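(* Let $p\in(0,\tfrac12)$ be a fixed constant. Then there exist constants $K_0,C_1,C_2>0$ such that for any $q>0$ and any $K\ge K_0$ one can find a random variable $\hat D\colon\Omega\to[0,\infty)$ such that, for $\mathbb P$-almost every $\underline\omega\in\Omega$, all $n\in\mathbb N$ and all mean-zero $\varphi,\psi\in H^1(\mathbb T^2)$, $$\left|\int_{\mathbb T^2}\varphi(x)\,\psi\circ f^n_{\underline\omega}(x)\,\mathrm dx\right|\le \hat D(\underline\omega)\exp\!\left(-\frac{C_1}{1+q}e^{-K^{265}}n\right)\|\varphi\|_{\dot H^1}\|\psi\|_{\dot H^1}.$$ Moreover, $\hat D$ satisfies the moment bound $\mathbb E[\hat D^q]\le C_2K^p$.
   Context: $\mathbb T^2=\mathbb R^2/(2\pi\mathbb Z)^2$. Let $\Omega_0=[0,2\pi)^2$ with the uniform probability measure $\mathbb P_0$, and let $(\Omega,\mathbb P)=(\Omega_0,\mathbb P_0)^{\mathbb N}$ be the product probability space, with elements $\underline\omega=(\omega_1,\omega_2,\dots)$, $\omega_i=(\omega_i^1,\omega_i^2)$ (so the $\omega_i$ are i.i.d. uniform on $[0,2\pi)^2$); $\mathbb E$ is expectation with respect to $\mathbb P$. For a parameter $K>0$ and $\omega=(\omega^1,\omega^2)\in\Omega_0$, the randomized Chirikov standard map $f_\omega\colon\mathbb T^2\to\mathbb T^2$ is $$f_\omega(x)=\begin{pmatrix}x_1+K\sin(x_2-\omega^1)\\ x_2+x_1+K\sin(x_2-\omega^1)-\omega^2\end{pmatrix}\pmod{2\pi}.$$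 Put $f^n_{\underline\omega}=f_{\omega_n}\circ\cdots\circ f_{\omega_1}$. (This is the time-$2n$ Lagrangian flow of the velocity field equal to $(K\sin(x_2-\omega_n^1),0)$ for $t\in[2n-2,2n-1)$ and to $(0,x_1-\omega_n^2)$ for $t\in[2n-1,2n)$, without diffusion.) For mean-zero $g$ with Fourier coefficients $\hat g_k$, $\|g\|_{\dot H^1}^2=\sum_{k\in\mathbb Z^2\setminus\{0\}}|k|^2|\hat g_k|^2$. *)

(* Defs.v *)
From HB Require Import structures.
From mathcomp Require Import all_boot all_order all_algebra.
From mathcomp Require Import complex.
From mathcomp Require Import all_classical all_reals all_analysis.

Set Implicit Arguments.
Unset Strict Implicit.
Unset Printing Implicit Defensive.

Import Order.TTheory GRing.Theory Num.Theory.
Import numFieldNormedType.Exports.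

Local Open Scope classical_set_scope.
Local Open Scope ring_scope.

Section Torus.
Variable R : realType.

(* R^2 with its Borel sigma-algebra. *)
Definition plane : Type := (measurableTypeR R * measurableTypeR R)%type.
HB.instance Definition _ := Measurable.on plane.

(* [0, 2 pi)^2 is both the sample space Omega_0 and the set of representatives
   of R^2 / (2 pi Z)^2: a function on the torus is a function on the plane of
   which only the values on this set are used, and maps of the torus are
   reduced modulo 2 pi into it. *)
Definition torus : set plane := `[0, 2 * pi[ `*` `[0, 2 * pi[.

Definition leb2 : {measure set plane -> \bar R} :=
  (@lebesgue_measure R \x @lebesgue_measure R)%E.

Definition uniform_torus (A : set plane) : \bar R :=
  (((2 * pi) ^- 2)%:E * leb2 (A `&` torus))%E.

Definition mod2pi (x : R) : R := x - 2 * pi * (Num.floor (x / (2 * pi)))%:~R.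

Definition chirikov (K : R) (w x : plane) : plane :=
  (mod2pi (x.1 + K * sin (x.2 - w.1)),
   mod2pi (x.2 + x.1 + K * sin (x.2 - w.1) - w.2)).

(* The noise omega_(i+1) of the usual 1-based indexing is w i. *)
Fixpoint chirikov_iter (K : R) (w : nat -> plane) (n : nat) (x : plane) :
    plane :=
  if n is m.+1 then chirikov K (w m) (chirikov_iter K w m x) else x.

Definition coordinate_cylinders : set (set (nat -> plane)) :=
  [set C | exists (i : nat) (A : set plane),
     measurable A /\ C = [set w | A (w i)]].

Definition noise : Type := g_sigma_algebraType coordinate_cylinders.
HB.instance Definition _ := Measurable.on noise.

(* The infinite product of the uniform measures: it is the unique probability
   measure on the product sigma-algebra with these finite-dimensional
   marginals.  It is supported on sequences with values in [0, 2 pi)^2. *)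
Definition is_uniform_product (P : probability noise R) : Prop :=
  forall (n : nat) (A : nat -> set plane), (forall i, measurable (A i)) ->
    P [set w : nat -> plane | forall i, (i < n)%N -> A i (w i)] =
    (\prod_(i < n) uniform_torus (A i))%E.

Definition dotk (k : int * int) (x : plane) : R :=
  k.1%:~R * x.1 + k.2%:~R * x.2.

(* (2 pi)^-1 \int g(x) e^(- i k.x) dx: the exponentials are normalized in
   L^2(torus, dx), so that the homogeneous norm below is the L^2(dx) norm of
   the gradient. *)
Definition fourier_coef (g : plane -> R) (k : int * int) : R[i] :=
  Complex ((2 * pi)^-1 * \int[leb2]_(x in torus) (g x * cos (dotk k x)))
          (- ((2 * pi)^-1 * \int[leb2]_(x in torus) (g x * sin (dotk k x)))).

Definition Hdot1_sq (g : plane -> R) : \bar R :=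
  (\esum_(k in [set k : int * int | k != (0%R, 0%R)])
     ((k.1%:~R ^+ 2 + k.2%:~R ^+ 2) *
      ComplexField.Normc.normc (fourier_coef g k) ^+ 2)%:E)%E.

Definition Hdot1_norm (g : plane -> R) : R := Num.sqrt (fine (Hdot1_sq g)).

Definition H1_mean_zero (g : plane -> R) : Prop :=
  [/\ measurable_fun torus g,
      leb2.-integrable torus (fun x => (g x ^+ 2)%:E),
      (Hdot1_sq g < +oo)%E &
      \int[leb2]_(x in torus) g x = 0].

End Torus.

Arguments torus {R}.
Arguments leb2 {R}.

(* Main.v *)
(** Write [A_n(k, l)] for the [l]-th Fourier coefficient of [e^(i k.f^n)].  By
Parseval the correlation is [sum psi_k phi_(-l) A_n(k, l)], so Cauchy-Schwarz
against the weights [|k| |l|] bounds it by the two H^1 norms times the square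
root of [S_n = sum |k|^-2 |l|^-2 |A_n(k, l)|^2], whose mean has to decay.

Averaging [|A_(n+1)(k, l)|^2] over the last noise decouples the frequencies:
the phase of the shear enters only through [sin (x_2 - w^1)], and the mean is
[sum_m J_m(t)^2 |A_n((k_1 + k_2, k_2 + m), l)|^2] with [t = K (k_1 + k_2)].
This is a Markov chain on Z^2 with transition probabilities [J_m(t)^2].
Since [|J_0(s)|] is small for large [s], the squared Bessel weights cannot
concentrate on an interval of length much smaller than [|t|], so that for
large [K] the frequency [|k_1 + k_2|] typically grows by a large factor.  A
Lyapunov function decaying like a small power of [1 / |k_1 + k_2|] is halved
in mean at each step, and [E S_n <= A 2^-n] with [A] independent of [K].

Then [X = sum_n (3/2)^n S_n] has mean at most [4 A], and the random constant is
[(1 + X)^theta] with [theta = 1 / (2 (1 + q))]: the correlation is at most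
[min(1, S_n)^(1/2) <= S_n^theta], and [theta q <= 1] bounds the [q]-th moment
by [1 + E X]. *)
Require Import Defs.
From HB Require Import structures.
From mathcomp Require Import all_boot all_order all_algebra.
From mathcomp Require Import complex.
From mathcomp Require Import all_classical all_reals all_analysis.
From mathcomp Require Import measurable_realfun.
From mathcomp Require Import ring lra zify.

Set Implicit Arguments.
Unset Strict Implicit.
Unset Printing Implicit Defensive.

Import Order.TTheory GRing.Theory Num.Theory.
Import numFieldNormedType.Exports.

Local Open Scope classical_set_scope.
Local Open Scope ring_scope.

(** * Bounded measurable functions *)

(** The squared modulus is a mean over pairs of points driven by the same noise. Averaging the phase
    of the shear turns the interaction of the pair into [Phi t y], that is J_0(2 t sin(y / 2)),
    whose Fourier coefficients are the J_m(t)^2. So J_0 is the only Bessel function to be estimated,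
    and the crude bound |J_0(s)| <= 6 s^(-1/4) suffices: a window of length at most rho^5 |t|
    carries weight at most 44 rho. This fixes the scale 4^5 = 1024: going down one scale divides the
    weight by 4 while the Lyapunov function only doubles, so the sum over scales is geometric. The
    Fourier series of [Phi] is never summed: Fejer means with an explicit error stand in for it, and
    the error tends to 0 at fixed time and frequency. Likewise every sum over modes is cut to a box,
    with bounds independent of the box, and the random constant is a monotone limit of truncations.
    The price is the L^2 density of trigonometric polynomials, built up from the indicator of an
    arc. Since S_n does not involve the test functions, one null set serves them all. *)

Section bounded_measurable.
Context d (T : measurableType d) (R : realType) (mu : probability T R).
Implicit Types f g : T -> R.

(** On a probability space such functions are integrable and closed under sums and products, so the
    real-valued integral is linear on them without further side conditions. *)
Definition bmeas d0 (T0 : measurableType d0) (f : T0 -> R) : Prop :=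
  measurable_fun [set: T0] f /\ exists M : R, forall x, `|f x| <= M.

Lemma bmeas_integrable f : bmeas f -> mu.-integrable setT (EFin \o f).
Proof.
move=> [mf [M fM]]; apply: measurable_bounded_integrable => //.
  exact: le_lt_trans (probability_le1 mu _) (ltry _).
by exists M; split; [exact: num_real | move=> x Mx t _ /=; exact: le_trans (fM t) (ltW Mx)].
Qed.

Lemma bmeas_cst (r : R) : bmeas (fun _ : T => r).
Proof. by split; [exact: measurable_cst | exists `|r|]. Qed.

Lemma bmeasD f g : bmeas f -> bmeas g -> bmeas (fun x => f x + g x).
Proof.
move=> [mf [M fM]] [mg [N gN]]; split; first exact: measurable_funD.
by exists (M + N) => x; apply: le_trans (ler_normD _ _) (lerD (fM x) (gN x)).
Qed.

Lemma bmeasM f g : bmeas f -> bmeas g -> bmeas (fun x => f x * g x).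
Proof.
move=> [mf [M fM]] [mg [N gN]]; split; first exact: measurable_funM.
by exists (M * N) => x; rewrite normrM ler_pM.
Qed.

Lemma bmeasN f : bmeas f -> bmeas (fun x => - f x).
Proof.
move=> bf; have := bmeasM (bmeas_cst (-1)) bf.
by under eq_fun do rewrite mulN1r.
Qed.

Lemma bmeasB f g : bmeas f -> bmeas g -> bmeas (fun x => f x - g x).
Proof. by move=> bf bg; apply: bmeasD => //; exact: bmeasN. Qed.

Lemma bmeas_norm f : bmeas f -> bmeas (fun x => `|f x|).
Proof.
move=> [mf [M fM]]; split; last by exists M => x; rewrite normr_id.
exact: measurableT_comp.
Qed.

Lemma bmeasX f n : bmeas f -> bmeas (fun x => f x ^+ n).
Proof.
move=> bf; elim: n => [|n IH]; first exact: bmeas_cst.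
by under eq_fun do rewrite exprS; exact: bmeasM.
Qed.

Lemma bmeas_sum (I : Type) (s : seq I) (P : pred I) (F : I -> T -> R) :
  (forall i, bmeas (F i)) -> bmeas (fun x => \sum_(i <- s | P i) F i x).
Proof.
move=> bF; elim: s => [|i s IH]; first by under eq_fun do rewrite big_nil; exact: bmeas_cst.
under eq_fun do rewrite big_cons.
by case: (P i) => //; exact: bmeasD.
Qed.

Lemma bmeas_cos f : measurable_fun setT f -> bmeas (fun x => cos (f x)).
Proof.
move=> mf; split; last by exists 1 => x; exact: cos_max.
by apply: measurableT_comp => //; apply: continuous_measurable_fun; exact: continuous_cos.
Qed.

Lemma bmeas_sin f : measurable_fun setT f -> bmeas (fun x => sin (f x)).
Proof.
move=> mf; split; last by exists 1 => x; exact: sin_max.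
by apply: measurableT_comp => //; apply: continuous_measurable_fun; exact: continuous_sin.
Qed.

Lemma RintD f g : bmeas f -> bmeas g ->
  \int[mu]_x (f x + g x) = \int[mu]_x f x + \int[mu]_x g x.
Proof. by move=> bf bg; rewrite RintegralD //; exact: bmeas_integrable. Qed.

Lemma RintB f g : bmeas f -> bmeas g ->
  \int[mu]_x (f x - g x) = \int[mu]_x f x - \int[mu]_x g x.
Proof. by move=> bf bg; rewrite RintegralB //; exact: bmeas_integrable. Qed.

Lemma RintZ r f : bmeas f -> \int[mu]_x (r * f x) = r * \int[mu]_x f x.
Proof. by move=> bf; rewrite RintegralZl //; exact: bmeas_integrable. Qed.

Lemma RintZr r f : bmeas f -> \int[mu]_x (f x * r) = \int[mu]_x f x * r.
Proof. by move=> bf; rewrite RintegralZr //; exact: bmeas_integrable. Qed.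

Lemma Rint_cst (r : R) : \int[mu]_x r = r.
Proof. by rewrite Rintegral_cst// [X in fine X]probability_setT mulr1. Qed.

Lemma Rint_sum (I : Type) (s : seq I) (P : pred I) (F : I -> T -> R) :
  (forall i, bmeas (F i)) ->
  \int[mu]_x (\sum_(i <- s | P i) F i x) = \sum_(i <- s | P i) \int[mu]_x F i x.
Proof.
move=> bF; elim: s => [|i s IH].
  by under eq_Rintegral do rewrite big_nil; rewrite Rint_cst big_nil.
under eq_Rintegral do rewrite big_cons.
rewrite big_cons; case: (P i) => //.
by rewrite RintD ?IH//; exact: bmeas_sum.
Qed.

Lemma ler_Rint f g : bmeas f -> bmeas g -> (forall x, f x <= g x) ->
  \int[mu]_x f x <= \int[mu]_x g x.
Proof.
by move=> bf bg fg; apply: le_Rintegral => //; exact: bmeas_integrable.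
Qed.

Lemma Rint_ge0 f : (forall x, 0 <= f x) -> 0 <= \int[mu]_x f x.
Proof. by move=> f0; apply: Rintegral_ge0. Qed.

Lemma norm_Rint f : bmeas f -> `|\int[mu]_x f x| <= \int[mu]_x `|f x|.
Proof. by move=> bf; apply: le_normr_Rintegral => //; exact: bmeas_integrable. Qed.

Lemma norm_Rint_le f M : bmeas f -> (forall x, `|f x| <= M) ->
  `|\int[mu]_x f x| <= M.
Proof.
move=> bf fM; apply: le_trans (norm_Rint bf) _.
rewrite -[leRHS]Rint_cst; apply: ler_Rint => //; first exact: bmeas_norm.
exact: bmeas_cst.
Qed.

Lemma EFin_Rint f : bmeas f -> (\int[mu]_x f x)%:E = (\int[mu]_x (f x)%:E)%E.
Proof.
move=> bf; rewrite /Rintegral fineK//; apply: integrable_fin_num => //.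
exact: bmeas_integrable.
Qed.

End bounded_measurable.

Lemma bmeas_comp d1 d2 (T1 : measurableType d1) (T2 : measurableType d2)
  (R : realType) (h : T1 -> T2) (f : T2 -> R) :
  measurable_fun setT h -> bmeas f -> bmeas (f \o h).
Proof.
move=> mh [mf [M fM]]; split; first exact: measurableT_comp.
by exists M => x; exact: fM.
Qed.

Lemma Rint_pushforward d1 d2 (T1 : measurableType d1) (T2 : measurableType d2)
  (R : realType) (mu : probability T1 R) (nu : probability T2 R) (h : T1 -> T2) (f : T2 -> R) :
  measurable_fun setT h -> (forall A, measurable A -> mu (h @^-1` A) = nu A) ->
  bmeas f -> \int[mu]_x f (h x) = \int[nu]_x f x.
Proof.
move=> mh hE bf; rewrite /Rintegral; congr fine.
have := @integral_pushforward _ _ _ _ _ h mh mu setT (EFin \o f).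
rewrite preimage_setT => <- //.
- by apply: eq_measure_integral => A mA _; exact: hE.
- by apply/measurable_EFinP; case: bf.
- by apply: (bmeas_integrable mu (f := f \o h)); exact: bmeas_comp.
Qed.

(** * Fubini for bounded functions on a product of probability spaces *)

Section Rfubini.
Context d1 d2 (T1 : measurableType d1) (T2 : measurableType d2) (R : realType)
  (m1 : probability T1 R) (m2 : probability T2 R).
Variable f : T1 * T2 -> R.
Hypothesis bf : bmeas f.

Let intf : (m1 \x m2)%E.-integrable setT (EFin \o f).
Proof. exact: (bmeas_integrable (m1 \x m2)%E bf). Qed.

Lemma bmeas_pair1 x : bmeas (fun y => f (x, y)).
Proof. by apply: (bmeas_comp (h := pair x)) => //; exact: measurable_pair1. Qed.

Lemma bmeas_pair2 y : bmeas (fun x => f (x, y)).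
Proof. by apply: (bmeas_comp (h := fun x => (x, y))) => //; exact: measurable_pair2. Qed.

Lemma bmeas_Rint1 : bmeas (fun x => \int[m2]_y f (x, y)).
Proof.
split; last first.
  case: (bf) => _ [M fM]; exists M => x; apply: norm_Rint_le => //.
  exact: bmeas_pair1.
apply/measurable_EFinP.
rewrite (_ : _ \o _ = fubini_F m2 (EFin \o f)); first exact: measurable_fubini_F intf.
by apply/funext => x /=; rewrite EFin_Rint//; exact: bmeas_pair1.
Qed.

Lemma bmeas_Rint2 : bmeas (fun y => \int[m1]_x f (x, y)).
Proof.
split; last first.
  case: (bf) => _ [M fM]; exists M => x; apply: norm_Rint_le => //.
  exact: bmeas_pair2.
apply/measurable_EFinP.
rewrite (_ : _ \o _ = fubini_G m1 (EFin \o f)); first exact: measurable_fubini_G intf.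
by apply/funext => x /=; rewrite EFin_Rint//; exact: bmeas_pair2.
Qed.

Lemma Rint_prod1 : \int[(m1 \x m2)%E]_z f z = \int[m1]_x \int[m2]_y f (x, y).
Proof.
apply: EFin_inj; etransitivity; first exact: (EFin_Rint (m1 \x m2)%E bf).
rewrite (EFin_Rint m1 bmeas_Rint1); etransitivity; first exact: esym (integral12_prod_meas1 intf).
apply: eq_integral => x _ /=.
by rewrite EFin_Rint//; exact: bmeas_pair1.
Qed.

Lemma Rint_prod2 : \int[(m1 \x m2)%E]_z f z = \int[m2]_y \int[m1]_x f (x, y).
Proof.
apply: EFin_inj; etransitivity; first exact: (EFin_Rint (m1 \x m2)%E bf).
rewrite (EFin_Rint m2 bmeas_Rint2); etransitivity; first exact: esym (integral21_prod_meas1 intf).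
apply: eq_integral => x _ /=.
by rewrite EFin_Rint//; exact: bmeas_pair2.
Qed.

Lemma Rint_swap : \int[m1]_x \int[m2]_y f (x, y) = \int[m2]_y \int[m1]_x f (x, y).
Proof. by rewrite -Rint_prod1 Rint_prod2. Qed.

End Rfubini.

(* [pushforward mu f] packed as a measure, which [lebesgue_measure_unique] expects. *)
Definition pushm d1 d2 (T1 : measurableType d1) (T2 : measurableType d2) (R : realType)
    (mu : {measure set T1 -> \bar R}) (f : T1 -> T2) (mf : measurable_fun setT f) :
    {measure set T2 -> \bar R} :=
  measure_function_pushforward__canonical__measure_function_Measure mu mf.

Lemma measurable_preimage d1 d2 (T1 : measurableType d1) (T2 : measurableType d2)
  (f : T1 -> T2) (A : set T2) :
  measurable_fun setT f -> measurable A -> measurable (f @^-1` A).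
Proof. by move=> mf mA; rewrite -[X in measurable X]setTI; exact: mf. Qed.

(** * The uniform probability on the circle *)

Section circle.
Variable R : realType.
Implicit Types (x y c : R) (A : set (measurableTypeR R)).

Lemma twopi_gt0 : 0 < 2 * pi :> R.
Proof. by rewrite mulr_gt0// pi_gt0. Qed.

Definition circ : probability (measurableTypeR R) R := uniform_prob twopi_gt0.

Lemma lebesgue_shift A c : measurable A ->
  lebesgue_measure ((fun x => x + c) @^-1` A) = lebesgue_measure A.
Proof.
have mc : measurable_fun setT (fun x : measurableTypeR R => x + c : measurableTypeR R).
  exact: measurable_funD.
move=> mA; symmetry.
apply: (@lebesgue_measure_unique _ (pushm lebesgue_measure mc) _ _ mA) => X.
move=> [[a b] /= _ <-]; rewrite /pushm/= /pushforward.
have -> : (fun x => x + c) @^-1` `]a, b] = `](a - c), (b - c)]%classic.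
  by apply/seteqP; split => x /=; rewrite !in_itv/= ltrBlDr lerBrDr.
by rewrite !lebesgue_measure_itv/= !lte_fin ltrD2r; case: ifP => // _; rewrite -!EFinB; congr EFin; ring.
Qed.

(** [uniform_prob] integrates over the closed interval; dropping the endpoint matches the
    fundamental domain used by [torus]. *)
Lemma integral_circ (f : R -> \bar R) : measurable_fun setT f -> (forall x, 0 <= f x)%E ->
  (\int[circ]_x f x = ((2 * pi)^-1)%:E * \int[lebesgue_measure]_(x in `[0%R, (2 * pi)%R[) f x)%E.
Proof.
move=> mf f0; rewrite /circ integral_uniform// subr0; congr (_ * _)%E.
by rewrite [RHS]integral_itv_bndo_bndc//; exact: measurable_funTS.
Qed.

Lemma circE A : measurable A ->
  circ A = (((2 * pi)^-1)%:E * lebesgue_measure (A `&` `[0%R, (2 * pi)%R[))%E.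
Proof.
move=> mA; rewrite -[A in LHS]setIT -integral_indic// integral_circ ?integral_indic//.
by apply/measurable_EFinP; exact: measurable_indic.
Qed.

Lemma mod2pi_int x : exists k : int, mod2pi x = x - 2 * pi * k%:~R.
Proof. by eexists. Qed.

Lemma mod2pi_itv x : 0 <= mod2pi x < 2 * pi.
Proof.
have tp := twopi_gt0.
rewrite /mod2pi; have /andP[h1 h2] := floor_itv (x / (2 * pi)).
move: h1; rewrite ler_pdivlMr// => h1; move: h2; rewrite ltr_pdivrMr// => h2.
rewrite intrD in h2.
by apply/andP; split; lra.
Qed.

Lemma mod2pi_uniq x y (k : int) : 0 <= y < 2 * pi -> x = y + 2 * pi * k%:~R ->
  mod2pi x = y.
Proof.
move=> /andP[y0 y1] ->; have tp := twopi_gt0.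
rewrite /mod2pi (_ : Num.floor _ = k); first by ring.
apply/floor_def; rewrite intrD ler_pdivlMr// ltr_pdivrMr//.
by apply/andP; split; lra.
Qed.

Lemma mod2pi_addl x c : mod2pi (mod2pi x + c) = mod2pi (x + c).
Proof.
have [k ->] := mod2pi_int x.
have [j jE] := mod2pi_int (x + c).
apply: (@mod2pi_uniq _ _ (j - k)); first exact: mod2pi_itv.
by rewrite jE intrD mulrNz; ring.
Qed.

Lemma mod2pi_id x : 0 <= x < 2 * pi -> mod2pi x = x.
Proof. by move=> h; apply: (@mod2pi_uniq _ _ 0) => //; rewrite mulr0 addr0. Qed.

Lemma measurable_mod2pi : measurable_fun setT (@mod2pi R).
Proof.
apply: measurable_funB => //; apply: measurable_funM => //.
rewrite (_ : (fun _ => _) = (fun x : R => (Num.floor x)%:~R) \o (fun x => x / (2 * pi)))//.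
apply: measurableT_comp; last exact: measurable_funM.
by apply: nondecreasing_measurable => // x y xy; rewrite ler_int le_floor.
Qed.

(** Once [c] is reduced modulo [2 * pi], the preimage in the fundamental domain splits into two
    translated pieces of [A], according to whether [x + c] wraps around. *)
Lemma circ_shift A c : measurable A ->
  circ ((fun x => mod2pi (x + c)) @^-1` A) = circ A.
Proof.
move=> mA; have tp := twopi_gt0.
wlog: c / 0 <= c < 2 * pi => [H|/andP[c0 c1]].
  rewrite -(H (mod2pi c)); last exact: mod2pi_itv.
  by congr (circ _); apply/seteqP; split => x /=; rewrite (addrC x (mod2pi c)) mod2pi_addl (addrC c).
have mf : measurable_fun setT (fun x : measurableTypeR R => mod2pi (x + c) : measurableTypeR R).
  by apply: (measurableT_comp measurable_mod2pi); exact: measurable_funD.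
rewrite !circE//; last exact: measurable_preimage.
congr (_ * _)%E.
pose A1 := A `&` `[c, (2 * pi)%R[; pose A2 := A `&` `[0%R, c[.
have mA1 : measurable A1 by apply: measurableI => //; exact: measurable_itv.
have mA2 : measurable A2 by apply: measurableI => //; exact: measurable_itv.
have msh r (B : set (measurableTypeR R)) : measurable B ->
    measurable ((fun x => x + r) @^-1` B).
  by move=> mB; apply: measurable_preimage => //; exact: measurable_funD.
rewrite (_ : _ `&` _ = ((fun x => x + c) @^-1` A1) `|` ((fun x => x + (c - 2 * pi)) @^-1` A2));
    last first.
  apply/seteqP; split => x; rewrite /A1 /A2 /preimage/= !in_itv/=.
    move=> [Ax /andP[x0 x1]]; case: (ltP (x + c) (2 * pi)) => h.
      left; rewrite mod2pi_id in Ax; last by apply/andP; split; lra.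
      by split => //; apply/andP; split; lra.
    right; have E : mod2pi (x + c) = x + (c - 2 * pi).
      by apply: (@mod2pi_uniq _ _ 1); [apply/andP; split; lra| rewrite mulr1; ring].
    by rewrite E in Ax; split => //; apply/andP; split; lra.
  move=> [[Ax /andP[x0 x1]]|[Ax /andP[x0 x1]]].
    rewrite mod2pi_id; last by apply/andP; split; lra.
    by split => //; apply/andP; split; lra.
  have -> : mod2pi (x + c) = x + (c - 2 * pi).
    by apply: (@mod2pi_uniq _ _ 1); [apply/andP; split; lra| rewrite mulr1; ring].
  by split => //; apply/andP; split; lra.
rewrite measureU//; [|exact: msh|exact: msh|]; last first.
  rewrite -subset0 => x; rewrite /A1 /A2 /preimage/= !in_itv/=.
  by move=> [[_ /andP[? ?]] [_ /andP[? ?]]]; lra.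
rewrite [X in (X + _)%E](lebesgue_shift _ mA1) [X in (_ + X)%E](lebesgue_shift _ mA2) -measureU//; last first.
  rewrite -subset0 => x; rewrite /A1 /A2 /= !in_itv/=.
  by move=> [[_ /andP[? ?]] [_ /andP[? ?]]]; lra.
congr (lebesgue_measure _); rewrite /A1 /A2; apply/seteqP; split => x/=; rewrite !in_itv/=.
  by move=> [[Ax /andP[? ?]]|[Ax /andP[? ?]]]; split => //; apply/andP; split; lra.
move=> [Ax /andP[? ?]]; case: (ltP x c) => h; [right|left]; by split => //; apply/andP; split; lra.
Qed.

Lemma Rint_circ_shift (f : R -> R) c : bmeas (f : measurableTypeR R -> R) ->
  (forall x, f (mod2pi x) = f x) -> \int[circ]_x f (x + c) = \int[circ]_x f x.
Proof.
move=> bf fE.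
have mf : measurable_fun setT (fun x : measurableTypeR R => mod2pi (x + c) : measurableTypeR R).
  by apply: (measurableT_comp measurable_mod2pi); exact: measurable_funD.
rewrite -(Rint_pushforward (mu := circ) (nu := circ) mf _ bf); last by move=> A mA; exact: circ_shift.
by apply: eq_Rintegral => x _; rewrite fE.
Qed.

Lemma cosDint x (k : int) : cos (x + 2 * pi * k%:~R) = cos x.
Proof.
have H (n : nat) (a : R) : cos (a + 2 * pi * n%:R) = cos a.
  rewrite (_ : a + _ = a + pi *+ 2 *+ n); first exact: (periodicn (@cosD2pi R)).
  by rewrite -(mulr_natr pi 2) -(mulr_natr (pi * 2%:R)) (mulrC pi).
case: k => n; first by rewrite -pmulrn H.
by rewrite -(H n.+1) NegzE mulrNz -pmulrn mulrN addrNK.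
Qed.

Lemma sinDint x (k : int) : sin (x + 2 * pi * k%:~R) = sin x.
Proof.
rewrite -[LHS]opprK -[in LHS]cosDpihalf -[RHS]opprK -cosDpihalf.
by rewrite addrAC cosDint.
Qed.

Lemma cosM_mod2pi x y (k : int) : cos (k%:~R * mod2pi x + y) = cos (k%:~R * x + y).
Proof.
have [j ->] := mod2pi_int x.
rewrite -[RHS](cosDint _ (- (k * j))); congr cos.
by rewrite mulrNz intrM; ring.
Qed.

Lemma cos_mod2pi x : cos (mod2pi x) = cos x.
Proof. by have := cosM_mod2pi x 0 1; rewrite !mul1r !addr0. Qed.

Lemma sin_mod2pi x : sin (mod2pi x) = sin x.
Proof.
rewrite -!cosBpihalf; have := cosM_mod2pi x (- (pi / 2)) 1.
by rewrite !mul1r.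
Qed.

End circle.

(** * Bessel functions and Fejer summation *)

Section oscillatory.
Variable R : realType.

Lemma Rint_circ_FTC (F f : R -> R) : (forall x : R, is_derive x (1 : R) F (f x)) ->
  continuous f -> (exists M, forall x, `|f x| <= M) ->
  \int[circ R]_x f x = (2 * pi)^-1 * (F (2 * pi) - F 0).
Proof.
move=> dF cf [M fM]; have tp := twopi_gt0 R.
have mf : measurable_fun setT f by exact: continuous_measurable_fun.
have bf : bmeas (f : measurableTypeR R -> R) by split => //; exists M.
(* [integral_uniform] is applied to a nonnegative integrand, so [f] is raised by its bound [M] and
   its primitive by [M * x]. *)
have dG' (x : R) : is_derive x (1 : R) (fun x => F x + M * x) (f x + M).
  have dMx : is_derive x (1 : R) (fun x => M * x) M.
    by have := is_deriveZ M (is_derive_id x (1 : R)); rewrite [M *: _]mulr1.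
  exact: is_deriveD.
suff H : \int[circ R]_x (f x + M) = (2 * pi)^-1 * (F (2 * pi) - F 0) + M.
  by move: H; rewrite RintD//; [rewrite Rint_cst => /addIr|exact: bmeas_cst].
apply: EFin_inj; rewrite EFin_Rint; last by apply: bmeasD => //; exact: bmeas_cst.
rewrite /circ integral_uniform; first last.
- by move=> x; rewrite lee_fin -lerBlDr sub0r; have := fM x; rewrite ler_norml => /andP[].
- by apply/measurable_EFinP; exact: measurable_funD.
rewrite (@continuous_FTC2 _ (fun x => f x + M) (fun x => F x + M * x)).
- rewrite -!EFinB -EFinM; congr EFin; rewrite subr0.
  have tn : 2 * pi != 0 :> R by rewrite gt_eqF.
  by set t := 2 * pi in tn *; field.
- exact: tp.
- by apply: continuous_subspaceT => x; apply: cvgD; [exact: cf|exact: cvg_cst].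
- have dG (x : R) : derivable (fun x => F x + M * x) x 1 by case: (dG' x).
  have cG : continuous (fun x => F x + M * x).
    by move=> x; apply: differentiable_continuous; apply/derivable1_diffP; exact: dG.
  by split => //; [exact: cvg_at_right_filter (cG _)|exact: cvg_at_left_filter (cG _)].
- move=> x _; rewrite derive1E; exact: (@derive_val _ _ _ _ _ _ _ (dG' x)).
Qed.

Lemma derivable_continuous (f df : R -> R) :
  (forall x : R, is_derive x (1 : R) f (df x)) -> continuous f.
Proof.
move=> H x; apply: differentiable_continuous; apply/derivable1_diffP.
by case: (H x).
Qed.

Lemma is_derive_sin_lin (a c x : R) :
  is_derive x (1 : R) (fun y => sin (a * y + c)) (a * cos (a * x + c)).
Proof.
have dl : is_derive x (1 : R) (fun y => a * y + c) a.
  have := is_deriveD (is_deriveZ a (is_derive_id x (1 : R))) (is_derive_cst c x (1 : R)).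
  by rewrite [a *: _]mulr1 addr0.
by rewrite mulrC; apply: is_derive1_comp.
Qed.

Lemma is_derive_cos_lin (a c x : R) :
  is_derive x (1 : R) (fun y => cos (a * y + c)) (- a * sin (a * x + c)).
Proof.
have dl : is_derive x (1 : R) (fun y => a * y + c) a.
  have := is_deriveD (is_deriveZ a (is_derive_id x (1 : R))) (is_derive_cst c x (1 : R)).
  by rewrite [a *: _]mulr1 addr0.
rewrite (_ : - a * _ = - sin (a * x + c) * a); last by ring.
exact: is_derive1_comp.
Qed.

Lemma Rint_circ_cos (m : int) (c : R) :
  \int[circ R]_y cos (m%:~R * y + c) = if m == 0 then cos c else 0.
Proof.
case: eqP => [->|/eqP m0].
  by under eq_Rintegral do rewrite mul0r add0r; rewrite Rint_cst.
have mR : m%:~R != 0 :> R by rewrite intr_eq0.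
have dF (x : R) : is_derive x (1 : R) (fun y => m%:~R^-1 * sin (m%:~R * y + c)) (cos (m%:~R * x + c)).
  have := is_deriveZ m%:~R^-1 (is_derive_sin_lin m%:~R c x).
  by rewrite /GRing.scale/= mulrA mulVf// mul1r.
rewrite (Rint_circ_FTC dF).
- by rewrite mulr0 add0r (_ : _ + c = c + 2 * pi * m%:~R); [rewrite sinDint subrr mulr0|ring].
- by apply: derivable_continuous => x; exact: is_derive_cos_lin.
- by exists 1 => x; exact: cos_max.
Qed.

Lemma lipschitz_of_deriv (f df : R -> R) (M : R) :
  (forall x : R, is_derive x (1 : R) f (df x)) -> (forall x, `|df x| <= M) ->
  forall x y, `|f y - f x| <= M * `|y - x|.
Proof.
move=> dF dM x y.
wlog xy : x y / x < y => [H|].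
  case: (ltgtP x y) => [/H//|yx|->]; last by rewrite !subrr normr0 mulr0.
  by rewrite distrC (distrC y); exact: H.
have [c _ ->] := @MVT R f df x y xy (fun z _ => dF z)
  (continuous_subspaceT (derivable_continuous dF)).
by rewrite normrM ler_wpM2r.
Qed.

Lemma lipschitz_sin (x y : R) : `|sin y - sin x| <= `|y - x|.
Proof.
rewrite -[leRHS]mul1r; apply: (@lipschitz_of_deriv sin cos) => z; exact: cos_max.
Qed.

Lemma lipschitz_cos (x y : R) : `|cos y - cos x| <= `|y - x|.
Proof.
rewrite -[leRHS]mul1r; apply: (@lipschitz_of_deriv cos (fun x => - sin x)) => z.
by rewrite normrN; exact: sin_max.
Qed.

Lemma cos_ge_quad (x : R) : 1 - x ^+ 2 / 2 <= cos x.
Proof.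
rewrite {2}(_ : x = (x / 2) *+ 2); last by rewrite -mulr_natr divfK// pnatr_eq0.
rewrite cos_mulr2n cos2sin2.
have : sin (x / 2) ^+ 2 <= (x / 2) ^+ 2.
  rewrite -(real_normK (num_real (sin _))) -(real_normK (num_real (x / 2))) lerXn2r ?nnegrE//.
  by have := lipschitz_sin 0 (x / 2); rewrite sin0 !subr0.
by rewrite exprMn -mulr_natr; lra.
Qed.

(** Up to 1 the cosine is at least 1/2, so the mean value theorem gives [sin y >= y / 2]. Beyond 1,
    monotonicity gives [sin x >= sin 1 >= 1/2], and [x / 4 < 1/2] because [pi / 2 < 2]. *)
Lemma sin_ge_lin (x : R) : 0 <= x <= pi / 2 -> x / 4 <= sin x.
Proof.
move=> /andP[x0 x1].
have small (y : R) : 0 <= y <= 1 -> y / 2 <= sin y.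
  move=> /andP[]; rewrite le_eqVlt => /predU1P[<- _|y0 y1]; first by rewrite sin0 mul0r.
  have [c] := @MVT R sin cos 0 y y0 (fun z _ => is_derive_sin z) (continuous_subspaceT (@continuous_sin R)).
  rewrite in_itv/= sin0 !subr0 => /andP[c0 cy] ->.
  rewrite mulrC ler_wpM2r//; first exact: ltW.
  have := cos_ge_quad c.
  have : c ^+ 2 <= 1 by rewrite expr_le1// ltW//; lra.
  lra.
case: (leP x 1) => [xl1|xg1]; first by have := small x; rewrite x0 xl1 => /(_ isT); lra.
have : sin 1 <= sin x.
  rewrite ltW// ltr_sin// in_itv/=; have := pihalf_ge1 R; have := pi_gt0 R => *;
    by apply/andP; split; lra.
have := small 1; rewrite ler01 lexx => /(_ isT); have := pihalf_lt2 R; lra.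
Qed.

Lemma abs_sin_lt_cover (r x : R) : 0 <= x < 2 * pi -> `|sin x| < r ->
  [\/ 0 <= x <= 4 * r, pi - 4 * r <= x <= pi, pi <= x <= pi + 4 * r |
     2 * pi - 4 * r <= x <= 2 * pi].
Proof.
have half (y : R) : 0 <= y <= pi -> `|sin y| < r -> y <= 4 * r \/ pi - 4 * r <= y.
  move=> /andP[y0 y1] sr.
  have {}sr : sin y < r := le_lt_trans (ler_norm _) sr.
  case: (leP y (pi / 2)) => h; [left|right].
    by have := @sin_ge_lin y; rewrite y0 h => /(_ isT); lra.
  have := @sin_ge_lin (pi - y).
  rewrite sinB sinpi cospi mul0r mulN1r sub0r opprK => H.
  have : (pi - y) / 4 <= sin y by apply: H; apply/andP; split; lra.
  lra.
move=> /andP[x0 x1] sr; case: (leP x pi) => h.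
  case: (half x) => //; first by rewrite x0 h.
    by move=> ?; constructor 1; rewrite x0.
  by move=> ?; constructor 2; apply/andP; split.
have sE : sin (x - pi) = - sin x by rewrite sinB sinpi cospi mulrN1 mulr0 subr0.
case: (half (x - pi)) => //; first by apply/andP; split; lra.
- by rewrite sE normrN.
- by move=> ?; constructor 3; apply/andP; split; lra.
- by move=> ?; constructor 4; apply/andP; split; lra.
Qed.

Lemma measurable_small_sin (r : R) :
  measurable ([set x | `|sin x| < r] : set (measurableTypeR R)).
Proof.
rewrite -[X in measurable X]setTI.
apply: (measurable_fun_ltr (f := fun x : measurableTypeR R => `|sin x|) (g := cst r)) => //;
  try exact: measurableT.
apply: measurableT_comp => //; apply: continuous_measurable_fun; exact: continuous_sin.
Qed.

(** Four intervals of length [4 * r] cover the set, and [16 * r / (2 * pi) <= 4 * r] since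
    [pi >= 2]. *)
Lemma Rint_small_sin (r : R) : 0 < r ->
  \int[circ R]_x \1_[set x | `|sin x| < r] x <= 4 * r.
Proof.
move=> r0; set A := [set x | _]; have tp := twopi_gt0 R.
have mA : measurable (A : set (measurableTypeR R)) by exact: measurable_small_sin.
have bA : bmeas (\1_A : measurableTypeR R -> R).
  split; first exact: measurable_indic.
  by exists 1 => x; rewrite indicE; case: (_ \in _); rewrite ?normr1 ?normr0.
rewrite -lee_fin EFin_Rint// (_ : (\int[circ R]_x (\1_A x)%:E)%E = circ R A); last first.
  by rewrite integral_indic// setIT.
rewrite circE//.
have I0 : (0 <= 4 * r) by lra.
pose I1 := `[0, 4 * r]%classic : set R; pose I2 := `[pi - 4 * r, pi]%classic : set R.
pose I3 := `[pi, pi + 4 * r]%classic : set R.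
pose I4 := `[2 * pi - 4 * r, 2 * pi]%classic : set R.
have lI (a : R) : lebesgue_measure (`[a, a + 4 * r]%classic : set R) = (4 * r)%:E.
  rewrite lebesgue_measure_itv/= lte_fin ltrDl (_ : 0 < 4 * r); last by lra.
  by rewrite -EFinB; congr EFin; ring.
have H : (lebesgue_measure (A `&` `[0%R, (2 * pi)%R[) <= (16 * r)%:E)%E.
  apply: (@le_trans _ _ (lebesgue_measure (I1 `|` I2 `|` (I3 `|` I4)))).
    apply: le_measure; rewrite ?inE.
    - by apply: measurableI => //; exact: measurable_itv.
    - by apply: measurableU; apply: measurableU; exact: measurable_itv.
    - move=> x [Ax]; rewrite /I1 /I2 /I3 /I4/= !in_itv/= => xI.
      by have [] := abs_sin_lt_cover xI Ax => ?; [left; left|left; right|right; left|right;right].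
  have m4 : measurable I1 /\ measurable I2 /\ measurable I3 /\ measurable I4.
    by do !split; exact: measurable_itv.
  case: m4 => m1 [m2 [m3 m4]].
  apply: le_trans (measureU2 _ _ _) _; [exact: measurableU|exact: measurableU|].
  rewrite (_ : 16 * r = (4 * r + 4 * r) + (4 * r + 4 * r)); last by ring.
  rewrite EFinD; apply: leeD; (apply: le_trans (measureU2 _ _ _) _ => //; rewrite EFinD; apply: leeD).
  - by have := lI 0; rewrite add0r => h; rewrite [X in (X <= _)%E]h.
  - by have := lI (pi - 4 * r); rewrite subrK => h; rewrite [X in (X <= _)%E]h.
  - by rewrite [X in (X <= _)%E]lI.
  - by have := lI (2 * pi - 4 * r); rewrite subrK => h; rewrite [X in (X <= _)%E]h.
apply: (@le_trans _ _ (((2 * pi)^-1)%:E * (16 * r)%:E)%E).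
  by apply: lee_wpmul2l => //; rewrite lee_fin invr_ge0 ltW.
rewrite -EFinM lee_fin mulrC ler_pdivrMr//.
have := pi_ge2 R => pi2; have : 0 <= r * (pi - 2) by rewrite mulr_ge0 ?subr_ge0// ltW.
lra.
Qed.

(** The Bessel function J_0. *)
Definition bessel0 (s : R) : R := \int[circ R]_x cos (s * cos x).

Lemma measurable_cosR : measurable_fun setT (@cos R : measurableTypeR R -> R).
Proof. by apply: continuous_measurable_fun; exact: continuous_cos. Qed.

Lemma measurable_sinR : measurable_fun setT (@sin R : measurableTypeR R -> R).
Proof. by apply: continuous_measurable_fun; exact: continuous_sin. Qed.

(** Integration by parts would divide by the derivative [- s * sin x] of the phase; its zeros are
    regularised by putting [sin x * u x] for [1 / sin x]. Since [G] is periodic, [G'] has mean zero,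
    and [bessel0 s] is the sum of two terms. The first is at most [1 / (s * D) <= r]. The second is
    the mean of [cos (s * cos x) * (D * u x)], where [D * u x] is at most [r] if [|sin x| >= r] and
    at most 1 on the remaining set, of measure at most [4 * r]. The choice [D = r ^+ 3] balances the
    two. *)
Lemma bessel0_le (r s : R) : 0 < r -> r ^- 4 <= s -> `|bessel0 s| <= 6 * r.
Proof.
move=> r0 rs; pose D := r ^+ 3; have D0 : 0 < D by rewrite exprn_gt0.
have s0 : 0 < s by apply: lt_le_trans rs; rewrite invr_gt0 exprn_gt0.
pose u x : R := (sin x ^+ 2 + D)^-1.
have v0 x : 0 < sin x ^+ 2 + D by rewrite ltr_wpDl// sqr_ge0.
have u0 x : 0 < u x by rewrite invr_gt0.
have uD x : u x <= D^-1 by rewrite lef_pV2 ?posrE// lerDr sqr_ge0.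
pose g x := cos x * (D - sin x ^+ 2) * u x ^+ 2.
pose G x := sin (s * cos x) * (sin x * u x).
pose G' x := sin (s * cos x) * g x - s * (cos (s * cos x) * (1 - D * u x)).
have dsc (x : R) : is_derive x (1 : R) (fun x => sin (s * cos x)) (cos (s * cos x) * (- s * sin x)).
  have dl : is_derive x (1 : R) (fun y => s * cos y) (- s * sin x).
    by have := is_deriveZ s (is_derive_cos x); rewrite /GRing.scale/= mulrN mulNr.
  exact: is_derive1_comp.
have dcc (x : R) : is_derive x (1 : R) (fun x => cos (s * cos x)) (- sin (s * cos x) * (- s * sin x)).
  have dl : is_derive x (1 : R) (fun y => s * cos y) (- s * sin x).
    by have := is_deriveZ s (is_derive_cos x); rewrite /GRing.scale/= mulrN mulNr.
  exact: is_derive1_comp.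
have du (x : R) : is_derive x (1 : R) u (- u x ^+ 2 * (2 * sin x * cos x)).
  have dw : is_derive x (1 : R) (fun x => sin x ^+ 2 + D) (2 * sin x * cos x).
    have := is_deriveD (is_deriveM (is_derive_sin x) (is_derive_sin x)) (is_derive_cst D x (1 : R)).
    rewrite addr0 /GRing.scale/= (_ : sin x * cos x + _ = 2 * sin x * cos x); last by ring.
    by under [fun x => sin x ^+ 2 + D]eq_fun do rewrite expr2.
  have := @is_deriveV R (fun x => sin x ^+ 2 + D) x _ 1 (lt0r_neq0 (v0 x)) dw; rewrite /GRing.scale/=.
  by rewrite /u exprVn.
have dG (x : R) : is_derive x (1 : R) G (G' x).
  have := is_deriveM (dsc x) (is_deriveM (is_derive_sin x) (du x)).
  move=> H; apply: (is_derive_eq H); rewrite /GRing.scale/=.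
  rewrite [(sin * u) x](_ : _ = sin x * u x)//.
  have := mulVf (lt0r_neq0 (v0 x)); rewrite -/(u x) => uE.
  apply/eqP; rewrite -subr_eq0; apply/eqP.
  transitivity ((sin (s * cos x) * cos x * u x + s * cos (s * cos x)) *
                (1 - u x * (sin x ^+ 2 + D))); last by rewrite uE subrr mulr0.
  by rewrite /G' /g; ring.
have gb x : `|g x| <= D^-1.
  rewrite /g expr2 !normrM -[leRHS]mul1r -mulrA; apply: ler_pM => //; first exact: cos_max.
  rewrite (ger0_norm (ltW (u0 x))) mulrA.
  rewrite -[leRHS]mul1r; apply: ler_pM => //; try by rewrite ?mulr_ge0// ltW.
  by rewrite -expr2 /u ler_pdivrMr// mul1r; apply: le_trans (ler_normB _ _) _; rewrite (ger0_norm (ltW D0)) ger0_norm ?sqr_ge0// addrC.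
have ms : measurable_fun setT (fun x : measurableTypeR R => s * cos x).
  by apply: measurable_funM => //; exact: measurable_cosR.
have mu : measurable_fun setT (u : measurableTypeR R -> R).
  by apply: continuous_measurable_fun; exact: derivable_continuous du.
have bu : bmeas (u : measurableTypeR R -> R).
  by split => //; exists D^-1 => x; rewrite ger0_norm// ltW.
have bg : bmeas (g : measurableTypeR R -> R).
  split; last by exists D^-1.
  apply: measurable_funM; last exact: measurable_funX.
  apply: measurable_funM; first exact: measurable_cosR.
  by apply: measurable_funB => //; apply: measurable_funX; exact: measurable_sinR.
have b1 : bmeas (fun x : measurableTypeR R => sin (s * cos x) * g x).
  by apply: bmeasM => //; exact: bmeas_sin.
have b2 : bmeas (fun x : measurableTypeR R => cos (s * cos x) * (1 - D * u x)).
  apply: bmeasM; first exact: bmeas_cos.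
  by apply: bmeasB; [exact: bmeas_cst|apply: bmeasM => //; exact: bmeas_cst].
have b3 : bmeas (fun x : measurableTypeR R => cos (s * cos x) * (D * u x)).
  by apply: bmeasM; [exact: bmeas_cos|apply: bmeasM => //; exact: bmeas_cst].
have cG' : continuous G'.
  have cu := derivable_continuous du; have csc := derivable_continuous dsc.
  have ccc := derivable_continuous dcc.
  move=> x; apply: cvgB.
    apply: cvgM; first exact: csc.
    apply: cvgM; last by under eq_fun do rewrite expr2; apply: cvgM; exact: cu.
    apply: cvgM; first exact: continuous_cos.
    apply: cvgB; first exact: cvg_cst.
    by under eq_fun do rewrite expr2; apply: cvgM; exact: continuous_sin.
  apply: cvgM; first exact: cvg_cst.
  apply: cvgM; first exact: ccc.
  by apply: cvgB; [exact: cvg_cst|apply: cvgM; [exact: cvg_cst|exact: cu]].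
have I0 : \int[circ R]_x (sin (s * cos x) * g x) =
          s * \int[circ R]_x (cos (s * cos x) * (1 - D * u x)).
  have := Rint_circ_FTC dG cG'.
  rewrite /G' RintB//; last by apply: bmeasM => //; exact: bmeas_cst.
  rewrite RintZ// /G.
  have -> : sin (2 * pi) = sin 0 :> R by have := sinDint (0 : R) 1; rewrite mulr1 add0r.
  rewrite sin0 !mul0r !mulr0 subrr mulr0 => H.
  apply/eqP; rewrite -subr_eq0; apply/eqP; apply: H.
  have [_ [M1 h1]] := b1; have [_ [M2 h2]] := b2.
  exists (M1 + s * M2) => x; apply: le_trans (ler_normB _ _) _; apply: lerD; first exact: h1.
  by rewrite normrM gtr0_norm// ler_wpM2l// ltW.
have E : bessel0 s = s^-1 * \int[circ R]_x (sin (s * cos x) * g x)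
      + \int[circ R]_x (cos (s * cos x) * (D * u x)).
  rewrite I0 mulrA mulVf ?gt_eqF// mul1r -RintD//; apply: eq_Rintegral => x _; ring.
have T1 : `|s^-1 * \int[circ R]_x (sin (s * cos x) * g x)| <= r.
  rewrite normrM gtr0_norm ?invr_gt0//.
  apply: (@le_trans _ _ (s^-1 * D^-1)).
    apply: ler_wpM2l; first by rewrite invr_ge0 ltW.
    apply: norm_Rint_le => // x.
    by rewrite normrM -[leRHS]mul1r; apply: ler_pM => //; exact: sin_max.
  rewrite -invfM invf_ple ?posrE ?mulr_gt0//.
  apply: (@le_trans _ _ (r ^- 4 * D)); last by rewrite ler_wpM2r// ltW.
  by rewrite /D exprS invfM mulfVK// expf_neq0// gt_eqF.
have bA : bmeas (\1_[set x | `|sin x| < r] : measurableTypeR R -> R).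
  split; first by apply: measurable_indic; exact: measurable_small_sin.
  by exists 1 => x; rewrite indicE; case: (_ \in _); rewrite ?normr1 ?normr0.
have T2 : `|\int[circ R]_x (cos (s * cos x) * (D * u x))| <= 5 * r.
  apply: le_trans (norm_Rint _ b3) _.
  apply: (@le_trans _ _ (\int[circ R]_x (\1_[set x | `|sin x| < r] x + r))).
    apply: ler_Rint; [exact: bmeas_norm|by apply: bmeasD => //; exact: bmeas_cst|move=> x].
    rewrite normrM -[leRHS]mul1r; apply: ler_pM => //; first exact: cos_max.
    rewrite ger0_norm; last by apply/ltW; exact: mulr_gt0.
    rewrite indicE; case: (ltP `|sin x| r) => h.
      rewrite mem_set//= -[leLHS]addr0; apply: lerD; last exact: ltW.
      by rewrite /u ler_pdivrMr// mul1r lerDr sqr_ge0.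
    rewrite memNset/=; last by apply/negP; rewrite -leNgt.
    rewrite add0r /u ler_pdivrMr// -ler_pdivrMl// [X in _ * X <= _]exprS mulKf ?gt_eqF//.
    apply: ler_wpDr; first by rewrite ltW// exprn_gt0.
    by rewrite -(real_normK (num_real (sin x))) lerXn2r ?nnegrE// ltW.
  rewrite RintD//; last exact: bmeas_cst.
  rewrite Rint_cst; have := Rint_small_sin r0; lra.
rewrite E; apply: le_trans (ler_normD _ _) _; lra.
Qed.

End oscillatory.

(** * Fejer means of the squared Bessel functions *)

Section fejer.
Variable R : realType.
Implicit Types (t x y z c A X Y : R) (m : int) (N : nat).

Lemma bessel0N t : bessel0 (- t) = bessel0 t.
Proof. by apply: eq_Rintegral => x _; rewrite mulNr cosN. Qed.

Lemma bessel0_norm t : bessel0 `|t| = bessel0 t.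
Proof. by case: (ger0P t) => // _; rewrite bessel0N. Qed.

Lemma bessel0_le1 t : `|bessel0 t| <= 1.
Proof.
apply: norm_Rint_le => [|x]; last exact: cos_max.
by apply: bmeas_cos; apply: measurable_funM => //; exact: measurable_cosR.
Qed.

Lemma Rint_circ_cos_cos A t c :
  \int[circ R]_v cos (A + t * cos (v + c)) = cos A * bessel0 t.
Proof.
have mc : measurable_fun setT (fun x : measurableTypeR R => t * cos x).
  by apply: measurable_funM => //; exact: measurable_cosR.
rewrite (Rint_circ_shift (f := fun v => cos (A + t * cos v))); first last.
- by move=> x; rewrite cos_mod2pi.
- by apply: bmeas_cos; exact: measurable_funD.
under eq_Rintegral do rewrite cosD.
have bc := bmeas_cos mc; have bs := bmeas_sin mc.
rewrite RintB//; first last.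
- by apply: bmeasM => //; exact: bmeas_cst.
- by apply: bmeasM => //; exact: bmeas_cst.
rewrite !RintZ//; have -> : \int[circ R]_x sin (t * cos x) = 0; last by rewrite mulr0 subr0.
have : \int[circ R]_x sin (t * cos (x + pi)) = \int[circ R]_x sin (t * cos x).
  rewrite (Rint_circ_shift (f := fun v => sin (t * cos v)))// => x.
  by rewrite cos_mod2pi.
under eq_Rintegral do rewrite cosDpi mulrN sinN -mulN1r.
rewrite RintZ//; lra.
Qed.

(** By Neumann's addition theorem this is the function with Fourier series sum_m J_m(t)^2 e^(i m y).
    It arises as the average over a common phase of exp(i t (sin X - sin Y)) at distance
    [X - Y = y]. *)
Definition Phi t y : R := bessel0 (2 * t * sin (y / 2)).

Lemma sinB_sinB X Y : sin X - sin Y = 2 * sin ((X - Y) / 2) * cos ((X + Y) / 2).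
Proof.
have -> : sin X = sin ((X + Y) / 2 + (X - Y) / 2) by congr sin; field.
have -> : sin Y = sin ((X + Y) / 2 - (X - Y) / 2) by congr sin; field.
by rewrite sinD sinB; ring.
Qed.

Lemma Rint_circ_phaseD A t X Y :
  \int[circ R]_v cos (A + t * (sin (X + v) - sin (Y + v))) = cos A * Phi t (X - Y).
Proof.
rewrite -(Rint_circ_cos_cos _ _ ((X + Y) / 2)); apply: eq_Rintegral => v _.
congr (cos (_ + _)); rewrite sinB_sinB (_ : X + v - (Y + v) = X - Y); last by ring.
rewrite (_ : (X + v + (Y + v)) / 2 = v + (X + Y) / 2); last by field.
by ring.
Qed.

Lemma Rint_circ_phaseB A t X Y :
  \int[circ R]_v cos (A + t * (sin (X - v) - sin (Y - v))) = cos A * Phi t (X - Y).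
Proof.
rewrite -(Rint_circ_cos_cos _ _ (- ((X + Y) / 2))); apply: eq_Rintegral => v _.
congr (cos (_ + _)); rewrite sinB_sinB (_ : X - v - (Y - v) = X - Y); last by ring.
rewrite (_ : (X - v + (Y - v)) / 2 = - (v - (X + Y) / 2)); last by field.
by rewrite cosN; ring.
Qed.

Lemma Phi_le1 t y : `|Phi t y| <= 1. Proof. exact: bessel0_le1. Qed.

(** Both values are phase averages of cosines, and the two phases differ by
    [t * (sin (x + v) - sin (y + v))], which is small uniformly in [v]. *)
Lemma Phi_lip t x y : `|Phi t x - Phi t y| <= 2 * `|t| * `|sin ((x - y) / 2)|.
Proof.
have m1 z : measurable_fun setT (fun v : measurableTypeR R => 0 + t * (sin (z + v) - sin (0 + v))).
  have ms w : measurable_fun setT (fun v : measurableTypeR R => sin (w + v)).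
    by apply: (measurableT_comp (@measurable_sinR R)); exact: measurable_funD.
  by apply: measurable_funD => //; apply: measurable_funM => //; exact: measurable_funB.
have PE z : Phi t z = \int[circ R]_v cos (0 + t * (sin (z + v) - sin (0 + v))).
  by rewrite Rint_circ_phaseD cos0 mul1r subr0.
rewrite !PE -RintB; [|exact: bmeas_cos|exact: bmeas_cos].
apply: norm_Rint_le => [|v]; first by apply: bmeasB; exact: bmeas_cos.
apply: le_trans (lipschitz_cos _ _) _.
rewrite (_ : _ - _ = t * (sin (x + v) - sin (y + v))); last by ring.
rewrite sinB_sinB normrM mulrAC -!mulrA mulrCA !normrM (ger0_norm (ler0n _ 2)).
rewrite (_ : x + v - (y + v) = x - y); last by ring.
rewrite [leLHS]mulrA [leLHS](_ : _ = `|t| * 2 * `|sin ((x - y) / 2)| * `|cos ((x + v + (y + v)) / 2)|); last by ring.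
rewrite mulrA (mulrC 2) -[leRHS]mulr1; apply: ler_wpM2l; last exact: cos_max.
by rewrite !mulr_ge0.
Qed.

Lemma measurable_Phi t : measurable_fun setT (Phi t : measurableTypeR R -> R).
Proof.
apply: (measurableT_comp (f := @bessel0 R) (g := fun y : measurableTypeR R => 2 * t * sin (y / 2))); last first.
  apply: measurable_funM => //; apply: (measurableT_comp (@measurable_sinR R)); exact: measurable_funM.
have bf : bmeas (fun p : measurableTypeR R * measurableTypeR R => cos (p.1 * cos p.2)).
  apply: bmeas_cos; apply: measurable_funM; first exact: measurable_fst.
  by apply: (measurableT_comp (@measurable_cosR R)); exact: measurable_snd.
by have [] := bmeas_Rint1 (circ R) (circ R) bf.
Qed.

Lemma bmeas_Phi t : bmeas (Phi t : measurableTypeR R -> R).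
Proof. by split; [exact: measurable_Phi|exists 1 => x; exact: Phi_le1]. Qed.

(** J_m(t)^2, encoded as the squared modulus of a Fourier coefficient of exp(i t sin x). *)
Definition bessel_sq t m : R :=
  (\int[circ R]_x cos (m%:~R * x + t * sin x)) ^+ 2 +
  (\int[circ R]_x sin (m%:~R * x + t * sin x)) ^+ 2.

Lemma bessel_sq_ge0 t m : 0 <= bessel_sq t m.
Proof. by rewrite addr_ge0 ?sqr_ge0. Qed.

(** Neumann's addition theorem, one coefficient at a time. With [Phi] written as a phase average
    over [z], the substitution [x = y + z] splits the double integral into a Fourier coefficient of
    exp(i t sin) times its conjugate. *)
Lemma Rint_Phi_cos t m c :
  \int[circ R]_y (Phi t y * cos (m%:~R * y + c)) = cos c * bessel_sq t m.
Proof.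
pose al x : R := m%:~R * x + t * sin x.
have mal : measurable_fun setT (al : measurableTypeR R -> R).
  by apply: measurable_funD; apply: measurable_funM => //; exact: measurable_sinR.
have bC := bmeas_cos mal; have bS := bmeas_sin mal.
pose g (p : measurableTypeR R * measurableTypeR R) :=
   cos (m%:~R * p.1 + c + t * (sin (p.1 + p.2) - sin (0 + p.2))).
have bg : bmeas g.
  apply: bmeas_cos; apply: measurable_funD.
    by apply: measurable_funD => //; apply: measurable_funM => //; exact: measurable_fst.
  apply: measurable_funM => //; apply: measurable_funB;
    apply: (measurableT_comp (@measurable_sinR R)); apply: measurable_funD => //;
    by [exact: measurable_fst | exact: measurable_snd].
transitivity (\int[circ R]_y \int[circ R]_z g (y, z)).
  by apply: eq_Rintegral => y _; rewrite /g/= Rint_circ_phaseD subr0 mulrC.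
rewrite Rint_swap//.
transitivity (\int[circ R]_z \int[circ R]_x (cos c * (cos (al x) * cos (al z) + sin (al x) * sin (al z)) 
   - sin c * (sin (al x) * cos (al z) - cos (al x) * sin (al z)))).
  apply: eq_Rintegral => z _.
  pose f x := cos (m%:~R * (x - z) + c + t * (sin x - sin z)).
  transitivity (\int[circ R]_y f (y + z)).
    by apply: eq_Rintegral => y _; rewrite /g /f/= add0r addrK.
  rewrite Rint_circ_shift.
  - by apply: eq_Rintegral => x _; rewrite -cosB -sinB -cosD; congr cos; rewrite /al; ring.
  - apply: bmeas_cos; apply: measurable_funD.
      by apply: measurable_funD => //; apply: measurable_funM => //; exact: measurable_funB.
    by apply: measurable_funM => //; apply: measurable_funB => //; exact: measurable_sinR.
  - move=> x; rewrite /f sin_mod2pi.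
    rewrite (_ : _ + _ = m%:~R * mod2pi x + (- (m%:~R * z) + c + t * (sin x - sin z))); last by ring.
    by rewrite cosM_mod2pi; congr cos; ring.
pose C := \int[circ R]_x cos (al x); pose S := \int[circ R]_x sin (al x).
transitivity (\int[circ R]_z (cos c * (C * cos (al z) + S * sin (al z)) 
   - sin c * (S * cos (al z) - C * sin (al z)))).
  apply: eq_Rintegral => z _.
  rewrite RintB; first last.
  - by apply: bmeasM; [exact: bmeas_cst|apply: bmeasB; apply: bmeasM => //; exact: bmeas_cst].
  - by apply: bmeasM; [exact: bmeas_cst|apply: bmeasD; apply: bmeasM => //; exact: bmeas_cst].
  rewrite !RintZ; first last.
  - by apply: bmeasD; apply: bmeasM => //; exact: bmeas_cst.
  - by apply: bmeasB; apply: bmeasM => //; exact: bmeas_cst.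
  rewrite RintB; [|by apply: bmeasM => //; exact: bmeas_cst..].
  rewrite RintD; [|by apply: bmeasM => //; exact: bmeas_cst..].
  by rewrite !RintZr.
rewrite RintB; first last.
- by apply: bmeasM; [exact: bmeas_cst|apply: bmeasB; apply: bmeasM => //; exact: bmeas_cst].
- by apply: bmeasM; [exact: bmeas_cst|apply: bmeasD; apply: bmeasM => //; exact: bmeas_cst].
rewrite !RintZ; first last.
- by apply: bmeasD; apply: bmeasM => //; exact: bmeas_cst.
- by apply: bmeasB; apply: bmeasM => //; exact: bmeas_cst.
rewrite RintB; [|by apply: bmeasM => //; exact: bmeas_cst..].
rewrite RintD; [|by apply: bmeasM => //; exact: bmeas_cst..].
by rewrite !RintZ// /bessel_sq -/C -/S; ring.
Qed.

(** The Fejer kernel as a double sum over differences: nonnegativity is that of a squared modulus,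
    and the triangular weights stay implicit. *)
Definition fejer N y : R :=
  N%:R^-1 * \sum_(a < N) \sum_(b < N) cos ((a%:Z - b%:Z)%:~R * y).

Lemma fejer_sqr N y : fejer N y =
  N%:R^-1 * ((\sum_(a < N) cos (a%:R * y)) ^+ 2 + (\sum_(a < N) sin (a%:R * y)) ^+ 2).
Proof.
congr (_ * _); rewrite !expr2 !big_distrlr/= -big_split/=; apply: eq_bigr => a _.
rewrite -big_split/=; apply: eq_bigr => b _.
by rewrite intrD mulrNz -!pmulrn mulrBl cosB.
Qed.

Lemma fejer_ge0 N y : 0 <= fejer N y.
Proof. by rewrite fejer_sqr mulr_ge0// ?invr_ge0// addr_ge0 ?sqr_ge0. Qed.

Lemma fejer_le N y : fejer N y <= N%:R.
Proof.
case: N => [|N]; first by rewrite /fejer big_ord0 mulr0.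
rewrite /fejer ler_pdivrMl ?ltr0n//.
apply: (@le_trans _ _ (\sum_(a < N.+1) \sum_(b < N.+1) (1 : R))).
  by apply: ler_sum => a _; apply: ler_sum => b _; exact: cos_le1.
by rewrite !sumr_const card_ord -[leLHS]mulr_natr.
Qed.

(** Multiplied by [2 * sin (y / 2)], the cosine and sine sums telescope, and together their squares
    stay below 4 whatever [N] is. *)
Lemma fejer_sin N y : fejer N y * sin (y / 2) ^+ 2 <= N%:R^-1.
Proof.
have Cs : 2 * sin (y / 2) * \sum_(a < N) cos (a%:R * y) =
    sin ((N%:R - 2^-1) * y) + sin (y / 2).
  elim: N => [|N IH]; first by rewrite big_ord0 mulr0 sub0r mulNr sinN mulrC addNr.
  rewrite big_ord_recr/= mulrDr IH.
  have -> : (N.+1%:R - 2^-1) * y = N%:R * y + y / 2 by rewrite -natr1; field.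
  have -> : (N%:R - 2^-1) * y = N%:R * y - y / 2 by field.
  by rewrite sinB sinD; ring.
have Ss : 2 * sin (y / 2) * \sum_(a < N) sin (a%:R * y) =
    cos (y / 2) - cos ((N%:R - 2^-1) * y).
  elim: N {Cs} => [|N IH]; first by rewrite big_ord0 mulr0 sub0r mulNr cosN mulrC subrr.
  rewrite big_ord_recr/= mulrDr IH.
  have -> : (N.+1%:R - 2^-1) * y = N%:R * y + y / 2 by rewrite -natr1; field.
  have -> : (N%:R - 2^-1) * y = N%:R * y - y / 2 by field.
  by rewrite cosB cosD; ring.
rewrite fejer_sqr -mulrA -[leRHS]mulr1 ler_wpM2l ?invr_ge0//.
set C := \sum_(a < N) cos _ in Cs *; set S := \sum_(a < N) sin _ in Ss *.
have : (2 * sin (y / 2) * C) ^+ 2 + (2 * sin (y / 2) * S) ^+ 2 <= 4.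
  rewrite Cs Ss; set u := (N%:R - 2^-1) * y; set v := y / 2.
  have -> : (sin u + sin v) ^+ 2 + (cos v - cos u) ^+ 2 =
      (cos u ^+ 2 + sin u ^+ 2) + (cos v ^+ 2 + sin v ^+ 2) - 2 * cos (u + v).
    by rewrite cosD; ring.
  by rewrite !cos2Dsin2; have := cos_geN1 (u + v); lra.
lra.
Qed.

Lemma bmeas_fejer N : bmeas (fejer N : measurableTypeR R -> R).
Proof.
apply: bmeasM; first exact: bmeas_cst.
by apply: bmeas_sum => a; apply: bmeas_sum => b; apply: bmeas_cos; exact: measurable_funM.
Qed.

Lemma Rint_fejer N : (0 < N)%N -> \int[circ R]_y fejer N y = 1.
Proof.
move=> N0; have bc (a b : 'I_N) : bmeas (fun y : measurableTypeR R => cos ((a%:Z - b%:Z)%:~R * y)).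
  by apply: bmeas_cos; exact: measurable_funM.
rewrite RintZ; last by apply: bmeas_sum => a; exact: bmeas_sum.
rewrite Rint_sum; last by move=> a; exact: bmeas_sum.
rewrite (eq_bigr (fun _ => 1)); first by rewrite sumr_const card_ord mulVf// pnatr_eq0 -lt0n.
move=> a _; rewrite Rint_sum// (bigD1 a)//= big1 ?addr0.
  by under eq_Rintegral do rewrite subrr mul0r cos0; rewrite Rint_cst.
move=> b ba; under eq_Rintegral do rewrite -[_ * _]addr0.
by rewrite Rint_circ_cos subr_eq0 eqz_nat val_eqE eq_sym (negbTE ba).
Qed.

Definition fejer_mean N t y : R :=
  N%:R^-1 * \sum_(a < N) \sum_(b < N) bessel_sq t (a%:Z - b%:Z) * cos ((a%:Z - b%:Z)%:~R * y).

Lemma fejer_mean_int N t y :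
  fejer_mean N t y = \int[circ R]_s (Phi t (s + y) * fejer N s).
Proof.
have bP := bmeas_Phi t.
have bPc (a b : 'I_N) y' : bmeas (fun s : measurableTypeR R => Phi t s * cos ((a%:Z - b%:Z)%:~R * s + y')).
  by apply: bmeasM => //; apply: bmeas_cos; apply: measurable_funD => //; exact: measurable_funM.
transitivity (\int[circ R]_s (Phi t s * fejer N (s - y))).
  transitivity (\int[circ R]_s (N%:R^-1 * \sum_(a < N) \sum_(b < N)
      Phi t s * cos ((a%:Z - b%:Z)%:~R * s + - ((a%:Z - b%:Z)%:~R * y)))).
    rewrite RintZ; last by apply: bmeas_sum => a; exact: bmeas_sum.
    rewrite Rint_sum; last by move=> a; exact: bmeas_sum.
    congr (_ * _); apply: eq_bigr => a _; rewrite Rint_sum//; apply: eq_bigr => b _.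
    by rewrite Rint_Phi_cos cosN mulrC.
  apply: eq_Rintegral => s _; rewrite /fejer mulrCA; congr (_ * _).
  rewrite mulr_sumr; apply: eq_bigr => a _; rewrite mulr_sumr; apply: eq_bigr => b _.
  by rewrite mulrBr.
rewrite -(@Rint_circ_shift R (fun s => Phi t s * fejer N (s - y)) y).
- by apply: eq_Rintegral => s _; rewrite addrK.
- apply: bmeasM => //.
  by apply: (bmeas_comp (h := fun s : measurableTypeR R => s - y : measurableTypeR R)) (bmeas_fejer N); exact: measurable_funB.
- move=> s; congr (_ * _).
    have H z : Phi t z = \int[circ R]_v cos (0 + t * (sin (z + v) - sin (0 + v))).
      by rewrite Rint_circ_phaseD cos0 mul1r subr0.
    rewrite !H; apply: eq_Rintegral => v _; congr (cos (_ + _ * (_ - _))).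
    by rewrite -[LHS]sin_mod2pi mod2pi_addl sin_mod2pi.
  rewrite /fejer; congr (_ * _); apply: eq_bigr => a _; apply: eq_bigr => b _.
  rewrite [X in cos X = _]mulrBr [X in _ = cos X]mulrBr.
  exact: (cosM_mod2pi s (- ((a%:Z - b%:Z)%:~R * y)) (a%:Z - b%:Z)).
Qed.

(** [Phi_lip] leaves the mean of [|sin (s / 2)|] under the kernel. It is split by
    [|g| <= e + g ^+ 2 / e]: the kernel has mean 1, and [fejer_sin] bounds the quadratic part by
    [1 / N]. *)
Lemma fejer_mean_approx N t y (e : R) : (0 < N)%N -> 0 < e ->
  `|fejer_mean N t y - Phi t y| <= 2 * `|t| * (e + (N%:R * e)^-1).
Proof.
move=> N0 e0; rewrite fejer_mean_int.
have bPs : bmeas (fun s : measurableTypeR R => Phi t (s + y)).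
  by apply: (bmeas_comp (h := fun s : measurableTypeR R => s + y : measurableTypeR R)) (bmeas_Phi t); exact: measurable_funD.
have bF := bmeas_fejer N.
have -> : Phi t y = \int[circ R]_s (Phi t y * fejer N s) by rewrite RintZ// Rint_fejer// mulr1.
rewrite -RintB; first last.
- by apply: bmeasM => //; exact: bmeas_cst.
- exact: bmeasM.
have bsin : bmeas (fun s : measurableTypeR R => fejer N s * sin (s / 2) ^+ 2).
  by apply: bmeasM => //; apply: bmeasX; apply: bmeas_sin; exact: measurable_funM.
have bd : bmeas (fun s : measurableTypeR R => Phi t (s + y) * fejer N s - Phi t y * fejer N s).
  by apply: bmeasB; apply: bmeasM => //; exact: bmeas_cst.
apply: le_trans (norm_Rint _ bd) _.
apply: (@le_trans _ _ (\int[circ R]_s (2 * `|t| * (e * fejer N s + e^-1 * (fejer N s * sin (s / 2) ^+ 2))))).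
  apply: ler_Rint.
  - exact: bmeas_norm.
  - by apply: bmeasM; [exact: bmeas_cst|apply: bmeasD; apply: bmeasM => //; exact: bmeas_cst].
  move=> s; rewrite -mulrBl normrM (ger0_norm (fejer_ge0 _ _)).
  have := Phi_lip t (s + y) y; rewrite addrK => h.
  apply: le_trans (ler_wpM2r (fejer_ge0 N s) h) _.
  rewrite -[leLHS]mulrA; apply: ler_wpM2l; first by rewrite mulr_ge0.
  rewrite (mulrC e) (mulrCA e^-1) -mulrDr mulrC; apply: ler_wpM2l; first exact: fejer_ge0.
  set g := sin (s / 2).
  have -> : `|g| = e^-1 * (e * `|g|) by rewrite mulKf// gt_eqF.
  have -> : e + e^-1 * g ^+ 2 = e^-1 * (e ^+ 2 + `|g| ^+ 2).
    by rewrite real_normK ?num_real// mulrDr expr2 mulKf// gt_eqF.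
  apply: ler_wpM2l; first by rewrite invr_ge0 ltW.
  by have := sqr_ge0 (e - `|g|); have := sqr_ge0 e; have := sqr_ge0 `|g|; lra.
rewrite RintZ; last by apply: bmeasD; apply: bmeasM => //; exact: bmeas_cst.
apply: ler_wpM2l; first by rewrite mulr_ge0.
rewrite RintD; [|by apply: bmeasM => //; exact: bmeas_cst..].
rewrite (RintZ _ e bF) (RintZ _ e^-1 bsin) Rint_fejer// mulr1 lerD2l invfM mulrC ler_wpM2r ?invr_ge0 ?(ltW e0)//.
rewrite -[leRHS](Rint_cst (circ R)); apply: ler_Rint => //; first exact: bmeas_cst.
by move=> s; exact: fejer_sin.
Qed.

(** Each offset [c < r] is a difference [a - b] of numbers below [r.*2] in at least [r] ways, namely
    [a = b + c] with [b < r]; the other terms are nonnegative. *)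
Lemma bessel_sq_window_le (r : nat) t (z : int) :
  r%:R * \sum_(c < r) bessel_sq t (z + c%:Z) <=
  \sum_(a < r.*2) \sum_(b < r.*2) bessel_sq t (z + (a%:Z - b%:Z)).
Proof.
rewrite exchange_big/=.
apply: (@le_trans _ _ (\sum_(0 <= b < r) \sum_(0 <= c < r) bessel_sq t (z + c%:Z))).
  by rewrite sumr_const_nat subn0 mulr_natl big_mkord.
rewrite -[leRHS](big_mkord xpredT (fun b => \sum_(a < r.*2) bessel_sq t (z + (a%:Z - b%:Z)))).
rewrite (big_cat_nat (n := r) (m := 0) (p := r.*2))//=; last by rewrite -addnn leq_addr.
rewrite ler_wpDr//.
  by apply: sumr_ge0 => b _; apply: sumr_ge0 => a _; exact: bessel_sq_ge0.
apply: ler_sum_nat => b /andP[_ br].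
rewrite -(big_mkord xpredT (fun a => bessel_sq t (z + (a%:Z - b%:Z)))).
rewrite (big_cat_nat (n := b) (m := 0) (p := r.*2))//=; last by rewrite -addnn ltnW// ltn_addr.
rewrite ler_wpDl//; first by apply: sumr_ge0 => a _; exact: bessel_sq_ge0.
rewrite (big_cat_nat (n := (r + b)%N) (m := b) (p := r.*2))//=; first last.
- by rewrite -addnn leq_add2l ltnW.
- exact: leq_addl.
rewrite ler_wpDr//; first by apply: sumr_ge0 => a _; exact: bessel_sq_ge0.
have -> (f : nat -> R) : \sum_(b <= a < r + b) f a = \sum_(0 <= c < r) f (c + b)%N.
  by rewrite -{1}[b]add0n big_addn addnK.
by apply: ler_sum => c _; rewrite PoszD addrK.
Qed.

Lemma bessel_sq_fejer N t (z : int) :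
  N%:R^-1 * \sum_(a < N) \sum_(b < N) bessel_sq t (z + (a%:Z - b%:Z)) =
  \int[circ R]_s (Phi t s * (cos (z%:~R * s) * fejer N s)).
Proof.
have bP := bmeas_Phi t.
have bPc (a b : 'I_N) : bmeas (fun s : measurableTypeR R => Phi t s * cos ((z + (a%:Z - b%:Z))%:~R * s + 0)).
  by apply: bmeasM => //; apply: bmeas_cos; apply: measurable_funD => //; exact: measurable_funM.
transitivity (\int[circ R]_s (N%:R^-1 * \sum_(a < N) \sum_(b < N)
      Phi t s * cos ((z + (a%:Z - b%:Z))%:~R * s + 0))).
  rewrite RintZ; last by apply: bmeas_sum => a; exact: bmeas_sum.
  rewrite Rint_sum; last by move=> a; exact: bmeas_sum.
  congr (_ * _); apply: eq_bigr => a _; rewrite Rint_sum//; apply: eq_bigr => b _.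
  by rewrite Rint_Phi_cos cos0 mul1r.
apply: eq_Rintegral => s _.
have sin0 : \sum_(a < N) \sum_(b < N) sin ((a%:Z - b%:Z)%:~R * s) = 0.
  set S := LHS; have : S = - S; last lra.
  rewrite {1}/S exchange_big/= -sumrN; apply: eq_bigr => a _.
  rewrite -sumrN; apply: eq_bigr => b _.
  by rewrite -sinN -mulNr -mulrNz opprB.
transitivity (N%:R^-1 * (Phi t s * (cos (z%:~R * s) * (\sum_(a < N) \sum_(b < N) cos ((a%:Z - b%:Z)%:~R * s)) -
   sin (z%:~R * s) * \sum_(a < N) \sum_(b < N) sin ((a%:Z - b%:Z)%:~R * s)))).
  congr (_ * _).
  rewrite !mulr_sumr -sumrB mulr_sumr; apply: eq_bigr => a _.
  rewrite !mulr_sumr -sumrB mulr_sumr; apply: eq_bigr => b _.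
  by rewrite addr0 intrD mulrDl cosD.
by rewrite sin0 mulr0 subr0 /fejer; ring.
Qed.

(* Fejer summation turns the window sum into an average of [Phi] against a kernel
   concentrated at scale [1 / r], where [Phi] has already decayed if [r << |t|]. *)
Lemma bessel_sq_window (r : nat) t (rho : R) (z : int) : (0 < r)%N -> 0 < rho ->
  r%:R * rho ^- 5 <= `|t| -> \sum_(c < r) bessel_sq t (z + c%:Z) <= 44 * rho.
Proof.
move=> r0 rho0 rt; have rR : 0 < r%:R :> R by rewrite ltr0n.
rewrite -(ler_pM2l rR); apply: le_trans (bessel_sq_window_le _ _ _) _.
have N0 : 0 < r.*2%:R :> R by rewrite ltr0n double_gt0.
rewrite -(ler_pM2l (x := r.*2%:R^-1)) ?invr_gt0// bessel_sq_fejer.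
have -> : r.*2%:R^-1 * (r%:R * (44 * rho)) = 22 * rho :> R.
  by rewrite -mul2n natrM; field; rewrite gt_eqF.
(* Where [|sin s| < 2 * d], a set of measure at most [8 * d], the kernel is only bounded by [r.*2],
   which costs [16 * rho]. Elsewhere [|sin (s / 2)| >= d], the argument of J_0 exceeds [rho ^- 4],
   and [bessel0_le] costs [6 * rho]. The sum [22 * rho] doubles in the comparison of the window with
   the Fejer sum. *)
pose d := rho / r%:R; have d0 : 0 < d by rewrite divr_gt0.
have bF := bmeas_fejer r.*2; have bP := bmeas_Phi t.
have bA : bmeas (\1_[set x | `|sin x| < 2 * d] : measurableTypeR R -> R).
  split; first by apply: measurable_indic; exact: measurable_small_sin.
  by exists 1 => x; rewrite indicE; case: (_ \in _); rewrite ?normr1 ?normr0.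
have bz : bmeas (fun s : measurableTypeR R => Phi t s * (cos (z%:~R * s) * fejer r.*2 s)).
  apply: bmeasM => //; apply: bmeasM => //; apply: bmeas_cos; exact: measurable_funM.
apply: le_trans (ler_norm _) _; apply: le_trans (norm_Rint _ bz) _.
apply: (@le_trans _ _ (\int[circ R]_s (r.*2%:R * \1_[set x | `|sin x| < 2 * d] s +
    6 * rho * fejer r.*2 s))).
  apply: ler_Rint; [exact: bmeas_norm|by apply: bmeasD; apply: bmeasM => //; exact: bmeas_cst|].
  move=> s; rewrite normrM [X in _ * X]normrM mulrCA (ger0_norm (fejer_ge0 _ _)).
  apply: (@le_trans _ _ (`|Phi t s| * fejer r.*2 s)).
    rewrite -[leRHS]mul1r; apply: ler_pM => //; last exact: cos_max.
    by rewrite mulr_ge0// fejer_ge0.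
  have F0 := fejer_ge0 r.*2 s.
  rewrite indicE; case: (ltP `|sin s| (2 * d)) => h.
    rewrite mem_set//= mulr1; apply: (@le_trans _ _ (fejer r.*2 s)).
      by rewrite -[leRHS]mul1r ler_wpM2r// Phi_le1.
    by rewrite -[leLHS]addr0 lerD ?fejer_le// mulr_ge0// mulr_ge0// ltW.
  rewrite memNset/=; last by apply/negP; rewrite -leNgt.
  rewrite mulr0 add0r; apply: ler_wpM2r => //.
  rewrite /Phi -bessel0_norm; apply: bessel0_le => //.
  have sd : d <= `|sin (s / 2)|.
    have : `|sin s| <= 2 * `|sin (s / 2)|; last lra.
    rewrite {1}(_ : s = (s / 2) *+ 2); last by rewrite -mulr_natr divfK// pnatr_eq0.
    rewrite sin_mulr2n -mulr_natl !normrM normr_nat; apply: ler_wpM2l => //.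
    by rewrite -[leRHS]mul1r; apply: ler_wpM2r => //; exact: cos_max.
  rewrite !normrM normr_nat.
  apply: (@le_trans _ _ (r%:R * rho ^- 5 * d)).
    rewrite /d (_ : _ * (rho / _) = rho ^- 4)//.
    by field; rewrite !gt_eqF.
  apply: ler_pM => //; first by rewrite mulr_ge0// invr_ge0 exprn_ge0// ltW.
    exact: ltW.
  by apply: (le_trans rt); rewrite ler_peMl// ler1n.
rewrite RintD; [|by apply: bmeasM => //; exact: bmeas_cst..].
rewrite (RintZ _ _ bA) (RintZ _ _ bF) Rint_fejer ?double_gt0// mulr1.
have : r.*2%:R * \int[circ R]_x \1_[set x0 | `|sin x0| < 2 * d] x <= r.*2%:R * (4 * (2 * d)).
  by apply: ler_wpM2l => //; apply: Rint_small_sin; rewrite mulr_gt0.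
rewrite (_ : r.*2%:R * (4 * (2 * d)) = 16 * rho); first lra.
by rewrite /d -mul2n natrM; field; rewrite gt_eqF.
Qed.

End fejer.

(** * The Lyapunov function *)

Lemma ler_sum_uniq_sub (R : numDomainType) (I : eqType) (s1 s2 : seq I) (f : I -> R) :
  uniq s1 -> uniq s2 -> {subset s1 <= s2} -> (forall i, 0 <= f i) ->
  \sum_(i <- s1) f i <= \sum_(i <- s2) f i.
Proof.
move=> u1 u2 s12 f0; have P : perm_eq [seq i <- s2 | i \in s1] s1.
  apply: uniq_perm => //; first exact: filter_uniq.
  by move=> i; rewrite mem_filter; apply/andb_idr => /s12.
rewrite [leRHS](bigID (mem s1))/= -[X in X + _]big_filter (perm_big _ P)/=.
by rewrite lerDl sumr_ge0.
Qed.

Definition zrange (M : nat) : seq int :=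
  [seq Posz n | n <- iota 0 M.+1] ++ [seq Negz n | n <- iota 0 M].

Lemma mem_zrange M (a : int) : (a \in zrange M) = (`|a|%N <= M)%N.
Proof.
rewrite mem_cat; case: a => n.
  rewrite mem_map; last by move=> ? ? [].
  rewrite mem_iota/= add0n ltnS orbC; case: (boolP (_ \in _)) => // /mapP[m _ //].
rewrite orbC mem_map; last by move=> ? ? [].
rewrite mem_iota/= add0n; case: (ltnP n M) => //= h.
by apply/negP => /mapP[m _ //].
Qed.

Lemma uniq_zrange M : uniq (zrange M).
Proof.
rewrite cat_uniq !map_inj_uniq ?iota_uniq//=; [|by move=> ? ? []|by move=> ? ? []].
by rewrite andbT; apply/hasPn => _ /mapP[m _ ->]; apply/negP => /mapP[k _].
Qed.

Lemma sum_zrange_le (R : realType) M (f : nat -> R) : (forall n, 0 <= f n) ->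
  \sum_(a <- zrange M) f `|a|%N <= 2 * \sum_(0 <= n < M.+1) f n.
Proof.
move=> f0; rewrite /zrange big_cat !big_map mulr2n mulrDl mul1r lerD//.
rewrite [leRHS]big_nat_recl// ler_wpDl// [X in _ <= X](_ : _ = \sum_(j <- iota 0 M) f j.+1)//.
by rewrite /index_iota subn0.
Qed.

(* 4 ^ 5, to match the exponent 5 in [bessel_sq_window]; locked, so that the unary
   numeral is never computed. *)
HB.lock Definition base : nat := 1024.

Lemma base_gt1 : (1 < base)%N. Proof. by rewrite base.unlock. Qed.

Section lyapunov.
Variable R : realType.

Lemma baseE : base%:R = 4 ^+ 5 :> R.
Proof. by rewrite base.unlock; ring. Qed.

(** Comparable to n^(-1/10), since [base] is 2^10, but constant between consecutive powers of
    [base], so that sums over scales are geometric. *)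
Definition decay (n : nat) : R := 2^-1 ^+ trunc_log base n.

(* If [k.1 + k.2 = 0] the shear leaves the mode untouched and [k] moves to
   [(0, k.2)]: the factor 2 makes this step a contraction by 1/2 as well. *)
Definition lyap (k : int * int) : R :=
  if k.1 + k.2 == 0 then 2 * decay `|k.1|%N else decay `|(k.1 + k.2)%R|%N.

Lemma decay_gt0 n : 0 < decay n.
Proof. by rewrite exprn_gt0// invr_gt0. Qed.

Lemma decay_le1 n : decay n <= 1.
Proof. by rewrite exprn_ile1 ?invr_ge0 ?invf_le1 ?ler1n. Qed.

(** The total mass is 1; the factor 2 is lost in comparing the window with the Fejer sum. *)
Lemma bessel_sq_mass (N : nat) (t : R) (z : int) :
  \sum_(c < N) bessel_sq t (z + c%:Z) <= 2.
Proof.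
case: N => [|N]; first by rewrite big_ord0.
have rR : 0 < N.+1%:R :> R by rewrite ltr0n.
rewrite -(ler_pM2l rR); apply: le_trans (bessel_sq_window_le _ _ _) _.
have N0 : 0 < N.+1.*2%:R :> R by rewrite ltr0n double_gt0.
rewrite -(ler_pM2l (x := N.+1.*2%:R^-1)) ?invr_gt0// bessel_sq_fejer.
have -> : N.+1.*2%:R^-1 * (N.+1%:R * 2) = 1 :> R.
  by rewrite -mul2n natrM; set m := N.+1%:R in rR *; field; rewrite gt_eqF.
have bF := bmeas_fejer R N.+1.*2; have bP := bmeas_Phi t.
have bc : bmeas (fun s : measurableTypeR R => cos (z%:~R * s)).
  by apply: bmeas_cos; exact: measurable_funM.
have I1 : \int[circ R]_s fejer N.+1.*2 s = 1 by rewrite Rint_fejer ?double_gt0.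
rewrite -[leRHS]I1.
apply: ler_Rint => //; first by apply: bmeasM => //; exact: bmeasM.
move=> s; rewrite mulrA -[leRHS]mul1r; apply: ler_wpM2r; first exact: fejer_ge0.
apply: le_trans (ler_norm _) _; rewrite normrM -[leRHS]mul1r.
by apply: ler_pM => //; [exact: Phi_le1|exact: cos_max].
Qed.

(** The admissible points lie in a window of length [r.*2], to which [bessel_sq_window] applies with
    [rho = 4^-1 ^+ e]: each factor [base = 4 ^ 5] between the window and [|t|] gains a factor 4. *)
Lemma bessel_sq_ball (N r e : nat) (t : R) (z w : int) : (0 < r)%N ->
  2 * r%:R * base%:R ^+ e <= `|t| ->
  \sum_(a < N) bessel_sq t (z + a%:Z) * (`|(w + a%:Z)%R|%N < r)%N%:R <= 44 * 4^-1 ^+ e.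
Proof.
move=> r0 rt; have r20 : (0 < r.*2)%N by rewrite double_gt0.
have e4 : 0 < 4^-1 ^+ e :> R by rewrite exprn_gt0// invr_gt0.
have H : r.*2%:R * (4^-1 ^+ e) ^- 5 <= `|t|.
  by rewrite -mul2n natrM exprVn exprVn invrK -exprM mulnC exprM -baseE.
apply: le_trans (bessel_sq_window (z - w - r%:Z) r20 e4 H).
apply: (@le_trans _ _ (\sum_(a < N) \sum_(c < r.*2) (c%:Z == w + a%:Z + r%:Z)%:R *
    bessel_sq t (z - w - r%:Z + c%:Z))).
  apply: ler_sum => a _; case: ltnP => h; last first.
    by rewrite mulr0 sumr_ge0// => c _; rewrite mulr_ge0// bessel_sq_ge0.
  have [c cE] : exists c : 'I_r.*2, c%:Z = w + a%:Z + r%:Z.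
    have h2 : (`|(w + a%:Z + r%:Z)%R|%N < r.*2)%N by lia.
    by exists (Ordinal h2) => /=; lia.
  rewrite (bigD1 c)//= cE eqxx mul1r mulr1 (_ : _ - _ - _ + _ = z + a%:Z); last by ring.
  by rewrite lerDl sumr_ge0// => d _; rewrite mulr_ge0// bessel_sq_ge0.
rewrite exchange_big/=; apply: ler_sum => c _; rewrite -mulr_suml.
rewrite -[leRHS]mul1r; apply: ler_wpM2r; first exact: bessel_sq_ge0.
have [/existsP[a /eqP aE]|/existsPn H0] := boolP [exists a : 'I_N, c%:Z == w + a%:Z + r%:Z].
  rewrite (bigD1 a)//= aE eqxx big1 ?addr0// => b ba.
  case: eqP => // E; exfalso; move/eqP: ba; apply; apply: val_inj => /=; lia.
by rewrite big1// => a _; rewrite (negbTE (H0 a)).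
Qed.

(** The one-step contraction. With [i] the scale of [b] and [n = i + kap], landing below scale
    [r + 1] has weight at most [44 * 4^-1 ^+ (n - r.+1)] and value about [2^-1 ^+ r], so the top
    scale dominates and everything is of order [2^-1 ^+ n]. The three contributions, from landing at
    0, from the scales below [n] and from the rest, add up to [2 * 44 + 176 + 2 = 266] times
    [2^-1 ^+ n], and 532 is twice that. *)
Lemma lyap_window (kap N : nat) (t : R) (b z w : int) : 532 <= 2 ^+ kap :> R -> b != 0 ->
  2 * base%:R ^+ kap * `|b|%N%:R <= `|t| ->
  \sum_(a < N) bessel_sq t (z + a%:Z) *
     (if w + a%:Z == 0 then 2 * decay `|b|%N else decay `|(w + a%:Z)%R|%N) <= decay `|b|%N / 2.
Proof.
move=> hk b0 bt; have hf0 : 0 <= 2^-1 :> R by rewrite invr_ge0.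
have hf1 : 2^-1 <= 1 :> R by rewrite invf_le1 ?ler1n.
set i := trunc_log base `|b|%N; have dE : decay `|b|%N = 2^-1 ^+ i by [].
pose n := (i + kap)%N.
have b1 : base%:R ^+ i <= `|b|%N%:R :> R.
  by rewrite -natrX ler_nat trunc_logP ?base_gt1// absz_gt0.
have nt : 2 * base%:R ^+ n <= `|t|.
  apply: le_trans bt; rewrite /n exprD (mulrC (base%:R ^+ i)) mulrA.
  by apply: ler_wpM2l => //; rewrite mulr_ge0 ?exprn_ge0.
(* A layer decomposition: the value at [x] is dominated by the term of its own scale, or by the
   floor [2^-1 ^+ n] if [x] is farther out. *)
have pw (x : int) : (if x == 0 then 2 * decay `|b|%N else decay `|x|%N) <=
  2 * decay `|b|%N * (`|x|%N < 1)%N%:R + \sum_(r < n) 2^-1 ^+ r * (`|x|%N < base ^ r.+1)%N%:R + 2^-1 ^+ n.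
  case: eqP => [->|/eqP x0].
    by rewrite mulr1 -addrA ler_wpDr// addr_ge0 ?sumr_ge0// => *; rewrite ?mulr_ge0 ?exprn_ge0// invr_ge0.
  have x1 : (0 < `|x|)%N by rewrite absz_gt0.
  rewrite ltnS leqNgt x1 mulr0 add0r /decay; case: (ltnP (trunc_log base `|x|%N) n) => h.
    rewrite (bigD1 (Ordinal h))//= trunc_log_ltn ?base_gt1// mulr1 -addrA ler_wpDr//.
    by rewrite addr_ge0 ?sumr_ge0// => *; rewrite ?mulr_ge0 ?exprn_ge0// invr_ge0.
  apply: (@le_trans _ _ (2^-1 ^+ n)); last first.
    by rewrite lerDr sumr_ge0// => *; rewrite mulr_ge0 ?exprn_ge0 ?invr_ge0.
  exact: ler_wiXn2l.
apply: (@le_trans _ _ (\sum_(a < N) bessel_sq t (z + a%:Z) *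
  (2 * decay `|b|%N * (`|(w + a%:Z)%R|%N < 1)%N%:R + \sum_(r < n) 2^-1 ^+ r * (`|(w + a%:Z)%R|%N < base ^ r.+1)%N%:R + 2^-1 ^+ n))).
  by apply: ler_sum => a _; apply: ler_wpM2l; [exact: bessel_sq_ge0|exact: pw].
under eq_bigr do rewrite !mulrDr.
rewrite !big_split/=.
have T1 : \sum_(a < N) bessel_sq t (z + a%:Z) * (2 * decay `|b|%N * (`|(w + a%:Z)%R|%N < 1)%N%:R)
    <= 2 * decay `|b|%N * (44 * 4^-1 ^+ n).
  under eq_bigr do rewrite mulrCA.
  rewrite -mulr_sumr ler_wpM2l//; first by rewrite mulr_ge0// ltW// decay_gt0.
  by apply: bessel_sq_ball => //; rewrite mulr1.
have T3 : \sum_(a < N) bessel_sq t (z + a%:Z) * 2^-1 ^+ n <= 2 * 2^-1 ^+ n.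
  rewrite -mulr_suml ler_wpM2r ?exprn_ge0 ?invr_ge0//; exact: bessel_sq_mass.
have T2 : \sum_(a < N) bessel_sq t (z + a%:Z) *
    (\sum_(r < n) 2^-1 ^+ r * (`|(w + a%:Z)%R|%N < base ^ r.+1)%N%:R)
    <= \sum_(r < n) 2^-1 ^+ r * (44 * 4^-1 ^+ (n - r.+1)).
  under eq_bigr do rewrite mulr_sumr.
  rewrite exchange_big/=; apply: ler_sum => r _.
  under eq_bigr do rewrite mulrCA.
  rewrite -mulr_sumr ler_wpM2l ?exprn_ge0 ?invr_ge0//.
  apply: bessel_sq_ball; first by rewrite expn_gt0 ltnW ?base_gt1.
  by rewrite natrX -mulrA -exprD subnKC.
(* The sum satisfies [s (m + 1) = s m / 4 + 44 * 2^-1 ^+ m], and [176 / 4 + 44 = 176 / 2]. *)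
have T2' : \sum_(r < n) 2^-1 ^+ r * (44 * 4^-1 ^+ (n - r.+1)) <= 176 * 2^-1 ^+ n :> R.
  elim: (n) => [|m IH]; first by rewrite big_ord0 mulr_ge0// expr0.
  rewrite big_ord_recr/= subnn expr0 mulr1.
  have -> : \sum_(r < m) 2^-1 ^+ r * (44 * 4^-1 ^+ (m.+1 - r.+1)) =
      4^-1 * \sum_(r < m) 2^-1 ^+ r * (44 * 4^-1 ^+ (m - r.+1)) :> R.
    rewrite mulr_sumr; apply: eq_bigr => r _; rewrite subSn; last exact: ltn_ord.
    by rewrite exprS; ring.
  rewrite exprS; have : 0 <= 2^-1 ^+ m :> R by rewrite exprn_ge0 ?invr_ge0.
  lra.
have d4 : 4^-1 ^+ n <= 2^-1 ^+ kap :> R.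
  rewrite (_ : 4^-1 = 2^-1 ^+ 2 :> R); last by field.
  by rewrite -exprM; apply: ler_wiXn2l => //; rewrite /n; lia.
have nE : 2^-1 ^+ n = 2^-1 ^+ i * 2^-1 ^+ kap :> R by rewrite exprD.
have i0 : 0 < 2^-1 ^+ i :> R by rewrite exprn_gt0 ?invr_gt0.
have kk : 532 * 2^-1 ^+ kap <= 1 :> R.
  by rewrite exprVn ler_pdivrMr ?exprn_gt0// mul1r.
have : 2 * decay `|b|%N * (44 * 4^-1 ^+ n) <= 2 * 2^-1 ^+ i * (44 * 2^-1 ^+ kap).
  by rewrite dE ler_wpM2l ?ler_wpM2l// mulr_ge0// ltW.
rewrite nE dE in T1 T2' T3 * => T1'.
have := ler_wpM2l (ltW i0) kk; rewrite mulr1.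
lra.
Qed.

End lyapunov.

(** * Summability of the Lyapunov function against the weights |k|^-2 *)

Section summability.
Variable R : realType.

Definition ksq (k : int * int) : R := k.1%:~R ^+ 2 + k.2%:~R ^+ 2.

Lemma ksq_ge0 k : 0 <= ksq k.
Proof. by rewrite addr_ge0 ?sqr_ge0. Qed.

Lemma ksq_ge1 k : k != (0, 0) -> 1 <= ksq k.
Proof.
case: k => a b; rewrite /ksq/= -!rmorphXn/= -rmorphD/= -[1]/(1%:~R) ler_int => ab.
suff : 0 < a ^+ 2 + b ^+ 2 by [].
by rewrite lt_neqAle addr_ge0 ?sqr_ge0// andbT eq_sym paddr_eq0 ?sqr_ge0// !sqrf_eq0 -xpair_eqE.
Qed.

Lemma sum_inv_sq (N : nat) : \sum_(0 <= m < N) (m%:R ^+ 2)^-1 <= 2 :> R.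
Proof.
case: N => [|N]; first by rewrite big_geq.
rewrite big_nat_recl// expr0n/= invr0 add0r.
apply: (@le_trans _ _ (2 - 2 / N.+1%:R)); last by rewrite gerBl// divr_ge0.
elim: N => [|N IH]; first by rewrite big_geq// divr1 subrr.
rewrite big_nat_recr//=; apply: le_trans (lerD IH (lexx _)) _.
have n0 : 0 < N.+1%:R :> R by rewrite ltr0n.
rewrite -(natr1 N.+1); set x := N.+1%:R in n0 *.
rewrite -subr_ge0 (_ : _ - _ = (x - 1) / (x ^+ 2 * (x + 1))); last by field; rewrite !gt_eqF// addr_gt0.
have x1 : 1 <= x by rewrite ler1n.
by apply: divr_ge0; [rewrite subr_ge0|apply: mulr_ge0; [exact: sqr_ge0|rewrite addr_ge0// ltW]].
Qed.

(** Each term is at most [4 / (n + m) - 4 / (n + m + 1)], because [(x + y) * (x + y + 1) <= 4 * (x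
    ^+ 2 + y ^+ 2)] for [x >= 1] and [y >= 0]. *)
Lemma sum_inv_sqD (n N : nat) : (0 < n)%N ->
  \sum_(0 <= m < N) (n%:R ^+ 2 + m%:R ^+ 2)^-1 <= 4 / n%:R :> R.
Proof.
move=> n0; have nR : 1 <= n%:R :> R by rewrite ler1n.
apply: (@le_trans _ _ (4 / n%:R - 4 / (n%:R + N%:R))); last first.
  by rewrite gerBl// divr_ge0 ?addr_ge0.
elim: N => [|N IH]; first by rewrite big_geq// addr0 subrr.
rewrite big_nat_recr//=; apply: le_trans (lerD IH (lexx _)) _.
rewrite -(natr1 N); set y := N%:R; set x := n%:R in nR *.
have y0 : 0 <= y by rewrite ler0n.
rewrite -subr_ge0 (_ : _ - _ = (4 * (x ^+ 2 + y ^+ 2) - (x + y) * (x + y + 1))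
   / ((x + y) * (x + y + 1) * (x ^+ 2 + y ^+ 2))); last first.
  by field; rewrite !gt_eqF//; nra.
apply: divr_ge0; last by rewrite !mulr_ge0 ?addr_ge0 ?sqr_ge0//; lra.
have := sqr_ge0 (x - y); have := sqr_ge0 (y - 1).
have : 0 <= x * (x - 1) by rewrite mulr_ge0 ?subr_ge0//; lra.
nra.
Qed.

(** The block from [base ^ i] to [base ^ i.+1] contributes at most [2^-1 ^+ i * (base - 1)], a
    geometric series. The term at 0 vanishes by [0^-1 = 0]. *)
Lemma sum_decay_div (N : nat) :
  \sum_(0 <= n < N) decay R n / n%:R <= 2 * base%:R :> R.
Proof.
have t0 n : 0 <= decay R n / n%:R by rewrite divr_ge0// ltW// decay_gt0.
have b0 := base_gt1.
have bpos i : (0 < base ^ i)%N by rewrite expn_gt0 ltnW.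
have H i : \sum_(0 <= n < base ^ i) decay R n / n%:R <= 2 * base%:R * (1 - 2^-1 ^+ i).
  elim: i => [|i IH].
    by rewrite expn0 big_nat1 invr0 mulr0 expr0 subrr mulr0.
  rewrite (big_cat_nat (n := (base ^ i)%N))//=; last by rewrite leq_pexp2l// ltnW.
  have : \sum_(base ^ i <= n < base ^ i.+1) decay R n / n%:R <=
      \sum_(base ^ i <= n < base ^ i.+1) 2^-1 ^+ i / (base ^ i)%:R.
    apply: ler_sum_nat => n /andP[n1 n2].
    rewrite /decay (_ : trunc_log base n = i); last by apply: trunc_log_eq => //; rewrite n1.
    rewrite ler_pM2l ?exprn_gt0 ?invr_gt0// lef_pV2 ?posrE ?ltr0n//; last exact: leq_trans n1.
    by rewrite ler_nat.
  have -> : \sum_(base ^ i <= n < base ^ i.+1) (2^-1 ^+ i / (base ^ i)%:R : R) =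
      2^-1 ^+ i / (base ^ i)%:R * ((base ^ i.+1)%:R - (base ^ i)%:R).
    rewrite sumr_const_nat -[LHS]mulr_natr natrB//.
    by rewrite leq_pexp2l// ltnW.
  have bi : 0 < (base ^ i)%:R :> R by rewrite ltr0n.
  rewrite [in (base ^ i.+1)%:R]expnS natrM (_ : _ * (base%:R * _ - _) = 2^-1 ^+ i * (base%:R - 1)); last first.
    by field; rewrite gt_eqF.
  move=> h; apply: le_trans (lerD IH h) _.
  have : 0 <= 2^-1 ^+ i :> R by rewrite exprn_ge0 ?invr_ge0.
  rewrite exprS; set z := 2^-1 ^+ i; set b := base%:R; lra.
apply: (@le_trans _ _ (\sum_(0 <= n < base ^ N) decay R n / n%:R)).
  rewrite [leRHS](big_cat_nat (n := N))//= ?ler_wpDr ?sumr_ge0//.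
  by rewrite ltnW// ltn_expl.
apply: le_trans (H N) _; rewrite ler_piMr ?mulr_ge0// gerBl.
Qed.

(** On Z^2 the weights |k|^-2 alone diverge logarithmically, and [decay] restores convergence. In
    the coordinates [s = a + b] and [a], where [s ^ 2 + a ^ 2] is at most three times |k|^2, the sum
    over [a] gives [4 / |s|] and leaves [sum_decay_div]. The line [s = 0] contributes the sum of the
    inverse squares. *)
Lemma lyap_summable (M : nat) :
  \sum_(a <- zrange M) \sum_(b <- zrange M) (ksq (a, b))^-1 * lyap R (a, b)
    <= 12 * (4 + 8 * base%:R).
Proof.
pose H (n m : nat) : R := if n == 0%N then 2 * (m%:R ^+ 2)^-1
  else decay R n * (n%:R ^+ 2 + m%:R ^+ 2)^-1.
have H0 n m : 0 <= H n m.
  rewrite /H; case: ifP => _; rewrite mulr_ge0 ?invr_ge0 ?addr_ge0 ?sqr_ge0//.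
  by rewrite ltW// decay_gt0.
have sqz (z : int) : z%:~R ^+ 2 = `|z|%N%:R ^+ 2 :> R.
  by rewrite natr_absz intr_norm real_normK ?num_real.
have key (a b : int) : (ksq (a, b))^-1 * lyap R (a, b) <= 3 * H `|(a + b)%R|%N `|a|%N.
  have [->|ab] := eqVneq (a, b) (0, 0).
    by rewrite /ksq/= expr0n/= add0r invr0 mul0r mulr_ge0.
  have k1 := ksq_ge1 ab; have k0 : 0 < ksq (a, b) by apply: lt_le_trans k1.
  rewrite /lyap /H/= absz_eq0 -!sqz intrD.
  set x : R := a%:~R; set y : R := b%:~R; rewrite -/(ksq (a, b)).
  have kE : ksq (a, b) = x ^+ 2 + y ^+ 2 by [].
  case: eqP => [s0|/eqP s0].
    have xy : x + y = 0 by rewrite -intrD s0.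
    have yx : y = - x by lra.
    have x0 : 0 < x ^+ 2 by rewrite kE yx sqrrN in k0; lra.
    apply: (@le_trans _ _ ((ksq (a, b))^-1 * 2)).
      rewrite ler_wpM2l ?invr_ge0 ?ksq_ge0//.
      by have := decay_le1 R `|a|%N; lra.
    rewrite mulrCA (mulrC _ 2) ler_wpM2l// ler_pdivlMr// mulrC ler_pdivrMr// kE; nra.
  have p0 : 0 < (x + y) ^+ 2 + x ^+ 2.
    have : x + y != 0 by rewrite -intrD intr_eq0.
    by move=> xy0; rewrite ltr_wpDr ?sqr_ge0// lt_neqAle sqr_ge0 andbT eq_sym sqrf_eq0.
  rewrite mulrCA (mulrC _ (decay _ _)) ler_wpM2l//; first by rewrite ltW// decay_gt0.
  rewrite ler_pdivlMr// mulrC ler_pdivrMr// kE.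
  by have := sqr_ge0 (x - y); have := sqr_ge0 y; nra.
apply: (@le_trans _ _ (\sum_(a <- zrange M) \sum_(s <- zrange (M + M)) 3 * H `|s|%N `|a|%N)).
  rewrite big_seq [leRHS]big_seq; apply: ler_sum => a; rewrite mem_zrange => aM.
  apply: (@le_trans _ _ (\sum_(b <- zrange M) 3 * H `|(a + b)%R|%N `|a|%N)).
    by apply: ler_sum => b _; exact: key.
  rewrite -(big_map (fun b => (a + b)%R) xpredT (fun s => 3 * H `|s|%N `|a|%N)).
  apply: ler_sum_uniq_sub.
  - by rewrite map_inj_uniq ?uniq_zrange// => u v /addrI.
  - exact: uniq_zrange.
  - move=> _ /mapP[b bM ->]; move: bM; rewrite !mem_zrange => bM; lia.
  - by move=> s; rewrite mulr_ge0.
have -> : 12 * (4 + 8 * base%:R) = 2 * (3 * (2 * (4 + 8 * base%:R))) :> R by ring.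
apply: le_trans (sum_zrange_le (f := fun m => \sum_(s <- zrange (M + M)) 3 * H `|s|%N m) _ _) _.
  by move=> m; apply: sumr_ge0 => s _; rewrite mulr_ge0.
rewrite ler_wpM2l//.
under eq_bigr do rewrite -mulr_sumr.
rewrite -mulr_sumr ler_wpM2l// exchange_big/=.
apply: le_trans (sum_zrange_le (f := fun n => \sum_(0 <= m < M.+1) H n m) _ _) _.
  by move=> n; apply: sumr_ge0.
rewrite ler_wpM2l// big_nat_recl// lerD//.
  rewrite /H/= -mulr_sumr; have := sum_inv_sq M.+1; lra.
apply: (@le_trans _ _ (\sum_(0 <= i < M + M) 4 * (decay R i.+1 / i.+1%:R))).
  apply: ler_sum => i _; rewrite /H/= -mulr_sumr mulrCA.
  by rewrite ler_wpM2l ?(ltW (decay_gt0 _ _))// sum_inv_sqD.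
rewrite -mulr_sumr (_ : 8 * _ = 4 * (2 * base%:R)); last by ring.
rewrite ler_wpM2l//; apply: le_trans (sum_decay_div (M + M).+1).
by rewrite [leRHS]big_nat_recl// ler_wpDl// divr_ge0// ltW// decay_gt0.
Qed.

End summability.

(** * Averaged Fourier coefficients of the random maps *)

Section fourier.
Variable R : realType.
Implicit Types (k j : int * int) (G : plane R -> plane R).

Definition unif : probability (plane R) R := (circ R \x circ R)%E.

Lemma measurable_dotk k : measurable_fun setT (@dotk R k).
Proof.
by apply: measurable_funD; exact: measurable_funM.
Qed.

(* Squared modulus of the [j]-th Fourier coefficient of [e^(i k.G)]. *)
Definition acoef2 G k j : R :=
  (\int[unif]_x cos (dotk k (G x) - dotk j x)) ^+ 2 +
  (\int[unif]_x sin (dotk k (G x) - dotk j x)) ^+ 2.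

Lemma acoef2_ge0 G k j : 0 <= acoef2 G k j.
Proof. by rewrite addr_ge0 ?sqr_ge0. Qed.

(** Doubling the variable turns the squared modulus of a mean into a single integral, inside which
    the noise can be averaged. *)
Lemma sqr_cos_sin_double d (T : measurableType d) (mu : probability T R) (xi : T -> R) :
  measurable_fun setT xi ->
  (\int[mu]_x cos (xi x)) ^+ 2 + (\int[mu]_x sin (xi x)) ^+ 2 =
  \int[(mu \x mu)%E]_z cos (xi z.1 - xi z.2).
Proof.
move=> mxi; have bc := bmeas_cos mxi; have bs := bmeas_sin mxi.
rewrite Rint_prod1; last first.
  apply: bmeas_cos; apply: measurable_funB; apply: measurableT_comp => //;
  by [exact: measurable_fst|exact: measurable_snd].
rewrite /=; set C := \int[mu]_x cos _; set S := \int[mu]_x sin _.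
transitivity (\int[mu]_x (cos (xi x) * C + sin (xi x) * S)).
  by rewrite RintD ?RintZr//; apply: bmeasM => //; exact: bmeas_cst.
apply: eq_Rintegral => x _; under [RHS]eq_Rintegral do rewrite cosB.
by rewrite RintD ?RintZ//; apply: bmeasM => //; exact: bmeas_cst.
Qed.

Lemma cos_dotk_chirikov (K : R) (w x : plane R) k (c : R) :
  cos (dotk k (chirikov K w x) + c) =
  cos ((k.1 + k.2)%:~R * x.1 + k.2%:~R * x.2 + K * (k.1 + k.2)%:~R * sin (x.2 - w.1)
    - k.2%:~R * w.2 + c).
Proof.
rewrite /dotk /chirikov/= -addrA cosM_mod2pi addrCA cosM_mod2pi intrD.
by congr cos; ring.
Qed.

Lemma sin_dotk_chirikov (K : R) (w x : plane R) k (c : R) :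
  sin (dotk k (chirikov K w x) + c) =
  sin ((k.1 + k.2)%:~R * x.1 + k.2%:~R * x.2 + K * (k.1 + k.2)%:~R * sin (x.2 - w.1)
    - k.2%:~R * w.2 + c).
Proof.
by have := cos_dotk_chirikov K w x k (c - pi / 2); rewrite !addrA !cosBpihalf.
Qed.

Lemma bessel_sqN (t : R) (m : int) : bessel_sq t (- m) = bessel_sq t m.
Proof.
have H n : bessel_sq t n = \int[circ R]_y (Phi t y * cos (n%:~R * y + 0)).
  by rewrite Rint_Phi_cos cos0 mul1r.
by rewrite !H; apply: eq_Rintegral => y _; rewrite mulrNz mulNr !addr0 cosN.
Qed.

(** Both points of the pair carry the constant phase [k.2 * w.2], which cancels in the difference
    and leaves only the phase [w.1] of the shear. *)
Lemma acoef2_chirikov (K : R) (w : plane R) G k j : measurable_fun setT G ->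
  acoef2 (chirikov K w \o G) k j =
  \int[(unif \x unif)%E]_z
     cos (dotk (k.1 + k.2, k.2) (G z.1) - dotk j z.1 - (dotk (k.1 + k.2, k.2) (G z.2) - dotk j z.2)
       + K * (k.1 + k.2)%:~R * (sin ((G z.1).2 - w.1) - sin ((G z.2).2 - w.1))).
Proof.
move=> mG; have mG1 : measurable_fun setT (fun x => (G x).1).
  by apply: (measurableT_comp _ mG); exact: measurable_fst.
have mG2 : measurable_fun setT (fun x => (G x).2).
  by apply: (measurableT_comp _ mG); exact: measurable_snd.
pose xi (x : plane R) : R := (k.1 + k.2)%:~R * (G x).1 + k.2%:~R * (G x).2
   + K * (k.1 + k.2)%:~R * sin ((G x).2 - w.1) - k.2%:~R * w.2 - dotk j x.
have mxi : measurable_fun setT xi.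
  apply: measurable_funB; last exact: measurable_dotk.
  apply: measurable_funB => //; apply: measurable_funD.
    by apply: measurable_funD; exact: measurable_funM.
  apply: measurable_funM => //; apply: (measurableT_comp (@measurable_sinR R)).
  exact: measurable_funB.
rewrite /acoef2; under eq_Rintegral do rewrite cos_dotk_chirikov.
under [X in _ + X ^+ 2]eq_Rintegral do rewrite sin_dotk_chirikov.
rewrite (sqr_cos_sin_double unif mxi); apply: eq_Rintegral => z _.
by congr cos; rewrite /xi /dotk/=; ring.
Qed.

(* Averaging over the first noise component turns the transfer of Fourier modes
   under the random map into a Markov chain with transition weights [bessel_sq]. *)
Lemma Rint_acoef2_chirikov (K t : R) G k j (N : nat) (e : R) :
  measurable_fun setT G -> (0 < N)%N -> 0 < e -> t = K * (k.1 + k.2)%:~R ->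
  \int[unif]_w acoef2 (chirikov K w \o G) k j <=
  2 * `|t| * (e + (N%:R * e)^-1) +
  N%:R^-1 * \sum_(a < N) \sum_(b < N)
    bessel_sq t (a%:Z - b%:Z) * acoef2 G (k.1 + k.2, k.2 + (a%:Z - b%:Z)) j.
Proof.
move=> mG N0 e0 tE.
have mG1 : measurable_fun setT (fun x => (G x).1).
  by apply: (measurableT_comp _ mG); exact: measurable_fst.
have mG2 : measurable_fun setT (fun x => (G x).2).
  by apply: (measurableT_comp _ mG); exact: measurable_snd.
pose P2 := (unif \x unif)%E : probability (plane R * plane R)%type R.
pose al (m : int) (z : plane R * plane R) : R :=
  dotk (k.1 + k.2, k.2 + m) (G z.1) - dotk j z.1 -
  (dotk (k.1 + k.2, k.2 + m) (G z.2) - dotk j z.2).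
pose D (z : plane R * plane R) : R := (G z.1).2 - (G z.2).2.
have m1 d (T : measurableType d) (h : plane R -> T) : measurable_fun setT h ->
    measurable_fun setT (fun z : plane R * plane R => h z.1).
  by move=> mh; apply: (measurableT_comp mh); exact: measurable_fst.
have m2 d (T : measurableType d) (h : plane R -> T) : measurable_fun setT h ->
    measurable_fun setT (fun z : plane R * plane R => h z.2).
  by move=> mh; apply: (measurableT_comp mh); exact: measurable_snd.
have mxi m : measurable_fun setT (fun x => dotk (k.1 + k.2, k.2 + m) (G x) - dotk j x).
  by apply: measurable_funB; [exact: (measurableT_comp (measurable_dotk _))|exact: measurable_dotk].
have mal m : measurable_fun setT (al m).
  by apply: measurable_funB; [exact: (m1 _ _ _ (mxi m))|exact: (m2 _ _ _ (mxi m))].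
have mD : measurable_fun setT D.
  by apply: measurable_funB; [exact: (m1 _ _ _ mG2)|exact: (m2 _ _ _ mG2)].
have aE m : acoef2 G (k.1 + k.2, k.2 + m) j = \int[P2]_z cos (al m z).
  by rewrite /acoef2 (sqr_cos_sin_double unif (mxi m)).
have alD m z : al m z = al 0 z + m%:~R * D z.
  by rewrite /al /D /dotk/= !intrD; ring.
have step1 : \int[unif]_w acoef2 (chirikov K w \o G) k j =
    \int[P2]_z (cos (al 0 z) * Phi t (D z)).
  pose f (v : measurableTypeR R * (plane R * plane R)) :=
    cos (al 0 v.2 + t * (sin ((G v.2.1).2 - v.1) - sin ((G v.2.2).2 - v.1))).
  have mf1 : measurable_fun setT (fun v : measurableTypeR R * (plane R * plane R) => (G v.2.1).2).
    exact: (measurableT_comp (m1 _ _ _ mG2) measurable_snd).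
  have mf2 : measurable_fun setT (fun v : measurableTypeR R * (plane R * plane R) => (G v.2.2).2).
    exact: (measurableT_comp (m2 _ _ _ mG2) measurable_snd).
  have bf : bmeas f.
    apply: bmeas_cos; apply: measurable_funD.
      exact: (measurableT_comp (mal 0) measurable_snd).
    apply: measurable_funM => //; apply: measurable_funB;
      by apply: (measurableT_comp (@measurable_sinR R)); exact: measurable_funB.
  transitivity (\int[unif]_w \int[P2]_z f (w.1, z)).
    apply: eq_Rintegral => w _; rewrite acoef2_chirikov//.
    by apply: eq_Rintegral => z _; rewrite /f /al addr0 tE.
  have bf1 : bmeas (fun w : measurableTypeR R * measurableTypeR R => \int[P2]_z f (w.1, z)).
    exact: (bmeas_comp (h := fun w : measurableTypeR R * measurableTypeR R => w.1)
      measurable_fst (bmeas_Rint1 (circ R) P2 bf)).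
  etransitivity; first exact: (Rint_prod1 (circ R) (circ R) bf1).
  under eq_Rintegral do rewrite /= Rint_cst.
  rewrite Rint_swap//; apply: eq_Rintegral => z _.
  by rewrite /f/= Rint_circ_phaseB.
have bPhi : bmeas (fun z => Phi t (D z)).
  by apply: (bmeas_comp (h := D : plane R * plane R -> measurableTypeR R)) (bmeas_Phi t).
have bcm m : bmeas (fun z => cos (m%:~R * D z)).
  by apply: bmeas_cos; exact: measurable_funM.
have ba m : bmeas (fun z => cos (al m z)) by exact: bmeas_cos.
have bFM : bmeas (fun z => fejer_mean N t (D z)).
  apply: bmeasM; first exact: bmeas_cst.
  apply: bmeas_sum => a; apply: bmeas_sum => b; apply: bmeasM => //; exact: bmeas_cst.
pose err := 2 * `|t| * (e + (N%:R * e)^-1).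
have step2 : \int[P2]_z (cos (al 0 z) * Phi t (D z)) <=
    err + \int[P2]_z (cos (al 0 z) * fejer_mean N t (D z)).
  rewrite -[err](Rint_cst P2) -RintD; [|exact: bmeas_cst|exact: bmeasM].
  apply: ler_Rint; [exact: bmeasM|apply: bmeasD; [exact: bmeas_cst|exact: bmeasM]|].
  move=> z; rewrite -lerBlDr -mulrBr; apply: le_trans (ler_norm _) _.
  rewrite normrM -[leRHS]mul1r; apply: ler_pM => //; first exact: cos_max.
  by rewrite distrC; exact: fejer_mean_approx.
rewrite step1; apply: (le_trans step2); rewrite lerD2l.
have bpc (a b : 'I_N) : bmeas (fun z => bessel_sq t (a%:Z - b%:Z) *
    (2^-1 * (cos (al (a%:Z - b%:Z) z) + cos (al (- (a%:Z - b%:Z)) z)))).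
  by apply: bmeasM; [exact: bmeas_cst|apply: bmeasM; [exact: bmeas_cst|exact: bmeasD]].
(* [cos (al 0 z) * cos (m * D z)] is half the sum of the phases shifted by [m] and by [- m].
   Evenness of [bessel_sq] and exchange of [a] and [b] make the two halves equal after summation. *)
have -> : \int[P2]_z (cos (al 0 z) * fejer_mean N t (D z)) =
   N%:R^-1 * \sum_(a < N) \sum_(b < N) \int[P2]_z (bessel_sq t (a%:Z - b%:Z) *
    (2^-1 * (cos (al (a%:Z - b%:Z) z) + cos (al (- (a%:Z - b%:Z)) z)))).
  under [in RHS]eq_bigr do rewrite -Rint_sum//.
  rewrite -Rint_sum; last by move=> a; exact: bmeas_sum.
  rewrite -RintZ; last by apply: bmeas_sum => a; exact: bmeas_sum.
  apply: eq_Rintegral => z _; rewrite /fejer_mean mulrCA; congr (_ * _).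
  rewrite mulr_sumr; apply: eq_bigr => a _; rewrite mulr_sumr; apply: eq_bigr => b _.
  rewrite mulrCA; congr (_ * _); rewrite (alD (a%:Z - b%:Z)) (alD (- _)) mulrNz mulNr.
  by move: (al 0 z) (_ * D z) => u v; rewrite cosD cosB; field.
rewrite ler_wpM2l ?invr_ge0//.
have E m : \int[P2]_z (bessel_sq t m * (2^-1 * (cos (al m z) + cos (al (- m) z)))) =
  2^-1 * (bessel_sq t m * acoef2 G (k.1 + k.2, k.2 + m) j) +
  2^-1 * (bessel_sq t (- m) * acoef2 G (k.1 + k.2, k.2 + - m) j).
  rewrite RintZ; last by apply: bmeasM; [exact: bmeas_cst|exact: bmeasD].
  rewrite RintZ; last exact: bmeasD.
  by rewrite RintD// -!aE bessel_sqN; ring.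
under eq_bigr => a _ do under eq_bigr => b _ do rewrite E.
pose S := \sum_(a < N) \sum_(b < N)
    bessel_sq t (a%:Z - b%:Z) * acoef2 G (k.1 + k.2, k.2 + (a%:Z - b%:Z)) j.
have S2 : \sum_(a < N) \sum_(b < N)
    bessel_sq t (- (a%:Z - b%:Z)) * acoef2 G (k.1 + k.2, k.2 + - (a%:Z - b%:Z)) j = S.
  by rewrite exchange_big/=; apply: eq_bigr => a _; apply: eq_bigr => b _; rewrite opprB.
under eq_bigr do rewrite big_split/= -!mulr_sumr.
rewrite big_split/= -!mulr_sumr S2 -/S; lra.
Qed.

End fourier.

(** * Orthogonality of the modes and the case without shear *)

Section fourier_modes.
Variable R : realType.
Implicit Types (k j : int * int) (G : plane R -> plane R).

Lemma Rint_unif_cos k (c : R) :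
  \int[unif R]_x cos (dotk k x + c) = if k == (0, 0) then cos c else 0.
Proof.
have bf : bmeas (fun x : measurableTypeR R * measurableTypeR R => cos (dotk k x + c)).
  by apply: bmeas_cos; apply: measurable_funD => //; exact: measurable_dotk.
etransitivity; first exact: (Rint_prod1 (circ R) (circ R) bf).
transitivity (\int[circ R]_x (if k.2 == 0 then cos (k.1%:~R * x + c) else 0)).
  apply: eq_Rintegral => x _; rewrite -Rint_circ_cos; apply: eq_Rintegral => y _.
  by rewrite /dotk/=; congr cos; ring.
case: k {bf} => k1 k2; rewrite xpair_eqE /=; case: eqP => _; rewrite ?andbT ?andbF.
  exact: Rint_circ_cos.
exact: Rint_cst.
Qed.

Lemma Rint_unif_sin k (c : R) :
  \int[unif R]_x sin (dotk k x + c) = if k == (0, 0) then sin c else 0.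
Proof.
under eq_Rintegral do rewrite -cosBpihalf -addrA.
by rewrite Rint_unif_cos cosBpihalf.
Qed.

Lemma acoef2_id k j : acoef2 (@id (plane R)) k j = (k == j)%:R.
Proof.
have H x : dotk k x - dotk j x = dotk (k.1 - j.1, k.2 - j.2) x + 0 :> R.
  by rewrite /dotk/= !intrD !mulrNz; ring.
rewrite /acoef2; under eq_Rintegral do rewrite H.
under [X in _ + X ^+ 2]eq_Rintegral do rewrite H.
rewrite Rint_unif_cos Rint_unif_sin cos0 sin0 xpair_eqE !subr_eq0.
have -> : (k.1 == j.1) && (k.2 == j.2) = (k == j) by case: (k) (j) => ? ? [? ?].
by case: eqP => _; rewrite ?expr1n expr0n/= addr0.
Qed.

Lemma acoef2_chirikov0 (K : R) (w : plane R) G k j : measurable_fun setT G ->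
  k.1 + k.2 = 0 -> acoef2 (chirikov K w \o G) k j = acoef2 G (0, k.2) j.
Proof.
move=> mG k0; rewrite acoef2_chirikov// k0 [RHS]/acoef2 (sqr_cos_sin_double (unif R)); last first.
  by apply: measurable_funB; [exact: (measurableT_comp (measurable_dotk _))|exact: measurable_dotk].
by apply: eq_Rintegral => z _; rewrite mulr0 mul0r addr0.
Qed.

End fourier_modes.

(** The start of the induction on time, where only the coefficient [j = k] is present. It rests on
    [decay n >= 1 / n], which holds because [base >= 2]. *)
Lemma inv_ksq_le_lyap (R : realType) (k : int * int) : k != (0, 0) ->
  (ksq R k)^-1 <= 2 * lyap R k.
Proof.
move=> k0; have kp : 0 < ksq R k by apply: lt_le_trans (ksq_ge1 R k0).
have dec (n : nat) : (0 < n)%N -> n%:R^-1 <= decay R n.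
  move=> n0; rewrite /decay exprVn lef_pV2 ?posrE ?ltr0n ?exprn_gt0//.
  rewrite -natrX ler_nat; apply: leq_trans (trunc_logP base_gt1 n0).
  by elim: trunc_log => // L IH; rewrite !expnS leq_mul ?base_gt1.
have sq (z : int) : z != 0 -> `|z|%N%:R <= z%:~R ^+ 2 :> R.
  move=> z0; have : 1 <= `|z|%N%:R :> R by rewrite ler1n absz_gt0.
  have -> : z%:~R ^+ 2 = `|z|%N%:R ^+ 2 :> R by rewrite natr_absz intr_norm real_normK ?num_real.
  by move=> h; rewrite expr2 ler_peMr// (le_trans ler01).
rewrite /lyap; case: eqP => [s0|/eqP s0].
  have k1 : k.1 != 0.
    by apply: contra_neq k0 => k10; move: s0; rewrite k10 add0r; case: (k) k10 => a b /= -> ->.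
  have n0 : (0 < `|k.1|)%N by rewrite absz_gt0.
  have h : `|k.1|%N%:R <= ksq R k by rewrite /ksq ler_wpDr ?sqr_ge0// sq.
  apply: (@le_trans _ _ (`|k.1|%N%:R^-1)); first by rewrite lef_pV2 ?posrE ?ltr0n.
  by have := dec _ n0; have := decay_gt0 R `|k.1|%N; lra.
have n0 : (0 < `|(k.1 + k.2)%R|)%N by rewrite absz_gt0.
have := sq _ s0; rewrite intrD => h.
have h2 : `|(k.1 + k.2)%R|%N%:R <= 2 * ksq R k.
  by apply: (le_trans h); rewrite /ksq; have := sqr_ge0 (k.1%:~R - k.2%:~R : R); lra.
have := dec _ n0; set m := `|_|%N%:R in h2 * => hm.
have m0 : 0 < m by rewrite ltr0n.
apply: (@le_trans _ _ (2 * m^-1)); last by lra.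
by rewrite ler_pdivlMr// mulrC ler_pdivrMr.
Qed.

(** * Averaging over the noise: the Markov recursion and its decay *)

Section noise.
Variable R : realType.
Variable P : probability (noise R) R.
Hypothesis hP : is_uniform_product P.

Lemma measurable_torus : measurable (torus : set (plane R)).
Proof. by apply: measurableX; exact: measurable_itv. Qed.

Lemma unif_leb2 (A : set (plane R)) : measurable A -> unif R A = uniform_torus A.
Proof.
move=> mA.
have c0 : 0 <= (2 * pi) ^- 2 :> R by rewrite invr_ge0 sqr_ge0.
pose m' := mscale (NngNum c0) (mrestr (@leb2 R) measurable_torus).
rewrite -[RHS]/(m' A).
apply: (@product_measure_unique _ _ _ _ _ (circ R) (circ R) m') => // X Y mX mY.
have E : (X `*` Y) `&` torus = (X `&` `[0%R, (2 * pi)%R[) `*` (Y `&` `[0%R, (2 * pi)%R[).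
  by apply/seteqP; split => -[x y]/=; rewrite /torus/=; tauto.
rewrite -[LHS]/(((2 * pi) ^- 2)%:E * leb2 ((X `*` Y) `&` torus))%E E.
have mI : measurable (`[0%R, (2 * pi)%R[%classic : set (measurableTypeR R)) by exact: measurable_itv.
rewrite [X in (_ * X)%E](product_measure1E lebesgue_measure lebesgue_measure
  (measurableI _ _ mX mI) (measurableI _ _ mY mI)).
rewrite [X in _ = (X * _)%E](circE mX) [X in _ = (_ * X)%E](circE mY) expr2 invfM EFinM -!muleA; congr (_ * _)%E; rewrite muleCA; congr (_ * _)%E.
Qed.

(** Resampling of one coordinate. Independence of the noise is used only in the form that this map
    carries [unif x P] to [P]. *)
Definition repl (n : nat) (p : plane R * noise R) : noise R :=
  fun i => if i == n then p.1 else (p.2 : nat -> plane R) i.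

Lemma measurable_coord i : measurable_fun setT (fun w : noise R => (w : nat -> plane R) i).
Proof.
move=> _ A mA; rewrite setTI; apply: sub_sigma_algebra.
by exists i, A.
Qed.

Lemma measurable_to_noise d (T : measurableType d) (h : T -> noise R) :
  (forall i, measurable_fun setT (fun x => (h x : nat -> plane R) i)) -> measurable_fun setT h.
Proof.
move=> mh; apply: (measurability (@coordinate_cylinders R : set (set (noise R)))) => //.
move=> _ [_ [i [A [mA ->]]] <-].
exact: (mh i measurableT A mA).
Qed.

Lemma measurable_repl n : measurable_fun setT (repl n).
Proof.
apply: measurable_to_noise => i; rewrite /repl; case: eqP => _; first exact: measurable_fst.
exact: (measurableT_comp (measurable_coord i) measurable_snd).
Qed.

Definition cylinders : set (set (noise R)) :=
  [set C | exists (n : nat) (A : nat -> set (plane R)), (forall i, measurable (A i)) /\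
     C = [set w : nat -> plane R | forall i, (i < n)%N -> A i (w i)]].

Lemma measurable_cylinder n (A : nat -> set (plane R)) : (forall i, measurable (A i)) ->
  measurable ([set w : nat -> plane R | forall i, (i < n)%N -> A i (w i)] : set (noise R)).
Proof.
move=> mA; rewrite (_ : [set _ | _] = \bigcap_(i in `I_n) [set w : nat -> plane R | A i (w i)]).
  apply: fin_bigcap_measurable; [exact: finite_II|move=> i _]; rewrite -[X in measurable X]setTI.
  exact: (measurable_coord i).
by apply/seteqP; split => w /= H i; exact: H.
Qed.

Lemma noise_measure_unique (m1 m2 : {measure set (noise R) -> \bar R}) :
  (m1 setT < +oo)%E ->
  (forall n (A : nat -> set (plane R)), (forall i, measurable (A i)) ->
    m1 [set w : nat -> plane R | forall i, (i < n)%N -> A i (w i)] =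
    m2 [set w : nat -> plane R | forall i, (i < n)%N -> A i (w i)]) ->
  forall E, measurable E -> m1 E = m2 E.
Proof.
move=> fin H; apply: (@measure_unique _ _ _ cylinders (fun=> setT)).
- apply/seteqP; split.
    apply: smallest_sub; first exact: smallest_sigma_algebra.
    move=> _ [i [A [mA ->]]]; apply: sub_sigma_algebra.
    exists i.+1, (fun j => if j == i then A else setT); split; first by move=> j; case: ifP.
    apply/seteqP; split => w /=; first by move=> Aw j ji; case: eqP => // ->.
    by move/(_ i (ltnSn i)); rewrite eqxx.
  apply: smallest_sub; first exact: sigma_algebra_measurable.
  by move=> _ [n [A [mA ->]]]; exact: measurable_cylinder.
- move=> _ _ [n [A [mA ->]]] [m [B [mB ->]]].
  exists (maxn n m), (fun i => (if (i < n)%N then A i else setT) `&` (if (i < m)%N then B i else setT)).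
  split; first by move=> i; apply: measurableI; case: ifP.
  apply/seteqP; split => w /=.
    by move=> [Ha Hb] i _; split; case: ifP => // h; [exact: Ha|exact: Hb].
  by move=> Hab; split => i h; have [] := Hab i ltac:(by rewrite leq_max h ?orbT); rewrite h.
- move=> _; exists 0%N, (fun=> setT); split => //; apply/seteqP; split => // w _ i.
- by rewrite bigcup_const.
- by move=> _ [n [A [mA ->]]]; exact: H.
- by move=> _.
Qed.

(** Both measures need only be compared on cylinders. There the resampled factor is split off, and
    the constraint on coordinate [n] under [P] becomes the whole plane, of mass 1. *)
Lemma repl_preserves n (E : set (noise R)) : measurable E ->
  (unif R \x P)%E (repl n @^-1` E) = P E.
Proof.
move=> mE; pose m1 := pushm (unif R \x P)%E (measurable_repl n).
rewrite -[LHS]/(m1 E); apply: noise_measure_unique => //.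
  by rewrite /m1/= /pushforward preimage_setT; apply: le_lt_trans (probability_le1 (unif R \x P)%E _) (ltry _).
move=> m A mA; rewrite /m1/= /pushforward.
pose A' i := if i == n then setT else A i.
have mA' i : measurable (A' i) by rewrite /A'; case: ifP.
have -> : repl n @^-1` [set w : nat -> plane R | forall i, (i < m)%N -> A i (w i)] =
    (if (n < m)%N then A n else setT) `*` [set w : nat -> plane R | forall i, (i < m)%N -> A' i (w i)].
  apply/seteqP; split => -[u w]; rewrite /repl/=.
    move=> H; split; first by case: ifP => // nm; have := H n nm; rewrite eqxx.
    by move=> i im; rewrite /A'; case: eqP => // /eqP ni; have := H i im; rewrite (negbTE ni).
  move=> [Hu Hw] i im; case: eqP => [En|/eqP ni]; first by rewrite En in im *; rewrite im in Hu.
  by have := Hw i im; rewrite /A' (negbTE ni).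
rewrite product_measure1E; [|by case: ifP|exact: measurable_cylinder].
have TE B : measurable B -> unif R B = uniform_torus B by exact: unif_leb2.
have T1 : uniform_torus (setT : set (plane R)) = 1%E.
  by rewrite -TE// probability_setT.
rewrite [X in (_ * X)%E](hP m mA') (hP m mA); case: ltnP => nm.
  have -> : (\prod_(i < m) uniform_torus (A' i) = \prod_(i < m | i != Ordinal nm) uniform_torus (A i))%E.
    rewrite (bigD1 (Ordinal nm))//= {1}/A' eqxx T1 mul1e.
    by apply: eq_bigr => i; rewrite -val_eqE/= /A' => /negbTE ->.
  rewrite [RHS](bigD1 (Ordinal nm))//=; congr (_ * _)%E; exact: TE.
rewrite [X in (X * _)%E]probability_setT mul1e; apply: eq_bigr => i _.
by rewrite /A' ltn_eqF// (leq_trans (ltn_ord i)).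
Qed.

Variable K : R.

Lemma measurable_chirikov : measurable_fun setT (fun p : plane R * plane R => chirikov K p.1 p.2).
Proof.
have mw2 : measurable_fun setT (fun p : plane R * plane R => p.1.2).
  exact: (measurableT_comp measurable_snd measurable_fst).
have mw1 : measurable_fun setT (fun p : plane R * plane R => p.1.1).
  exact: (measurableT_comp measurable_fst measurable_fst).
have mx2 : measurable_fun setT (fun p : plane R * plane R => p.2.2).
  exact: (measurableT_comp measurable_snd measurable_snd).
have mx1 : measurable_fun setT (fun p : plane R * plane R => p.2.1).
  exact: (measurableT_comp measurable_fst measurable_snd).
have ms : measurable_fun setT (fun p : plane R * plane R => K * sin (p.2.2 - p.1.1)).
  apply: measurable_funM => //; apply: (measurableT_comp (@measurable_sinR R)).
  exact: measurable_funB.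
apply: measurable_fun_pair; apply: (measurableT_comp (@measurable_mod2pi R)).
  exact: measurable_funD.
by apply: measurable_funB => //; apply: measurable_funD => //; exact: measurable_funD.
Qed.

Lemma measurable_chirikov_iter n :
  measurable_fun setT (fun p : noise R * plane R => chirikov_iter K p.1 n p.2).
Proof.
elim: n => [|n IH] /=; first exact: measurable_snd.
apply: (measurableT_comp measurable_chirikov (g := fun p : noise R * plane R =>
  ((p.1 : nat -> plane R) n, chirikov_iter K p.1 n p.2))).
apply: measurable_fun_pair => //.
exact: (measurableT_comp (measurable_coord n) measurable_fst).
Qed.

Lemma measurable_chirikov_iter2 n (w : noise R) :
  measurable_fun setT (chirikov_iter K w n).
Proof.
exact: (measurableT_comp (measurable_chirikov_iter n) (measurable_pair1 w)).
Qed.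

Lemma bmeas_acoef2_iter n k j : bmeas (fun w : noise R => acoef2 (chirikov_iter K w n) k j).
Proof.
have mxi : measurable_fun setT (fun p : noise R * plane R => dotk k (chirikov_iter K p.1 n p.2) - dotk j p.2).
  apply: measurable_funB.
    exact: (measurableT_comp (measurable_dotk k) (measurable_chirikov_iter n)).
  exact: (measurableT_comp (measurable_dotk j) measurable_snd).
apply: bmeasD; apply: bmeasX.
  exact: (bmeas_Rint1 P (unif R) (bmeas_cos mxi)).
exact: (bmeas_Rint1 P (unif R) (bmeas_sin mxi)).
Qed.

Definition mean_acoef2 n k j : R := \int[P]_w acoef2 (chirikov_iter K w n) k j.

Lemma chirikov_iter_repl n m p x : (m <= n)%N ->
  chirikov_iter K (repl n p) m x = chirikov_iter K p.2 m x.
Proof.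
elim: m => //= m IH mn; rewrite IH; last exact: ltnW.
by rewrite /repl ltn_eqF.
Qed.

Lemma acoef2_repl n u w k j : acoef2 (chirikov_iter K (repl n (u, w)) n.+1) k j =
  acoef2 (chirikov K u \o chirikov_iter K w n) k j.
Proof.
have FE : chirikov_iter K (repl n (u, w)) n.+1 = chirikov K u \o chirikov_iter K w n.
  by apply/funext => x /=; rewrite chirikov_iter_repl//= /repl eqxx.
by rewrite FE.
Qed.

(** The first [n] steps do not read [w n], so resampling that coordinate averages the last step
    alone. *)
Lemma mean_acoef2S n k j : mean_acoef2 n.+1 k j =
  \int[P]_w \int[unif R]_u acoef2 (chirikov K u \o chirikov_iter K w n) k j.
Proof.
have b1 := bmeas_acoef2_iter n.+1 k j.
rewrite /mean_acoef2 -(Rint_pushforward (mu := (unif R \x P)%E) (nu := P) (measurable_repl n) _ b1); last first.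
  by move=> A mA; exact: repl_preserves.
have b2 := bmeas_comp (measurable_repl n) b1.
etransitivity; first exact: (Rint_prod2 (unif R) P b2).
apply: eq_Rintegral => w _; apply: eq_Rintegral => u _.
exact: acoef2_repl.
Qed.

Lemma mean_acoef2_rec n k j (N : nat) (e t : R) : (0 < N)%N -> 0 < e ->
  t = K * (k.1 + k.2)%:~R ->
  mean_acoef2 n.+1 k j <=
  2 * `|t| * (e + (N%:R * e)^-1) +
  N%:R^-1 * \sum_(a < N) \sum_(b < N)
    bessel_sq t (a%:Z - b%:Z) * mean_acoef2 n (k.1 + k.2, k.2 + (a%:Z - b%:Z)) j.
Proof.
move=> N0 e0 tE; rewrite mean_acoef2S.
have b1 := bmeas_comp (measurable_repl n) (bmeas_acoef2_iter n.+1 k j).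
have b2 : bmeas (fun w : noise R => \int[unif R]_u acoef2 (chirikov K u \o chirikov_iter K w n) k j).
  rewrite (_ : (fun _ => _) = fun w : noise R => \int[unif R]_u
    ((fun w : noise R => acoef2 (chirikov_iter K w n.+1) k j) \o repl n) (u, w)).
    exact: bmeas_Rint2.
  apply/funext => w; apply: eq_Rintegral => u _; symmetry; exact: acoef2_repl.
have ba k' := bmeas_acoef2_iter n k' j.
have bs (a b : 'I_N) : bmeas (fun w : noise R => bessel_sq t (a%:Z - b%:Z) *
    acoef2 (chirikov_iter K w n) (k.1 + k.2, k.2 + (a%:Z - b%:Z)) j).
  by apply: bmeasM => //; exact: bmeas_cst.
have b3 : bmeas (fun w : noise R => 2 * `|t| * (e + (N%:R * e)^-1) +
    N%:R^-1 * \sum_(a < N) \sum_(b < N) bessel_sq t (a%:Z - b%:Z) *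
    acoef2 (chirikov_iter K w n) (k.1 + k.2, k.2 + (a%:Z - b%:Z)) j).
  apply: bmeasD; first exact: bmeas_cst.
  by apply: bmeasM; [exact: bmeas_cst|apply: bmeas_sum => a; exact: bmeas_sum].
apply: (@le_trans _ _ _ _ _ (ler_Rint P b2 b3 _)).
  by move=> w; exact: Rint_acoef2_chirikov (measurable_chirikov_iter2 n w) N0 e0 tE.
rewrite RintD; [|exact: bmeas_cst|by apply: bmeasM; [exact: bmeas_cst|apply: bmeas_sum => a; exact: bmeas_sum]].
rewrite Rint_cst RintZ; last by apply: bmeas_sum => a; exact: bmeas_sum.
rewrite Rint_sum; last by move=> a; exact: bmeas_sum.
rewrite lerD2l ler_wpM2l ?invr_ge0//; apply: ler_sum => a _.
by rewrite Rint_sum//; apply: ler_sum => b _; rewrite RintZ.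
Qed.

Lemma mean_acoef2_rec0 n k j : k.1 + k.2 = 0 ->
  mean_acoef2 n.+1 k j = mean_acoef2 n (0, k.2) j.
Proof.
move=> k0; rewrite mean_acoef2S; apply: eq_Rintegral => w _.
transitivity (\int[unif R]_u acoef2 (chirikov_iter K w n) (0, k.2) j); last exact: Rint_cst.
by apply: eq_Rintegral => u _; rewrite acoef2_chirikov0//; exact: measurable_chirikov_iter2.
Qed.

(** Induction on time with [lyap] contracting by 1/2 at each step. The Fejer error enters with the
    factor [W], finite because [J] is a finite list, and is sent to 0 at fixed [n] and [k]; the
    resulting bound does not depend on [J]. *)
Lemma mean_acoef2_decay (J : seq (int * int)) (kap : nat) : 532 <= 2 ^+ kap :> R ->
  2 * base%:R ^+ kap <= K -> uniq J ->
  forall n k, k != (0, 0) ->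
  \sum_(j <- J) (ksq R j)^-1 * mean_acoef2 n k j <= 2 * 2^-1 ^+ n * lyap R k.
Proof.
move=> hk hK uJ; have K0 : 0 <= K by apply: le_trans hK; rewrite mulr_ge0 ?exprn_ge0.
elim=> [|n IH] k k0.
  rewrite expr0 mulr1; apply: (le_trans _ (inv_ksq_le_lyap R k0)).
  have m0 j : mean_acoef2 0 k j = (k == j)%:R.
    by rewrite /mean_acoef2/= (_ : (fun _ => _) = cst (k == j)%:R) ?Rint_cst//; apply/funext => w /=; exact: acoef2_id.
  under eq_bigr do rewrite m0.
  have [kJ|kJ] := boolP (k \in J).
    rewrite (bigD1_seq k)//= eqxx mulr1 big1 ?addr0// => j jk.
    by rewrite eq_sym (negbTE jk) mulr0.
  rewrite big_seq big1 ?invr_ge0 ?ksq_ge0// => j jJ.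
  by case: eqP => [kj|_]; rewrite ?mulr0//; rewrite kj jJ in kJ.
have [s0|s0] := eqVneq (k.1 + k.2) 0.
  under eq_bigr do rewrite mean_acoef2_rec0//.
  have k20 : k.2 != 0.
    by apply: contra_neq k0 => k20; move: s0; rewrite k20 addr0; case: (k) k20 => a b /= -> ->.
  apply: le_trans (IH (0, k.2) _) _; first by rewrite xpair_eqE eqxx.
  rewrite /lyap/= s0 eqxx add0r (negbTE k20).
  have -> : `|k.1|%N = `|k.2|%N by rewrite (_ : k.1 = - k.2) ?abszN//; apply/eqP; rewrite -addr_eq0 s0.
  by rewrite exprS; lra.
set t := K * (k.1 + k.2)%:~R.
pose W := \sum_(j <- J) (ksq R j)^-1.
have W0 : 0 <= W by apply: sumr_ge0 => j _; rewrite invr_ge0 ksq_ge0.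
have step (N : nat) (e : R) : (0 < N)%N -> 0 < e ->
  \sum_(j <- J) (ksq R j)^-1 * mean_acoef2 n.+1 k j <=
    W * (2 * `|t| * (e + (N%:R * e)^-1)) + 2 * 2^-1 ^+ n.+1 * lyap R k.
  move=> N0 e0; have NR : 0 < N%:R :> R by rewrite ltr0n.
  apply: (@le_trans _ _ (\sum_(j <- J) (ksq R j)^-1 * (2 * `|t| * (e + (N%:R * e)^-1) +
    N%:R^-1 * \sum_(a < N) \sum_(b < N)
    bessel_sq t (a%:Z - b%:Z) * mean_acoef2 n (k.1 + k.2, k.2 + (a%:Z - b%:Z)) j))).
    apply: ler_sum => j _; rewrite ler_wpM2l ?invr_ge0 ?ksq_ge0//.
    exact: mean_acoef2_rec.
  under eq_bigr do rewrite mulrDr.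
  rewrite big_split/= -mulr_suml lerD2l.
  have -> : \sum_(j <- J) (ksq R j)^-1 * (N%:R^-1 * \sum_(a < N) \sum_(b < N)
    bessel_sq t (a%:Z - b%:Z) * mean_acoef2 n (k.1 + k.2, k.2 + (a%:Z - b%:Z)) j) =
    N%:R^-1 * \sum_(b < N) \sum_(a < N) bessel_sq t (a%:Z - b%:Z) *
      \sum_(j <- J) (ksq R j)^-1 * mean_acoef2 n (k.1 + k.2, k.2 + (a%:Z - b%:Z)) j.
    under eq_bigr do rewrite mulrCA.
    rewrite -mulr_sumr; congr (_ * _); under eq_bigr do rewrite mulr_sumr.
    rewrite exchange_big [RHS]exchange_big; apply: eq_bigr => a _ /=.
    under eq_bigr do rewrite mulr_sumr.
    rewrite exchange_big; apply: eq_bigr => b _ /=.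
    by rewrite mulr_sumr; apply: eq_bigr => j _; rewrite mulrCA.
  rewrite ler_pdivrMl//.
  apply: (@le_trans _ _ (\sum_(b < N) 2 * 2^-1 ^+ n.+1 * lyap R k)); last first.
    by rewrite sumr_const card_ord -[leLHS]mulr_natl.
  apply: ler_sum => b _.
  have bt : 2 * base%:R ^+ kap * `|(k.1 + k.2)%R|%N%:R <= `|t|.
    by rewrite /t normrM (ger0_norm K0) -intr_norm -natr_absz ler_wpM2r.
  (* For fixed [b] the differences [a - b] run through a window starting at [- b]. *)
  have := lyap_window N (- b%:Z) (k.1 + k.2 + k.2 - b%:Z) hk s0 bt.
  have lE : lyap R k = decay R `|(k.1 + k.2)%R|%N by rewrite /lyap (negbTE s0).
  move=> H.
  apply: (@le_trans _ _ (2 * 2^-1 ^+ n * (decay R `|(k.1 + k.2)%R|%N / 2))).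
    2: by rewrite lE exprS; lra.
  apply: (le_trans _ (ler_wpM2l _ H)); last by rewrite mulr_ge0 ?exprn_ge0 ?invr_ge0.
  rewrite mulr_sumr; apply: ler_sum => a _.
  rewrite [leRHS]mulrCA (addrC (- b%:Z)) ler_wpM2l ?bessel_sq_ge0//.
  apply: le_trans (IH _ _) _; first by rewrite xpair_eqE (negbTE s0).
  rewrite ler_wpM2l ?mulr_ge0 ?exprn_ge0 ?invr_ge0// /lyap/=.
  have -> : k.1 + k.2 + k.2 - b%:Z + a%:Z = k.1 + k.2 + (k.2 + (a%:Z - b%:Z)) by ring.
  by [].
apply/ler_addgt0Pr => e e0.
pose c := W * (2 * `|t|) + 1.
have c0 : 0 < c by rewrite ltr_wpDl// !mulr_ge0.
pose d := e / (2 * c); have d0 : 0 < d by rewrite divr_gt0// mulr_gt0.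
have dE : e = c * (d + d) by rewrite /d; field; rewrite gt_eqF.
clearbody d.
(* With [e = d] and [N >= d ^- 2], each of the two Fejer errors is at most [d]. *)
pose N := (Num.trunc (d ^- 2)).+1.
have ND : d ^- 2 <= N%:R by rewrite ltW// truncnS_gt.
have NR : 0 < N%:R :> R by rewrite ltr0n.
apply: le_trans (step N d (ltn0Sn _) d0) _; rewrite addrC lerD2l.
have : (N%:R * d)^-1 <= d.
  rewrite -[X in _ <= X]invrK lef_pV2 ?posrE ?invr_gt0 ?mulr_gt0//.
  apply: (@le_trans _ _ (d ^- 2 * d)).
    by rewrite expr2 invfM mulfVK// gt_eqF.
  by rewrite ler_pM2r.
move=> h; apply: (@le_trans _ _ (W * (2 * `|t|) * (d + d))).
  by rewrite mulrA ler_wpM2l ?mulr_ge0// lerD2l.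
rewrite dE; by rewrite ler_wpM2r ?addr_ge0 ?(ltW d0)// /c lerDl.
Qed.

Lemma mean_acoef2_sum (kap : nat) : 532 <= 2 ^+ kap :> R -> 2 * base%:R ^+ kap <= K ->
  forall n M, \sum_(a <- zrange M) \sum_(b <- zrange M) (ksq R (a, b))^-1 *
    \sum_(c <- zrange M) \sum_(d <- zrange M) (ksq R (c, d))^-1 * mean_acoef2 n (a, b) (c, d)
  <= 24 * (4 + 8 * base%:R) * 2^-1 ^+ n.
Proof.
move=> hk hK n M.
apply: (@le_trans _ _ (\sum_(a <- zrange M) \sum_(b <- zrange M)
   2 * 2^-1 ^+ n * ((ksq R (a, b))^-1 * lyap R (a, b)))).
  apply: ler_sum => a _; apply: ler_sum => b _.
  (* The zero mode is fixed by the dynamics and does not decay; its weight is [0^-1 = 0]. *)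
  have [->|ab] := eqVneq (a, b) (0, 0).
    by rewrite /ksq/= expr0n/= add0r invr0 !mul0r mulr0.
  rewrite mulrCA ler_wpM2l ?invr_ge0 ?ksq_ge0//.
  pose J := [seq (c, d) | c <- zrange M, d <- zrange M].
  have uJ : uniq J by apply: allpairs_uniq; rewrite ?uniq_zrange// => -[? ?] [? ?].
  apply: (le_trans _ (mean_acoef2_decay hk hK uJ n ab)).
  by rewrite big_allpairs.
under eq_bigr do rewrite -mulr_sumr.
rewrite -mulr_sumr; have := lyap_summable R M => h.
apply: le_trans (ler_wpM2l _ h) _; first by rewrite mulr_ge0 ?exprn_ge0 ?invr_ge0.
by rewrite le_eqVlt; apply/orP; left; apply/eqP; ring.
Qed.

End noise.

(** * Density of trigonometric polynomials in L^2 *)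

Lemma discriminant_le (R : realFieldType) (a b c : R) :
  0 <= a -> (forall t, 0 <= a * t ^+ 2 - 2 * b * t + c) -> b ^+ 2 <= a * c.
Proof.
move=> a0 H; have [a00|an0] := eqVneq a 0.
  have [->|b0] := eqVneq b 0; first by rewrite expr0n/= a00 mul0r.
  have := H ((c + 1) / (2 * b)); rewrite a00 mul0r sub0r.
  rewrite (_ : 2 * b * _ = c + 1); [lra|by field].
have ap : 0 < a by rewrite lt_neqAle eq_sym an0.
have := H (b / a); rewrite (_ : _ + c = (a * c - b ^+ 2) / a); last by field.
by rewrite pmulr_lge0 ?invr_gt0// subr_ge0.
Qed.

Lemma sum_cauchy_schwarz (R : realFieldType) (I : Type) (s : seq I) (x y : I -> R) :
  (\sum_(i <- s) x i * y i) ^+ 2 <= (\sum_(i <- s) x i ^+ 2) * (\sum_(i <- s) y i ^+ 2).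
Proof.
apply: discriminant_le; first by apply: sumr_ge0 => i _; exact: sqr_ge0.
move=> t; rewrite (_ : _ + _ = \sum_(i <- s) (x i * t - y i) ^+ 2).
  by apply: sumr_ge0 => i _; exact: sqr_ge0.
under [RHS]eq_bigr do rewrite sqrrB.
rewrite big_split/= sumrB; congr (_ - _ + _).
  by rewrite mulr_suml; apply: eq_bigr => i _; rewrite exprMn.
rewrite -mulrA mulr_suml mulr_sumr; apply: eq_bigr => i _.
by rewrite -mulr_natl; ring.
Qed.

(** * Square-integrable functions on a probability space *)

Section L2.
Context d (T : measurableType d) (R : realType) (mu : probability T R).
Implicit Types f g h : T -> R.

Definition sq_integrable f : Prop :=
  measurable_fun setT f /\ mu.-integrable setT (EFin \o (fun x => f x ^+ 2)).

Definition sqnorm f : R := \int[mu]_x f x ^+ 2.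

Lemma sqnorm_ge0 f : 0 <= sqnorm f.
Proof. by apply: Rint_ge0 => x; exact: sqr_ge0. Qed.

Lemma sq_integrable_bmeas f : bmeas f -> sq_integrable f.
Proof.
by move=> bf; split; [case: bf|apply: bmeas_integrable; exact: bmeasX].
Qed.

Lemma integrableDR f g : mu.-integrable setT (EFin \o f) -> mu.-integrable setT (EFin \o g) ->
  mu.-integrable setT (EFin \o (fun x => f x + g x)).
Proof.
move=> If Ig; have := integrableD measurableT If Ig.
by apply: eq_integrable => // x _.
Qed.

Lemma integrableZR r f : mu.-integrable setT (EFin \o f) ->
  mu.-integrable setT (EFin \o (fun x => r * f x)).
Proof.
move=> If; have := integrableZl measurableT r If.
by apply: eq_integrable => // x _.
Qed.

Lemma sq_integrableM f g : sq_integrable f -> sq_integrable g ->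
  mu.-integrable setT (EFin \o (fun x => f x * g x)).
Proof.
move=> [mf if2] [mg ig2].
apply: (@le_integrable _ _ _ mu setT _ _ (EFin \o (fun x => f x ^+ 2 + g x ^+ 2))) => //.
- by apply/measurable_EFinP; exact: measurable_funM.
- move=> x _ /=; rewrite lee_fin [leRHS]ger0_norm; last by rewrite addr_ge0// sqr_ge0.
  rewrite normrM -(real_normK (num_real (f x))) -(real_normK (num_real (g x))).
  have := sqr_ge0 (`|f x| - `|g x|); have := normr_ge0 (f x); have := normr_ge0 (g x); nra.
- exact: integrableDR.
Qed.

Lemma sq_integrableD f g : sq_integrable f -> sq_integrable g ->
  sq_integrable (fun x => f x + g x).
Proof.
move=> If Ig; have ifg := sq_integrableM If Ig; case: If => mf if2; case: Ig => mg ig2.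
split; first exact: measurable_funD.
have := integrableD measurableT (integrableD measurableT if2 ig2)
  (integrableZl measurableT 2 ifg).
apply: eq_integrable => // x _ /=; rewrite -!EFinM -!EFinD; congr EFin; ring.
Qed.

Lemma sq_integrableZ r f : sq_integrable f -> sq_integrable (fun x => r * f x).
Proof.
move=> [mf if2]; split; first exact: measurable_funM.
have := integrableZl measurableT (r ^+ 2) if2.
by apply: eq_integrable => // x _ /=; rewrite -EFinM; congr EFin; ring.
Qed.

Lemma sq_integrableB f g : sq_integrable f -> sq_integrable g ->
  sq_integrable (fun x => f x - g x).
Proof.
move=> If Ig; have := sq_integrableD If (sq_integrableZ (-1) Ig).
by congr sq_integrable; apply/funext => x; rewrite mulN1r.
Qed.

Lemma sqnormD_le f g : sq_integrable f -> sq_integrable g ->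
  sqnorm (fun x => f x + g x) <= 2 * sqnorm f + 2 * sqnorm g.
Proof.
move=> If Ig; have Ifg := sq_integrableD If Ig.
case: If => mf if2; case: Ig => mg ig2; case: Ifg => mfg ifg2.
rewrite /sqnorm -!RintegralZl// -RintegralD//; first last.
- exact: (integrableZl measurableT 2 ig2).
- exact: (integrableZl measurableT 2 if2).
apply: le_Rintegral => //.
  exact: integrableDR (integrableZR 2 if2) (integrableZR 2 ig2).
by move=> x _; have := sqr_ge0 (f x - g x); lra.
Qed.

Lemma cauchy_schwarz f g : sq_integrable f -> sq_integrable g ->
  (\int[mu]_x (f x * g x)) ^+ 2 <= sqnorm f * sqnorm g.
Proof.
move=> If Ig; have ifg := sq_integrableM If Ig.
apply: discriminant_le; first exact: sqnorm_ge0.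
move=> t; rewrite (_ : _ + _ = sqnorm (fun x => t * f x - g x)); first exact: sqnorm_ge0.
case: If => mf if2; case: Ig => mg ig2.
rewrite /sqnorm.
transitivity (\int[mu]_x (t ^+ 2 * f x ^+ 2 + - (2 * t) * (f x * g x) + g x ^+ 2)); last first.
  by apply: eq_Rintegral => x _; ring.
have i1 := integrableZR (t ^+ 2) if2.
have i2 := integrableZR (- (2 * t)) ifg.
rewrite RintegralD//; last exact: integrableDR i1 i2.
rewrite RintegralD// !RintegralZl//; ring.
Qed.

Lemma norm_Rint_mul_le f g : sq_integrable f -> sq_integrable g ->
  `|\int[mu]_x (f x * g x)| <= Num.sqrt (sqnorm f) * Num.sqrt (sqnorm g).
Proof.
move=> If Ig; rewrite -sqrtrM ?sqnorm_ge0// -sqrtr_sqr ler_sqrt ?mulr_ge0 ?sqnorm_ge0//.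
exact: cauchy_schwarz.
Qed.

Lemma sqnorm_dominated (G : T -> R) (g : T -> R) (gn : nat -> T -> R) :
  sq_integrable G -> measurable_fun setT g -> (forall n, measurable_fun setT (gn n)) ->
  (forall x, `|g x| <= G x) -> (forall n x, `|gn n x| <= G x) ->
  {ae mu, forall x, gn ^~ x @ \oo --> g x} ->
  sq_integrable g /\ (forall n, sq_integrable (gn n)) /\
  forall e, 0 < e -> exists n, sqnorm (fun x => g x - gn n x) <= e.
Proof.
move=> [mG iG2] mg mgn gG gnG cv.
have dom f : measurable_fun setT f -> (forall x, `|f x| <= G x) -> sq_integrable f.
  move=> mf fG; split => //.
  apply: (@le_integrable _ _ _ mu setT _ _ (EFin \o (fun x => G x ^+ 2))) => //.
    by apply/measurable_EFinP; exact: measurable_funX.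
  move=> x _ /=; rewrite lee_fin !ger0_norm ?sqr_ge0//.
  rewrite -(real_normK (num_real (f x))) lerXn2r ?nnegrE//.
  by apply: le_trans (fG x).
split; first exact: dom.
split; first by move=> n; exact: dom.
have I2 n := sq_integrableB (dom g mg gG) (dom _ (mgn n) (gnG n)).
pose fn n x := ((g x - gn n x) ^+ 2)%:E.
have [] := @dominated_convergence _ _ _ mu setT measurableT fn (cst 0%E) (fun x => (4 * G x ^+ 2)%:E).
- by move=> n; apply/measurable_EFinP; apply: measurable_funX; exact: measurable_funB.
- exact: measurable_cst.
- apply: filterS cv => x cx _; rewrite /fn.
  apply: cvg_EFin => /=; first by near=> n.
  rewrite [X in X @ _](_ : _ = (fun n => (g x - gn n x) * (g x - gn n x)))//.
  have c0 : g x - gn n x @[n --> \oo] --> (0 : R).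
    by rewrite -(subrr (g x)); apply: cvgB => //; exact: cvg_cst.
  by rewrite -[X in _ --> X](mul0r (0 : R)); apply: cvgM.
- exact: (integrableZl measurableT 4 iG2).
- apply: aeW => x n _; rewrite /fn /= lee_fin ger0_norm ?sqr_ge0//.
  have := ler_normB (g x) (gn n x); have := gG x; have := gnG n x => h1 h2 h3.
  rewrite -(real_normK (num_real (_ - _))).
  have := normr_ge0 (g x - gn n x); have := normr_ge0 (g x) => h4 h5; nra.
move=> _ _; rewrite integral0 => /fine_cvgP[_ H].
move=> e e0; have /cvgrPdist_le/(_ e e0)[N _ /(_ N (leqnn N))] /= := H.
rewrite /fn sub0r normrN => h; exists N; exact: le_trans (ler_norm _) h.
Unshelve. all: by end_near.
Qed.

End L2.

(** * Trigonometric polynomials and approximation of arcs *)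

Section trigonometric_polynomials.
Variable R : realType.
Implicit Types (f g : plane R -> R) (k l : int * int).

(** The free phase [c] makes sines a special case, and the inductive form lets orthogonality and
    products be checked on a single cosine. *)
Inductive trig (M : nat) : (plane R -> R) -> Prop :=
| trig_cos k c : (`|k.1| <= M)%N -> (`|k.2| <= M)%N -> trig M (fun x => cos (dotk k x + c))
| trigD f g : trig M f -> trig M g -> trig M (fun x => f x + g x)
| trigZ r f : trig M f -> trig M (fun x => r * f x).

Lemma trig_mono M N f : (M <= N)%N -> trig M f -> trig N f.
Proof.
move=> MN; elim => [k c k1 k2|{}f g _ Tf _ Tg|r {}f _ Tf].
- by apply: trig_cos; exact: leq_trans MN.
- exact: trigD.
- exact: trigZ.
Qed.

Lemma bmeas_trig M f : trig M f -> bmeas f.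
Proof.
elim => [k c _ _|{}f g _ Tf _ Tg|r {}f _ Tf].
- by apply: bmeas_cos; apply: measurable_funD => //; exact: measurable_dotk.
- exact: bmeasD.
- by apply: bmeasM => //; exact: bmeas_cst.
Qed.

Lemma trig_cst M (r : R) : trig M (fun=> r).
Proof.
have -> : (fun=> r) = (fun x : plane R => r * cos (dotk (0, 0) x + 0)).
  by apply/funext => x; rewrite /dotk/= !mul0r !addr0 cos0 mulr1.
by apply: trigZ; exact: trig_cos.
Qed.

Lemma trigB M f g : trig M f -> trig M g -> trig M (fun x => f x - g x).
Proof.
move=> Tf Tg; have := trigD Tf (trigZ (-1) Tg).
by congr trig; apply/funext => x; rewrite mulN1r.
Qed.

Lemma trig_sin M k c : (`|k.1| <= M)%N -> (`|k.2| <= M)%N ->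
  trig M (fun x => sin (dotk k x + c)).
Proof.
move=> k1 k2; have := trig_cos (c - pi / 2) k1 k2.
by congr trig; apply/funext => x; rewrite addrA cosBpihalf.
Qed.

Lemma trigM M N f g : trig M f -> trig N g -> trig (M + N) (fun x => f x * g x).
Proof.
move=> Tf; elim: Tf g => [k c k1 k2 g Tg|{}f h _ Tf _ Th g Tg|r {}f _ Tf g Tg].
- elim: Tg => [l e l1 l2|{}f {}g _ Tf _ Tg|r {}f _ Tf].
  + have -> : (fun x : plane R => cos (dotk k x + c) * cos (dotk l x + e)) =
       (fun x => 2^-1 * (cos (dotk (k.1 + l.1, k.2 + l.2) x + (c + e)) +
                         cos (dotk (k.1 - l.1, k.2 - l.2) x + (c - e)))).
      apply/funext => x; rewrite (_ : dotk _ x + (c + e) = (dotk k x + c) + (dotk l x + e)); last first.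
        by rewrite /dotk/= !intrD; ring.
      rewrite (_ : dotk _ x + (c - e) = (dotk k x + c) - (dotk l x + e)); last first.
        by rewrite /dotk/= !intrD !mulrNz; ring.
      by move: (dotk k x + c) (dotk l x + e) => u v; rewrite cosD cosB; field.
    apply: trigZ; apply: trigD; apply: trig_cos => /=; lia.
  + have -> : (fun x : plane R => cos (dotk k x + c) * (f x + g x)) =
      (fun x => cos (dotk k x + c) * f x + cos (dotk k x + c) * g x).
      by apply/funext => x; rewrite mulrDr.
    exact: trigD.
  + have -> : (fun x : plane R => cos (dotk k x + c) * (r * f x)) =
      (fun x => r * (cos (dotk k x + c) * f x)).
      by apply/funext => x; rewrite mulrCA.
    exact: trigZ.
- have -> : (fun x => (f x + h x) * g x) = (fun x => f x * g x + h x * g x).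
    by apply/funext => x; rewrite mulrDl.
  by apply: trigD; [exact: Tf|exact: Th].
- have -> : (fun x => r * f x * g x) = (fun x => r * (f x * g x)).
    by apply/funext => x; rewrite mulrA.
  by apply: trigZ; exact: Tf.
Qed.

(* Iterating the odd cubic [u |-> (3 u - u^3) / 2], which maps [-1, 1] to itself, drives
   [u] to its sign: the indicator of an arc is a limit of trigonometric polynomials. *)
Fixpoint sgn_iter (n : nat) (u : R) : R :=
  if n is m.+1 then (3 * sgn_iter m u - sgn_iter m u ^+ 3) / 2 else u.

Lemma sgn_iterN n u : sgn_iter n (- u) = - sgn_iter n u.
Proof. by elim: n => //= n ->; field. Qed.

(** With [s] the current iterate, the distance to 1 is multiplied by
    [(1 - s) * (2 + s) / 2 <= 1 - s / 2], and [s >= u] throughout. *)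
Lemma sgn_iter_pos n u : 0 <= u <= 1 ->
  u <= sgn_iter n u <= 1 /\ 1 - sgn_iter n u <= (1 - u / 2) ^+ n.
Proof.
move=> /andP[u0 u1]; elim: n => [|n [/andP[h1 h2] h3]] /=; first by rewrite lexx u1 expr0; split => //; lra.
set s := sgn_iter n u in h1 h2 h3 *; split.
  apply/andP; split.
    apply: (le_trans h1); rewrite -subr_ge0.
    rewrite (_ : _ - s = s * (1 - s) * (1 + s) / 2); last by field.
    by rewrite divr_ge0// !mulr_ge0 ?subr_ge0//; lra.
  rewrite -subr_ge0 (_ : _ - _ = (1 - s) * (1 - s) * (2 + s) / 2); last by field.
  by rewrite divr_ge0// !mulr_ge0 ?subr_ge0//; lra.
rewrite (_ : 1 - _ = (1 - s) * ((1 - s) * (2 + s) / 2)); last by field.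
rewrite exprSr; apply: ler_pM => //; first by rewrite subr_ge0.
  by rewrite divr_ge0// !mulr_ge0 ?subr_ge0//; lra.
have := sqr_ge0 s; lra.
Qed.

Lemma sgn_iter_norm n u : `|u| <= 1 -> `|sgn_iter n u| <= 1.
Proof.
move=> u1; case: (ger0P u) u1 => u0 u1.
  have := @sgn_iter_pos n u; rewrite u0 u1 => /(_ isT) [/andP[h1 h2] _].
  by rewrite ger0_norm// (le_trans u0).
have := @sgn_iter_pos n (- u); rewrite u1 oppr_ge0 (ltW u0) => /(_ isT) [/andP[h1 h2] _].
by rewrite -normrN -sgn_iterN ger0_norm// (le_trans _ h1)// oppr_ge0 ltW.
Qed.

Lemma sgn_iter_cvg u : `|u| <= 1 -> sgn_iter ^~ u @ \oo --> Num.sg u.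
Proof.
have pos v : 0 < v <= 1 -> sgn_iter ^~ v @ \oo --> (1 : R).
  move=> /andP[v0 v1]; have H n := @sgn_iter_pos n v (introT andP (conj (ltW v0) v1)).
  apply/cvgrPdist_le => e e0.
  have : (fun n => (1 - v / 2) ^+ n) @ \oo --> (0 : R) by apply: cvg_expr; rewrite ger0_norm; lra.
  move/cvgrPdist_le => /(_ e e0); apply: filterS => n.
  rewrite sub0r normrN => h; have [/andP[h1 h2] h3] := H n.
  rewrite ger0_norm ?subr_ge0//; apply: (le_trans h3); exact: le_trans (ler_norm _) h.
move=> u1; case: (ltgtP u 0) => [un|up|->].
- rewrite ltr0_sg//; have -> : sgn_iter ^~ u = fun n => - sgn_iter n (- u).
    by apply/funext => n; rewrite -sgn_iterN opprK.
  by apply: cvgN; apply: pos; rewrite oppr_gt0 un -(ltr0_norm un).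
- by rewrite gtr0_sg//; apply: pos; rewrite up -(gtr0_norm up).
- rewrite sgr0; have -> : sgn_iter ^~ (0 : R) = cst 0; last exact: cvg_cst.
  by apply/funext => n /=; elim: n => //= n ->; rewrite mulr0 expr0n subr0 mul0r.
Qed.

(** The quadratic sends the signs -1, 0, 1 to 0, 0, 1, so the limit is the indicator of strict
    positivity. *)
Definition step_iter (n : nat) (u : R) : R := (sgn_iter n u ^+ 2 + sgn_iter n u) / 2.

Lemma step_iter_norm n u : `|u| <= 1 -> `|step_iter n u| <= 1.
Proof.
move=> /(sgn_iter_norm n); rewrite /step_iter; set s := sgn_iter n u.
rewrite !ler_norml => /andP[h1 h2]; apply/andP; split; nra.
Qed.

Lemma step_iter_cvg u : `|u| <= 1 -> step_iter ^~ u @ \oo --> ((0 < u)%R%:R : R).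
Proof.
move=> u1; have sc := sgn_iter_cvg u1.
have -> : ((0 < u)%R%:R : R) = (Num.sg u * Num.sg u + Num.sg u) / 2.
  by case: (ltgtP u 0) => [h|h|->]; rewrite ?(ltr0_sg h) ?(gtr0_sg h) ?sgr0/=; lra.
rewrite (_ : step_iter ^~ u = fun n => (sgn_iter n u * sgn_iter n u + sgn_iter n u) / 2).
  by apply: cvgMl; apply: cvgD => //; exact: cvgM.
by apply/funext => n.
Qed.

Lemma trig_step_iter n M f : trig M f -> exists N, trig N (fun x => step_iter n (f x)).
Proof.
move=> Tf; have [N TN] : exists N, trig N (fun x => sgn_iter n (f x)).
  elim: n => [|n [N TN]]; first by exists M.
  exists (N + N + N)%N.
  have := trigZ 2^-1 (trigB (trigZ 3 (trig_mono (leq_trans (leq_addr N N) (leq_addr N _)) TN))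
    (trigM (trigM TN TN) TN)).
  by congr trig; apply/funext => x /=; rewrite mulrC !exprS expr0 mulr1 mulrA.
exists (N + N)%N.
have := trigZ 2^-1 (trigD (trigM TN TN) (trig_mono (leq_addr N N) TN)).
by congr trig; apply/funext => x /=; rewrite mulrC.
Qed.

(** The value [None] leaves a coordinate unconstrained, as the one-variable Dynkin arguments require
    for their full set. *)
Definition ray (o : option R) : set (measurableTypeR R) :=
  if o is Some a then `]-oo, a[%classic else setT.

(** For [0 < a < 2 * pi], the arc below [a] is where [sin (x / 2) * sin ((a - x) / 2)] is positive.
    The factors have half-integer frequencies, but their product is a trigonometric polynomial of
    degree 1, to which [step_iter] is applied. *)
Lemma ray_approx (o : option R) : exists q : nat -> R -> R,
  (forall n x, `|q n x| <= 1) /\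
  (forall n, exists M, trig M (fun x => q n x.1) /\ trig M (fun x => q n x.2)) /\
  (forall x, 0 < x < 2 * pi -> q ^~ x @ \oo --> (\1_(ray o) x : R)).
Proof.
case: o => [a|] /=; last first.
  exists (fun _ _ => 1); split; first by move=> *; rewrite normr1.
  split; first by move=> _; exists 0%N; split; exact: trig_cst.
  by move=> x _; rewrite indicT; exact: cvg_cst.
have [a0|a0] := leP a 0.
  exists (fun _ _ => 0); split; first by move=> *; rewrite normr0.
  split; first by move=> _; exists 0%N; split; exact: trig_cst.
  move=> x /andP[x0 _]; rewrite indicE memNset; first exact: cvg_cst.
  by rewrite /= in_itv/=; lra.
have [a1|a1] := leP (2 * pi) a.
  exists (fun _ _ => 1); split; first by move=> *; rewrite normr1.
  split; first by move=> _; exists 0%N; split; exact: trig_cst.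
  move=> x /andP[_ x1]; rewrite indicE mem_set; first exact: cvg_cst.
  by rewrite /= in_itv/=; lra.
pose u x : R := 2^-1 * (cos (x + - (a / 2)) - cos (a / 2)).
have uE x : u x = sin (x / 2) * sin ((a - x) / 2).
  rewrite /u (_ : x + - (a / 2) = x / 2 - (a - x) / 2); last by field.
  rewrite (_ : a / 2 = x / 2 + (a - x) / 2); last by field.
  by rewrite cosB cosD; field.
have u1 x : `|u x| <= 1 by rewrite uE normrM -[leRHS]mul1r; apply: ler_pM => //; exact: sin_max.
exists (fun n x => step_iter n (u x)); split; first by move=> n x; exact: step_iter_norm.
split.
  move=> n.
  have [N1 T1] : exists N, trig N (fun x => step_iter n (u x.1)).
    apply: (@trig_step_iter n 1 (fun x => u x.1)); apply: trigZ; apply: trigB; last exact: trig_cst.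
    have := @trig_cos 1 (1, 0) (- (a / 2)) isT isT; congr trig; apply/funext => x.
    by rewrite /dotk/= mul1r mul0r addr0.
  have [N2 T2] : exists N, trig N (fun x => step_iter n (u x.2)).
    apply: (@trig_step_iter n 1 (fun x => u x.2)); apply: trigZ; apply: trigB; last exact: trig_cst.
    have := @trig_cos 1 (0, 1) (- (a / 2)) isT isT; congr trig; apply/funext => x.
    by rewrite /dotk/= mul1r mul0r add0r.
  by exists (N1 + N2)%N; split; [apply: trig_mono T1; exact: leq_addr|apply: trig_mono T2; exact: leq_addl].
move=> x /andP[x0 x1]; have -> : \1_(`]-oo, a[) x = (0 < u x)%R%:R :> R; last exact: step_iter_cvg.
have sx : 0 < sin (x / 2) by apply: sin_gt0_pi; apply/andP; split; lra.
rewrite indicE uE pmulr_rgt0//; congr (_%:R); case: (ltP x a) => xa.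
  rewrite mem_set; last by rewrite /= in_itv.
  by rewrite sin_gt0_pi//; apply/andP; split; lra.
rewrite memNset; last by rewrite /= in_itv/=; apply/negP; rewrite -leNgt.
have h : sin ((a - x) / 2) <= 0.
  by rewrite -oppr_ge0 -sinN; apply: sin_ge0_pi; apply/andP; split; lra.
by rewrite ltNge h.
Qed.

Definition trig_dense g : Prop := forall e : R, 0 < e ->
  exists M h, trig M h /\ sqnorm (unif R) (fun x => g x - h x) <= e.

Lemma trig_dense_lim g : sq_integrable (unif R) g ->
  (forall e, 0 < e -> exists h, [/\ sq_integrable (unif R) h, trig_dense h &
     sqnorm (unif R) (fun x => g x - h x) <= e]) -> trig_dense g.
Proof.
move=> Ig H e e0; have e4 : 0 < e / 4 by rewrite divr_gt0.
have [h [Ih Vh he]] := H _ e4; have [M [t [Tt te]]] := Vh _ e4.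
exists M, t; split => //.
have It := sq_integrable_bmeas (unif R) (bmeas_trig Tt).
have := sqnormD_le (sq_integrableB Ig Ih) (sq_integrableB Ih It).
rewrite (_ : (fun x => _) = fun x => g x - t x); first lra.
by apply/funext => x; ring.
Qed.

Lemma trig_denseD f g : sq_integrable (unif R) f -> sq_integrable (unif R) g ->
  trig_dense f -> trig_dense g -> trig_dense (fun x => f x + g x).
Proof.
move=> If Ig Vf Vg e e0; have e4 : 0 < e / 4 by rewrite divr_gt0.
have [M [t [Tt te]]] := Vf _ e4; have [N [s [Ts se]]] := Vg _ e4.
exists (M + N)%N, (fun x => t x + s x); split.
  by apply: trigD; [exact: trig_mono (leq_addr _ _) Tt|exact: trig_mono (leq_addl _ _) Ts].
have It := sq_integrable_bmeas (unif R) (bmeas_trig Tt).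
have Is := sq_integrable_bmeas (unif R) (bmeas_trig Ts).
have := sqnormD_le (sq_integrableB If It) (sq_integrableB Ig Is).
rewrite (_ : (fun x => _) = fun x => f x + g x - (t x + s x)); first lra.
by apply/funext => x; ring.
Qed.

Lemma sqnormZ (r : R) g : sq_integrable (unif R) g ->
  sqnorm (unif R) (fun x => r * g x) = r ^+ 2 * sqnorm (unif R) g.
Proof.
move=> [mg ig2]; rewrite /sqnorm -RintegralZl//.
by apply: eq_Rintegral => x _; rewrite exprMn.
Qed.

Lemma trig_denseZ r g : sq_integrable (unif R) g -> trig_dense g ->
  trig_dense (fun x => r * g x).
Proof.
move=> Ig Vg e e0; have r1 : 0 < r ^+ 2 + 1 by rewrite ltr_wpDl// sqr_ge0.
have [M [t [Tt te]]] := Vg (e / (r ^+ 2 + 1)) (divr_gt0 e0 r1).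
exists M, (fun x => r * t x); split; first exact: trigZ.
have It := sq_integrable_bmeas (unif R) (bmeas_trig Tt).
rewrite (_ : (fun x => _) = fun x => r * (g x - t x)); last by apply/funext => x; ring.
rewrite sqnormZ; last exact: sq_integrableB.
apply: (@le_trans _ _ ((r ^+ 2 + 1) * (e / (r ^+ 2 + 1)))); last by rewrite mulrC divfK// gt_eqF.
by apply: ler_pM => //; rewrite ?sqr_ge0 ?sqnorm_ge0 ?lerDl.
Qed.

Lemma trig_denseB f g : sq_integrable (unif R) f -> sq_integrable (unif R) g ->
  trig_dense f -> trig_dense g -> trig_dense (fun x => f x - g x).
Proof.
move=> If Ig Vf Vg.
have := trig_denseD If (sq_integrableZ (-1) Ig) Vf (trig_denseZ (-1) Ig Vg).
by congr trig_dense; apply/funext => x; rewrite mulN1r.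
Qed.

Lemma trig_dense_dominated (G g : plane R -> R) (gn : nat -> plane R -> R) :
  sq_integrable (unif R) G -> measurable_fun setT g -> (forall n, measurable_fun setT (gn n)) ->
  (forall x, `|g x| <= G x) -> (forall n x, `|gn n x| <= G x) ->
  {ae unif R, forall x, gn ^~ x @ \oo --> g x} ->
  (forall n, trig_dense (gn n)) -> trig_dense g.
Proof.
move=> IG mg mgn gG gnG cv V.
have [Ig [Ign H]] := sqnorm_dominated IG mg mgn gG gnG cv.
apply: trig_dense_lim => // e e0; have [n ne] := H e e0.
by exists (gn n).
Qed.

End trigonometric_polynomials.

(** * From rays to measurable sets and square-integrable functions *)

Section density.
Import HBSimple HBNNSimple.
Variable R : realType.
Implicit Types (f g : plane R -> R).

Lemma circ_boundary : circ R (~` `]0, (2 * pi)[%classic) = 0%E.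
Proof.
have mI : measurable (`]0, (2 * pi)[%classic : set (measurableTypeR R)) by exact: measurable_itv.
rewrite circE; last exact: measurableC.
rewrite (_ : _ `&` _ = [set 0]); first by rewrite [X in (_ * X)%E]lebesgue_measure_set1 mule0.
apply/seteqP; split => x /=; rewrite !in_itv/=.
  move=> [/negP]; rewrite negb_and -!leNgt => /orP[h|h] /andP[h1 h2]; last by lra.
  by apply/eqP; rewrite eq_le h h1.
by move=> ->; rewrite ltxx lexx twopi_gt0.
Qed.

(** At [x = 0] the polynomial behind [ray_approx] vanishes although the indicator may be 1, so its
    convergence is available only off the boundary. *)
Lemma ae_unif_interior :
  {ae unif R, forall x : plane R, 0 < x.1 < 2 * pi /\ 0 < x.2 < 2 * pi}.
Proof.
pose I : set (measurableTypeR R) := ~` `]0, (2 * pi)[%classic.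
have mI : measurable I by apply: measurableC; exact: measurable_itv.
have z1 : unif R (I `*` setT) = 0%E.
  by rewrite [LHS](product_measure1E (circ R) (circ R) mI measurableT) [X in (X * _)%E]circ_boundary mul0e.
have z2 : unif R (setT `*` I) = 0%E.
  by rewrite [LHS](product_measure1E (circ R) (circ R) measurableT mI) [X in (_ * X)%E]circ_boundary mule0.
exists ((I `*` setT) `|` (setT `*` I)); split.
- by apply: measurableU; exact: measurableX.
- by rewrite measureU0//; exact: measurableX.
move=> x /= H; case: (pselect (0 < x.1 < 2 * pi)) => h; [right|left]; split => //; rewrite /I/= in_itv//=.
by move=> h2; apply: H.
Qed.

Lemma bmeas_indic (A : set (plane R)) : measurable A -> bmeas (\1_A : plane R -> R).
Proof.
move=> mA; split; first exact: measurable_indic.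
by exists 1 => x; rewrite indicE; case: (_ \in _); rewrite ?normr1 ?normr0.
Qed.

Lemma sq_integrable_cst (r : R) : sq_integrable (unif R) (fun=> r).
Proof. by apply: sq_integrable_bmeas; exact: bmeas_cst. Qed.

Lemma norm_indic_le1 (A : set (plane R)) x : `|\1_A x : R| <= 1.
Proof. by rewrite indicE; case: (_ \in _); rewrite ?normr1 ?normr0. Qed.

Lemma measurable_ray o : measurable (@ray R o).
Proof. by case: o => [a|] //=; exact: measurable_itv. Qed.

Lemma trig_dense_trig M f : trig M f -> trig_dense f.
Proof.
move=> Tf e e0; exists M, f; split => //; rewrite /sqnorm.
under eq_Rintegral do rewrite subrr expr0n/=.
by rewrite Rint_cst ltW.
Qed.

Lemma trig_dense_rays o1 o2 : trig_dense (\1_(@ray R o1 `*` @ray R o2) : plane R -> R).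
Proof.
have [q1 [b1 [t1 c1]]] := ray_approx o1; have [q2 [b2 [t2 c2]]] := ray_approx o2.
have T n : exists M, trig M (fun x : plane R => q1 n x.1 * q2 n x.2).
  have [M1 [T1 _]] := t1 n; have [M2 [_ T2]] := t2 n.
  by exists (M1 + M2)%N; exact: trigM.
apply: (trig_dense_dominated (sq_integrable_cst 1) (gn := fun n x => q1 n x.1 * q2 n x.2)).
- by apply: measurable_indic; apply: measurableX; exact: measurable_ray.
- by move=> n; have [M TM] := T n; have [] := bmeas_trig TM.
- exact: norm_indic_le1.
- by move=> n x; rewrite normrM -[leRHS]mul1r ler_pM.
- apply: filterS ae_unif_interior => x [x1 x2].
  rewrite (_ : \1_(_ `*` _) x = \1_(ray o1) x.1 * \1_(ray o2) x.2); first by apply: cvgM; [exact: c1|exact: c2].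
  rewrite !indicE -natrM mulnb; congr (_%:R : R); congr nat_of_bool.
  by apply/idP/andP; rewrite !inE.
- by move=> n; have [M TM] := T n; exact: trig_dense_trig TM.
Qed.

(* Dynkin's argument in each of the two variables in turn, then jointly. *)
Lemma trig_dense_sigma d (T : measurableType d) (F : plane R -> T) (C : set (plane R))
    (G : set (set T)) : measurable_fun setT F -> measurable C ->
  measurable = <<s G >> -> setI_closed G ->
  (forall A, G A -> trig_dense (\1_((F @^-1` A) `&` C) : plane R -> R)) ->
  trig_dense (\1_C : plane R -> R) ->
  forall A : set T, measurable A -> trig_dense (\1_((F @^-1` A) `&` C) : plane R -> R).
Proof.
move=> mF mC GE GI HG HC.
pose H : set (set T) := [set A | measurable A /\ trig_dense (\1_((F @^-1` A) `&` C) : plane R -> R)].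
have mP A : measurable A -> measurable ((F @^-1` A) `&` C).
  by move=> mA; apply: measurableI => //; exact: measurable_preimage.
have I1 A : measurable A -> sq_integrable (unif R) (\1_((F @^-1` A) `&` C)).
  by move=> mA; apply: sq_integrable_bmeas; apply: bmeas_indic; exact: mP.
have lam : lambda_system setT H.
  split => //.
  - by split; [exact: measurableT|rewrite preimage_setT setTI].
  - move=> A B BA [mA VA] [mB VB]; split; first exact: measurableD.
    have := trig_denseB (I1 _ mA) (I1 _ mB) VA VB; congr trig_dense.
    apply/funext => x; rewrite !indicE.
    have [xC|xC] := pselect (C x); last first.
      by rewrite !memNset ?subrr//; move=> [].
    have [xB|xB] := pselect (B (F x)).
      rewrite (mem_set (A := _ `&` _)); last by split => //; exact: BA.
      by rewrite mem_set ?memNset ?subrr// => -[[]].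
    rewrite [in X in _ - X]memNset ?subr0; last by move=> [].
    congr (_%:R : R); congr nat_of_bool; apply/idP/idP; rewrite !inE => -[h _]; split => //.
    by case: h.
  - move=> E ndE HE; have mE i : measurable (E i) by have [] := HE i.
    have mUE : measurable (\bigcup_i E i) by exact: bigcup_measurable.
    split => //.
    apply: (trig_dense_dominated (sq_integrable_cst 1) (gn := fun n => \1_((F @^-1` (E n)) `&` C))).
    + by apply: measurable_indic; exact: mP.
    + by move=> n; apply: measurable_indic; exact: mP.
    + exact: norm_indic_le1.
    + by move=> n; exact: norm_indic_le1.
    + apply: aeW => x; apply: cvg_near_cst.
      have [[[N _ xN] xC]|xU] := pselect (((F @^-1` \bigcup_i E i) `&` C) x).
        exists N => // n /= Nn; rewrite !indicE !mem_set//.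
          by split => //; exists N.
        by split => //; have /subsetPset := ndE _ _ Nn; exact.
      apply: nearW => n; rewrite !indicE !memNset// => -[h xC]; apply: xU; split => //.
      by exists n.
    + by move=> n; have [] := HE n.
move=> A mA; suff : H A by case.
apply: (lambda_system_subset GI lam _ _) => //; last by rewrite -GE.
by move=> B GB; split; [rewrite GE; exact: sub_sigma_algebra|exact: HG].
Qed.

Lemma trig_dense_indic (E : set (plane R)) : measurable E -> trig_dense (\1_E : plane R -> R).
Proof.
pose G : set (set (measurableTypeR R)) := [set A | exists a, A = `]-oo, a[%classic].
have GE : measurable = <<s G >> by exact: RGenInftyO.measurableE.
have GI : setI_closed G.
  move=> _ _ [a ->] [b ->]; exists (Num.min a b); apply/seteqP; split => x /=; rewrite !in_itv/= lt_min.
    by move=> [-> ->].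
  by move=> /andP[].
have step1 o A : measurable A -> trig_dense (\1_(A `*` @ray R o) : plane R -> R).
  move=> mA; rewrite (_ : A `*` ray o = (fst @^-1` A) `&` (setT `*` ray o)); last first.
    by apply/seteqP; split => x /=; tauto.
  have mo := @measurable_ray o.
  have mfst : measurable_fun setT (fst : plane R -> measurableTypeR R) by exact: measurable_fst.
  apply: (trig_dense_sigma (G := G) mfst) => //.
  - exact: measurableX.
  - move=> _ [a ->]; have := trig_dense_rays (Some a) o; congr trig_dense; congr indic.
    by apply/seteqP; split => x /=; tauto.
  - exact: (trig_dense_rays None o).
have step2 A B : measurable A -> measurable B -> trig_dense (\1_(A `*` B) : plane R -> R).
  move=> mA mB; rewrite (_ : A `*` B = (snd @^-1` B) `&` (A `*` setT)); last first.
    by apply/seteqP; split => x /=; tauto.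
  have msnd : measurable_fun setT (snd : plane R -> measurableTypeR R) by exact: measurable_snd.
  apply: (trig_dense_sigma (G := G) msnd) => //.
  - exact: measurableX.
  - move=> _ [a ->]; have := step1 (Some a) _ mA; congr trig_dense; congr indic.
    by apply/seteqP; split => x /=; tauto.
  - exact: (step1 None _ mA).
move=> mE; rewrite -[E]setIT -[E in E `&` _]preimage_id.
pose G2 := [set A `*` B | A in @measurable _ (measurableTypeR R) & B in @measurable _ (measurableTypeR R)].
have mid : measurable_fun setT (id : plane R -> plane R) by exact: measurable_id.
apply: (trig_dense_sigma (G := G2) mid) => //.
- exact: measurable_prod_measurableType.
- move=> _ _ [A1 mA1 [B1 mB1 <-]] [A2 mA2 [B2 mB2 <-]].
  exists (A1 `&` A2); first exact: measurableI.
  exists (B1 `&` B2); first exact: measurableI.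
  by apply/seteqP; split => x /=; tauto.
- by move=> _ [A1 mA1 [B1 mB1 <-]]; rewrite setIT; exact: step2.
- by have := trig_dense_trig (trig_cst 0%N 1); congr trig_dense; apply/funext => x; rewrite indicT.
Qed.

Lemma trig_dense_nnsfun (f : {nnsfun plane R >-> R}) : trig_dense f.
Proof.
have [n [r ->]] : exists (n : nat) (r : nat -> R),
    (f : plane R -> R) = fun x => \sum_(i < n) r i * \1_(f @^-1` [set r i]) x.
  pose s := finmap.enum_fset (fset_set (range f)).
  by exists (size s), (nth 0 s); apply/funext => x; exact: fimfunEord.
have bi i : bmeas (fun x => r i * \1_(f @^-1` [set r i]) x).
  apply: bmeasM; first exact: bmeas_cst.
  by apply: bmeas_indic; exact: measurable_sfunP.
elim: n => [|n IH].
  rewrite (_ : (fun _ => _) = fun=> 0); last by apply/funext => x; rewrite big_ord0.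
  exact: trig_dense_trig (trig_cst 0%N 0).
under eq_fun do rewrite big_ord_recr/=.
apply: trig_denseD => //.
- by apply: sq_integrable_bmeas; exact: bmeas_sum.
- exact: sq_integrable_bmeas.
- apply: trig_denseZ; first by apply: sq_integrable_bmeas; apply: bmeas_indic; exact: measurable_sfunP.
  by apply: trig_dense_indic; exact: measurable_sfunP.
Qed.

Lemma trig_dense_ge0 f : sq_integrable (unif R) f -> (forall x, 0 <= f x) -> trig_dense f.
Proof.
move=> If f0; have [mf _] := If.
have mEf : measurable_fun setT (EFin \o f) by apply/measurable_EFinP.
have [g [ndg cg]] := approximation measurableT mEf (fun x _ => f0 x).
have cvr x : (fun n => g n x) @ \oo --> f x.
  by have := cg x I; move/fine_cvgP => [_]; exact.
have gf n x : g n x <= f x.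
  rewrite -(cvg_lim (@Rhausdorff R) (cvr x)); apply: nondecreasing_cvgn_le.
    by move=> i j ij; have /lefP := ndg _ _ ij; exact.
  by apply/cvg_ex; exists (f x); exact: cvr.
apply: (trig_dense_dominated If mf (gn := fun n => g n)).
- by move=> n; exact: measurable_funP.
- by move=> x; rewrite ger0_norm.
- by move=> n x; rewrite ger0_norm.
- by apply: aeW => x; exact: cvr.
- by move=> n; exact: trig_dense_nnsfun.
Qed.

Lemma trig_dense_sq_integrable f : sq_integrable (unif R) f -> trig_dense f.
Proof.
move=> If; have [mf if2] := If.
have dom g : measurable_fun setT g -> (forall x, `|g x| <= `|f x|) -> sq_integrable (unif R) g.
  move=> mg gf; split => //.
  apply: (@le_integrable _ _ _ (unif R) setT _ _ (EFin \o (fun x => f x ^+ 2))) => //.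
    by apply/measurable_EFinP; exact: measurable_funX.
  move=> x _ /=; rewrite lee_fin !ger0_norm ?sqr_ge0//.
  by rewrite -(real_normK (num_real (f x))) -(real_normK (num_real (g x))) lerXn2r ?nnegrE.
have Ip : sq_integrable (unif R) (f^\+)%R.
  apply: dom; first exact: measurable_funrpos.
  move=> x; rewrite ger0_norm ?funrpos_ge0//.
  by rewrite /funrpos ge_max ler_norm normr_ge0.
have In : sq_integrable (unif R) (f^\-)%R.
  apply: dom; first exact: measurable_funrneg.
  move=> x; rewrite ger0_norm ?funrneg_ge0//.
  by rewrite /funrneg ge_max -normrN ler_norm normr_ge0.
have := trig_denseB Ip In (trig_dense_ge0 Ip (@funrpos_ge0 _ _ f)) (trig_dense_ge0 In (@funrneg_ge0 _ _ f)).
congr trig_dense; apply/funext => x.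
by rewrite -[in RHS](funrposBneg f).
Qed.

End density.

(** * Quenched correlations *)

Section projection.
Variable R : realType.
Implicit Types (f g : plane R -> R) (k l : int * int).

Definition ccoef g k : R := \int[unif R]_x (g x * cos (dotk k x)).
Definition scoef g k : R := \int[unif R]_x (g x * sin (dotk k x)).
Definition pcoef g k : R := ccoef g k ^+ 2 + scoef g k ^+ 2.

Definition box (M : nat) : seq (int * int) := [seq (a, b) | a <- zrange M, b <- zrange M].

Lemma mem_box M k : (k \in box M) = (`|k.1|%N <= M)%N && (`|k.2|%N <= M)%N.
Proof.
rewrite -!mem_zrange; apply/allpairsP/andP => [[[a b] /= [aM bM ->]]//|[aM bM]].
by exists k; case: k aM bM.
Qed.

Lemma uniq_box M : uniq (box M).
Proof. by apply: allpairs_uniq; rewrite ?uniq_zrange// => -[? ?] [? ?]. Qed.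

Definition oppk k : int * int := (- k.1, - k.2).

Lemma oppkK : involutive oppk.
Proof. by move=> [a b]; rewrite /oppk/= !opprK. Qed.

Lemma mem_box_opp M k : (oppk k \in box M) = (k \in box M).
Proof. by rewrite !mem_box /= !abszN. Qed.

Lemma dotk_opp k x : dotk (oppk k) x = - dotk k x :> R.
Proof. by rewrite /dotk/= !mulrNz; ring. Qed.

Lemma dotkD k l x : dotk (k.1 + l.1, k.2 + l.2) x = dotk k x + dotk l x :> R.
Proof. by rewrite /dotk/= !intrD; ring. Qed.

Lemma sum_box_opp M (F : int * int -> R) :
  \sum_(k <- box M) F (oppk k) = \sum_(k <- box M) F k.
Proof.
rewrite -(big_map oppk xpredT F); apply: perm_big; apply: uniq_perm.
- by rewrite map_inj_uniq ?uniq_box//; exact: inv_inj oppkK.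
- exact: uniq_box.
- by move=> k; rewrite -[k in LHS]oppkK mem_map ?mem_box_opp//; exact: inv_inj oppkK.
Qed.

Lemma add_pair_eq0 l k : ((l.1 + k.1, l.2 + k.2) == (0, 0)) = (l == oppk k).
Proof. by case: l k => [a b] [c d]; rewrite /oppk !xpair_eqE/= !addr_eq0. Qed.

Lemma Rint_cos_cos l k c : \int[unif R]_x (cos (dotk l x) * cos (dotk k x + c)) =
  2^-1 * cos c * ((l == oppk k)%:R + (l == k)%:R).
Proof.
have bc m e : bmeas (fun x : plane R => cos (dotk m x + e)).
  by apply: bmeas_cos; apply: measurable_funD => //; exact: measurable_dotk.
transitivity (\int[unif R]_x (2^-1 * (cos (dotk (l.1 + k.1, l.2 + k.2) x + c) +
    cos (dotk (l.1 + (oppk k).1, l.2 + (oppk k).2) x + - c)))).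
  apply: eq_Rintegral => x _; rewrite !dotkD dotk_opp.
  rewrite (_ : dotk l x + dotk k x + c = dotk l x + (dotk k x + c)); last by ring.
  rewrite (_ : dotk l x + - dotk k x - c = dotk l x - (dotk k x + c)); last by ring.
  by move: (dotk l x) (dotk k x + c) => u v; rewrite cosD cosB; field.
rewrite RintZ; last exact: bmeasD.
rewrite RintD// !Rint_unif_cos !add_pair_eq0 oppkK cosN.
by case: (l == oppk k); case: (l == k); rewrite /=; ring.
Qed.

Lemma Rint_sin_cos l k c : \int[unif R]_x (sin (dotk l x) * cos (dotk k x + c)) =
  2^-1 * sin c * ((l == oppk k)%:R - (l == k)%:R).
Proof.
have bc m e : bmeas (fun x : plane R => sin (dotk m x + e)).
  by apply: bmeas_sin; apply: measurable_funD => //; exact: measurable_dotk.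
transitivity (\int[unif R]_x (2^-1 * (sin (dotk (l.1 + k.1, l.2 + k.2) x + c) +
    sin (dotk (l.1 + (oppk k).1, l.2 + (oppk k).2) x + - c)))).
  apply: eq_Rintegral => x _; rewrite !dotkD dotk_opp.
  rewrite (_ : dotk l x + dotk k x + c = dotk l x + (dotk k x + c)); last by ring.
  rewrite (_ : dotk l x + - dotk k x - c = dotk l x - (dotk k x + c)); last by ring.
  by move: (dotk l x) (dotk k x + c) => u v; rewrite sinD sinB; field.
rewrite RintZ; last exact: bmeasD.
rewrite RintD// !Rint_unif_sin !add_pair_eq0 oppkK sinN.
by case: (l == oppk k); case: (l == k); rewrite /=; ring.
Qed.

(** The truncated Fourier series in real form. Both [k] and [- k] lie in the box and contribute the
    same term, which accounts for the absence of a factor 2. *)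
Definition proj M g (x : plane R) : R :=
  \sum_(k <- box M) (ccoef g k * cos (dotk k x) + scoef g k * sin (dotk k x)).

Lemma trig_sum M (I : eqType) (s : seq I) (F : I -> plane R -> R) :
  (forall i, i \in s -> trig M (F i)) -> trig M (fun x => \sum_(i <- s) F i x).
Proof.
elim: s => [|i s IH] H; first by under eq_fun do rewrite big_nil; exact: trig_cst.
under eq_fun do rewrite big_cons; apply: trigD; first by apply: H; rewrite mem_head.
by apply: IH => j js; apply: H; rewrite inE js orbT.
Qed.

Lemma trig_proj M g : trig M (proj M g).
Proof.
apply: trig_sum => k; rewrite mem_box => /andP[k1 k2].
apply: trigD; apply: trigZ.
  by have := trig_cos (0 : R) k1 k2; under eq_fun do rewrite addr0.
by have := trig_sin (0 : R) k1 k2; under eq_fun do rewrite addr0.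
Qed.

Lemma bmeas_cosk k : bmeas (fun x : plane R => cos (dotk k x)).
Proof. by apply: bmeas_cos; exact: measurable_dotk. Qed.

Lemma bmeas_sink k : bmeas (fun x : plane R => sin (dotk k x)).
Proof. by apply: bmeas_sin; exact: measurable_dotk. Qed.

Lemma ccoef_opp g k : ccoef g (oppk k) = ccoef g k.
Proof. by apply: eq_Rintegral => x _; rewrite dotk_opp cosN. Qed.

Lemma sq_integrable_mul_bmeas g f : sq_integrable (unif R) g -> bmeas f ->
  (unif R).-integrable setT (EFin \o (fun x => g x * f x)).
Proof. by move=> Ig bf; apply: sq_integrableM => //; exact: sq_integrable_bmeas. Qed.

Lemma scoef_opp g k : sq_integrable (unif R) g -> scoef g (oppk k) = - scoef g k.
Proof.
move=> Ig; rewrite /scoef -mulN1r -RintegralZl//; last first.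
  by apply: (sq_integrable_mul_bmeas Ig); exact: bmeas_sink.
by apply: eq_Rintegral => x _; rewrite dotk_opp sinN; ring.
Qed.

Lemma Rint_mul_cos g k c : sq_integrable (unif R) g ->
  \int[unif R]_x (g x * cos (dotk k x + c)) = cos c * ccoef g k - sin c * scoef g k.
Proof.
move=> Ig.
have i1 : (unif R).-integrable setT (EFin \o (fun x => g x * cos (dotk k x))).
  by apply: (sq_integrable_mul_bmeas Ig); exact: bmeas_cosk.
have i2 : (unif R).-integrable setT (EFin \o (fun x => g x * sin (dotk k x))).
  by apply: (sq_integrable_mul_bmeas Ig); exact: bmeas_sink.
rewrite /ccoef /scoef -!RintegralZl// -RintegralB//; first last.
- exact: (integrableZR (sin c) i2).
- exact: (integrableZR (cos c) i1).
by apply: eq_Rintegral => x _; rewrite cosD; ring.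
Qed.

Lemma Rint_proj_cos M g k c : sq_integrable (unif R) g -> k \in box M ->
  \int[unif R]_x (proj M g x * cos (dotk k x + c)) =
  \int[unif R]_x (g x * cos (dotk k x + c)).
Proof.
move=> Ig kM; rewrite [RHS]Rint_mul_cos//.
have bkc : bmeas (fun x : plane R => cos (dotk k x + c)).
  by apply: bmeas_cos; apply: measurable_funD => //; exact: measurable_dotk.
have b1 l : bmeas (fun x : plane R => cos (dotk l x) * cos (dotk k x + c)).
  by apply: bmeasM => //; exact: bmeas_cosk.
have b2 l : bmeas (fun x : plane R => sin (dotk l x) * cos (dotk k x + c)).
  by apply: bmeasM => //; exact: bmeas_sink.
have b1c l : bmeas (fun x : plane R => ccoef g l * (cos (dotk l x) * cos (dotk k x + c))).
  by apply: bmeasM => //; exact: bmeas_cst.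
have b2c l : bmeas (fun x : plane R => scoef g l * (sin (dotk l x) * cos (dotk k x + c))).
  by apply: bmeasM => //; exact: bmeas_cst.
transitivity (\int[unif R]_x \sum_(l <- box M) (ccoef g l * (cos (dotk l x) * cos (dotk k x + c)) +
   scoef g l * (sin (dotk l x) * cos (dotk k x + c)))).
  by apply: eq_Rintegral => x _; rewrite mulr_suml; apply: eq_bigr => l _; ring.
rewrite Rint_sum; last by move=> l; exact: bmeasD.
under eq_bigr do rewrite RintD// !RintZ// Rint_cos_cos Rint_sin_cos.
pose A := 2^-1 * cos c; pose B := 2^-1 * sin c.
rewrite (eq_bigr (fun l => (A * ccoef g l + B * scoef g l) * (l == oppk k)%:R +
   (A * ccoef g l - B * scoef g l) * (l == k)%:R)); last by move=> l _; rewrite /A /B; ring.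
rewrite big_split/=.
have pick (F : int * int -> R) m : m \in box M -> \sum_(l <- box M) F l * (l == m)%:R = F m.
  move=> mM; rewrite (bigD1_seq m)//; last exact: uniq_box.
  rewrite eqxx mulr1 big1 => [|l lm]; first exact: addr0.
  by rewrite (negbTE lm) mulr0.
rewrite !pick ?mem_box_opp// ccoef_opp scoef_opp// /A /B; by field.
Qed.

Lemma Rint_sub_proj_trig M g f : sq_integrable (unif R) g -> trig M f ->
  \int[unif R]_x ((g x - proj M g x) * f x) = 0.
Proof.
move=> Ig; have Ip : sq_integrable (unif R) (proj M g).
  by apply: sq_integrable_bmeas; exact: bmeas_trig (trig_proj M g).
have Id := sq_integrableB Ig Ip.
have II h : trig M h -> (unif R).-integrable setT (EFin \o (fun x => (g x - proj M g x) * h x)).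
  by move=> Th; apply: (sq_integrable_mul_bmeas Id); exact: bmeas_trig Th.
elim => [k c k1 k2|{}f h Tf IHf Th IHh|r {}f Tf IHf].
- have kM : k \in box M by rewrite mem_box k1.
  have bkc : bmeas (fun x : plane R => cos (dotk k x + c)).
    by apply: bmeas_cos; apply: measurable_funD => //; exact: measurable_dotk.
  under eq_Rintegral do rewrite mulrBl.
  rewrite RintegralB//; [|exact: sq_integrable_mul_bmeas..].
  by rewrite Rint_proj_cos// subrr.
- under eq_Rintegral do rewrite mulrDr.
  by rewrite RintegralD//; [rewrite IHf IHh addr0|exact: II..].
- under eq_Rintegral do rewrite mulrCA.
  by rewrite RintegralZl//; [rewrite IHf mulr0|exact: II].
Qed.

(** Pythagoras: [g - proj M g] is orthogonal to every trigonometric polynomial of the box. This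
    makes the approximation error monotone in the box, which density alone does not give. *)
Lemma sqnorm_sub_proj_le M g f : sq_integrable (unif R) g -> trig M f ->
  sqnorm (unif R) (fun x => g x - proj M g x) <= sqnorm (unif R) (fun x => g x - f x).
Proof.
move=> Ig Tf; have Tp := trig_proj M g.
have Ip := sq_integrable_bmeas (unif R) (bmeas_trig Tp).
have Tpf := trigB Tp Tf.
have Ipf := sq_integrable_bmeas (unif R) (bmeas_trig Tpf).
have Id := sq_integrableB Ig Ip.
have E : sqnorm (unif R) (fun x => g x - f x) =
   sqnorm (unif R) (fun x => g x - proj M g x) + sqnorm (unif R) (fun x => proj M g x - f x).
  have cross := Rint_sub_proj_trig Ig Tpf.
  have iX := sq_integrableM Id Ipf.
  have [_ i1] := Id; have [_ i2] := Ipf.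
  rewrite /sqnorm.
  transitivity (\int[unif R]_x ((g x - proj M g x) ^+ 2 + 2 * ((g x - proj M g x) * (proj M g x - f x))
     + (proj M g x - f x) ^+ 2)).
    by apply: eq_Rintegral => x _; ring.
  rewrite RintegralD//; last exact: integrableDR i1 (integrableZR 2 iX).
  rewrite RintegralD//; last exact: integrableZR.
  by rewrite RintegralZl// cross mulr0 addr0.
by rewrite E lerDl; exact: sqnorm_ge0.
Qed.

Lemma proj_cvg g e : sq_integrable (unif R) g -> 0 < e ->
  exists M0, forall M, (M0 <= M)%N -> sqnorm (unif R) (fun x => g x - proj M g x) <= e.
Proof.
move=> Ig e0; have [M0 [f [Tf fe]]] := trig_dense_sq_integrable Ig e0.
by exists M0 => M MM; apply: le_trans fe; apply: sqnorm_sub_proj_le => //; exact: trig_mono Tf.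
Qed.

Lemma sqnorm_proj M g : sq_integrable (unif R) g ->
  sqnorm (unif R) (proj M g) = \sum_(k <- box M) pcoef g k.
Proof.
move=> Ig; have bp := bmeas_trig (trig_proj M g).
have bc k : bmeas (fun x => ccoef g k * (proj M g x * cos (dotk k x + 0))).
  apply: bmeasM; first exact: bmeas_cst.
  by apply: bmeasM => //; apply: bmeas_cos; apply: measurable_funD => //; exact: measurable_dotk.
have bs k : bmeas (fun x => scoef g k * (proj M g x * cos (dotk k x + - (pi / 2)))).
  apply: bmeasM; first exact: bmeas_cst.
  by apply: bmeasM => //; apply: bmeas_cos; apply: measurable_funD => //; exact: measurable_dotk.
rewrite /sqnorm.
transitivity (\int[unif R]_x \sum_(k <- box M) (ccoef g k * (proj M g x * cos (dotk k x + 0)) +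
  scoef g k * (proj M g x * cos (dotk k x + - (pi / 2))))).
  apply: eq_Rintegral => x _; rewrite expr2 {2}/proj mulr_sumr; apply: eq_bigr => k _.
  by rewrite addr0 cosBpihalf; ring.
rewrite Rint_sum; last by move=> k; exact: bmeasD.
rewrite big_seq [RHS]big_seq; apply: eq_bigr => k kM.
rewrite RintD// RintegralZl//; last first.
  apply: (bmeas_integrable (unif R)); apply: bmeasM => //.
  by apply: bmeas_cos; apply: measurable_funD => //; exact: measurable_dotk.
rewrite RintegralZl//; last first.
  apply: (bmeas_integrable (unif R)); apply: bmeasM => //.
  by apply: bmeas_cos; apply: measurable_funD => //; exact: measurable_dotk.
rewrite !Rint_proj_cos// !Rint_mul_cos// cos0 sin0 cosN sinN cos_pihalf sin_pihalf /pcoef; ring.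
Qed.

End projection.

(** * Measure-preserving maps and invariance under the random maps *)

Section measure_preserving.
Context d (T : measurableType d) (R : realType) (mu : probability T R).

Definition preserving (F : T -> T) : Prop :=
  measurable_fun setT F /\
  forall A, measurable A -> mu (F @^-1` A) = mu A.

Lemma integrable_preserving F (f : T -> R) : preserving F ->
  (mu).-integrable setT (EFin \o f) -> (mu).-integrable setT (EFin \o (f \o F)).
Proof.
move=> [mF pF] If; have mf : measurable_fun setT (EFin \o f) by case/integrableP: If.
apply/integrableP; split; first exact: (measurableT_comp mf mF).
have /integrableP[_] := If; congr (_ < _)%E.
have := @ge0_integral_pushforward _ _ _ _ _ F mF (mu) setT (fun x => `|(f x)%:E|%E).
rewrite preimage_setT => <- //; last exact: measurableT_comp.
by apply: eq_measure_integral => A mA _; rewrite /= /pushforward pF.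
Qed.

Lemma Rint_preserving F (f : T -> R) : preserving F ->
  (mu).-integrable setT (EFin \o f) -> \int[mu]_x f (F x) = \int[mu]_x f x.
Proof.
move=> pF If; have IfF := integrable_preserving pF If.
have mf : measurable_fun setT (EFin \o f) by case/integrableP: If.
case: pF => mF pF; rewrite /Rintegral; congr fine.
have := @integral_pushforward _ _ _ _ _ F mF (mu) setT (EFin \o f).
rewrite preimage_setT => <- //.
by apply: eq_measure_integral => A mA _; rewrite /= /pushforward pF.
Qed.

Lemma sq_integrable_preserving F f : preserving F -> sq_integrable (mu) f ->
  sq_integrable (mu) (fun x => f (F x)).
Proof.
move=> pF [mf if2]; split; first by apply: measurableT_comp; [exact: mf|case: pF].
exact: (integrable_preserving pF if2).
Qed.

Lemma sqnorm_preserving F f : preserving F -> sq_integrable (mu) f ->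
  sqnorm (mu) (fun x => f (F x)) = sqnorm (mu) f.
Proof. by move=> pF [mf if2]; exact: (Rint_preserving pF if2). Qed.

Lemma probability_Rint_indic (A : set T) : measurable A ->
  mu A = (\int[mu]_x \1_A x)%:E.
Proof.
move=> mA; rewrite EFin_Rint; first by rewrite integral_indic// setIT.
split; first exact: measurable_indic.
by exists 1 => x; rewrite indicE; case: (_ \in _); rewrite ?normr1 ?normr0.
Qed.

End measure_preserving.

Section preservation.
Variable R : realType.

(** The map is a horizontal shear followed by a vertical one. Each rotates one coordinate by an
    amount depending on the other, so Fubini and [circ_shift] apply twice. *)
Lemma Rint_chirikov (K : R) (w : plane R) (h : plane R -> R) :
  bmeas h -> \int[unif R]_x h (chirikov K w x) = \int[unif R]_x h x.
Proof.
move=> bh.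
have mm (f : plane R -> measurableTypeR R) : measurable_fun setT f ->
    measurable_fun setT (fun x => mod2pi (f x) : measurableTypeR R).
  by move=> mf; apply: (measurableT_comp (@measurable_mod2pi R)).
have m1 : measurable_fun setT (fst : plane R -> measurableTypeR R) by exact: measurable_fst.
have m2 : measurable_fun setT (snd : plane R -> measurableTypeR R) by exact: measurable_snd.
pose g (x : plane R) := h (x.1, mod2pi (x.2 + (x.1 - w.2))).
have mg : measurable_fun setT (fun x : plane R => (x.1, mod2pi (x.2 + (x.1 - w.2))) : plane R).
  apply: measurable_fun_pair => //; apply: mm; apply: measurable_funD => //.
  exact: measurable_funB.
have bg : bmeas (g : measurableTypeR R * measurableTypeR R -> R) by exact: (bmeas_comp mg bh).
have mc : measurable_fun setT (fun x : plane R => (mod2pi (x.1 + K * sin (x.2 - w.1)), x.2) : plane R).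
  apply: measurable_fun_pair => //; apply: mm; apply: measurable_funD => //.
  apply: measurable_funM => //; apply: (measurableT_comp (@measurable_sinR R)).
  exact: measurable_funB.
pose f (x : measurableTypeR R * measurableTypeR R) := g (mod2pi (x.1 + K * sin (x.2 - w.1)), x.2).
have bf : bmeas f by exact: (bmeas_comp mc bg).
have E x : h (chirikov K w x) = f x.
  rewrite /f /g /chirikov/=; congr (h (_, _)).
  by rewrite addrCA mod2pi_addl; congr mod2pi; ring.
under eq_Rintegral do rewrite E.
have ms c : measurable_fun setT (fun x : measurableTypeR R => mod2pi (x + c) : measurableTypeR R).
  by apply: (measurableT_comp (@measurable_mod2pi R)); exact: measurable_funD.
etransitivity; first exact: (Rint_prod2 (circ R) (circ R) bf).
transitivity (\int[circ R]_y \int[circ R]_x g (x, y)).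
  apply: eq_Rintegral => y _; rewrite /f/=.
  apply: (Rint_pushforward (mu := circ R) (nu := circ R) (f := fun x => g (x, y)) (ms _)).
    by move=> A mA; exact: circ_shift.
  exact: (bmeas_pair2 bg).
etransitivity; first exact: esym (Rint_swap (circ R) (circ R) bg).
etransitivity; last exact: esym (Rint_prod1 (circ R) (circ R) bh).
apply: eq_Rintegral => x _.
rewrite -(Rint_pushforward (mu := circ R) (nu := circ R) (f := fun y => h (x, y)) (ms (x - w.2)))//.
  by move=> A mA; exact: circ_shift.
exact: (bmeas_pair1 bh).
Qed.

Lemma preserving_chirikov_iter (K : R) (w : nat -> plane R) n :
  preserving (unif R) (chirikov_iter K w n).
Proof.
split; first exact: measurable_chirikov_iter2.
move=> A mA; have Rint_iter h : bmeas h ->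
    \int[unif R]_x h (chirikov_iter K w n x) = \int[unif R]_x h x.
  elim: n h => [//|n IH] h bh /=.
  rewrite -(Rint_chirikov K (w n) bh).
  apply: (IH (fun x => h (chirikov K (w n) x))).
  exact: (bmeas_comp (measurableT_comp (measurable_chirikov K) (measurable_pair1 (w n))) bh).
have mF := measurable_chirikov_iter2 K n w.
have E B : measurable B -> unif R B = (\int[unif R]_x \1_B x)%:E.
  exact: probability_Rint_indic.
rewrite !E//; last exact: measurable_preimage.
by rewrite -(Rint_iter _ (bmeas_indic mA)).
Qed.

End preservation.

(** * The bilinear estimate for correlations *)

Section bilinear.
Variable R : realType.
Implicit Types (f g : plane R -> R) (F : plane R -> plane R) (k l : int * int).

(** A product of two real modes involves the coefficients at [k] and at [- k]. Grouping by these,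
    [(C1, S1)] meets [(a c + b d, a d - b c)] and [(C2, S2)] meets [(a c - b d, a d + b c)]; both
    vectors have the length of [(a, b)] times that of [(c, d)], and the planar Cauchy-Schwarz
    inequality concludes. *)
Lemma norm_mode_pair_le (a b c d C1 S1 C2 S2 : R) :
  `|2^-1 * (a * c * (C1 + C2) + b * d * (C1 - C2) + a * d * (S1 + S2) + b * c * (S2 - S1))| <=
  2^-1 * (Num.sqrt (C1 ^+ 2 + S1 ^+ 2) + Num.sqrt (C2 ^+ 2 + S2 ^+ 2)) *
  (Num.sqrt (a ^+ 2 + b ^+ 2) * Num.sqrt (c ^+ 2 + d ^+ 2)).
Proof.
have sq2 (x y : R) : 0 <= x ^+ 2 + y ^+ 2 by rewrite addr_ge0 ?sqr_ge0.
have H (x y z t : R) : `|x * z + y * t| <= Num.sqrt (x ^+ 2 + y ^+ 2) * Num.sqrt (z ^+ 2 + t ^+ 2).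
  rewrite -sqrtrM// -sqrtr_sqr ler_sqrt ?mulr_ge0// -subr_ge0.
  by rewrite (_ : _ - _ = (x * t - y * z) ^+ 2) ?sqr_ge0//; ring.
have -> : 2^-1 * (a * c * (C1 + C2) + b * d * (C1 - C2) + a * d * (S1 + S2) + b * c * (S2 - S1)) =
  2^-1 * ((C1 * (a * c + b * d) + S1 * (a * d - b * c)) +
          (C2 * (a * c - b * d) + S2 * (a * d + b * c))) by ring.
rewrite normrM (ger0_norm (x := 2^-1)) ?invr_ge0// -mulrA ler_wpM2l ?invr_ge0//.
apply: le_trans (ler_normD _ _) _; rewrite mulrDl -sqrtrM//.
have -> : (a ^+ 2 + b ^+ 2) * (c ^+ 2 + d ^+ 2) = (a * c + b * d) ^+ 2 + (a * d - b * c) ^+ 2 by ring.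
apply: lerD; first exact: H.
have -> : (a * c + b * d) ^+ 2 + (a * d - b * c) ^+ 2 = (a * c - b * d) ^+ 2 + (a * d + b * c) ^+ 2 by ring.
exact: H.
Qed.

Definition mode f k (x : plane R) : R := ccoef f k * cos (dotk k x) + scoef f k * sin (dotk k x).

Lemma bmeas_mode f k : bmeas (mode f k).
Proof.
by apply: bmeasD; (apply: bmeasM; first exact: bmeas_cst); [exact: bmeas_cosk|exact: bmeas_sink].
Qed.

Lemma norm_Rint_mode_le F f g k l : measurable_fun setT F ->
  `|\int[unif R]_x (mode f k x * mode g l (F x))| <=
  2^-1 * (Num.sqrt (acoef2 F l k) + Num.sqrt (acoef2 F l (oppk k))) *
  (Num.sqrt (pcoef f k) * Num.sqrt (pcoef g l)).
Proof.
move=> mF.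
have mp j : measurable_fun setT (fun x => dotk l (F x) - dotk j x).
  by apply: measurable_funB; [exact: (measurableT_comp (measurable_dotk l) mF)|exact: measurable_dotk].
have bc j : bmeas (fun x => cos (dotk l (F x) - dotk j x)) by exact: bmeas_cos.
have bs j : bmeas (fun x => sin (dotk l (F x) - dotk j x)) by exact: bmeas_sin.
apply: le_trans (norm_mode_pair_le _ _ _ _ _ _ _ _); rewrite le_eqVlt; apply/orP; left; apply/eqP.
congr `|_|; rewrite /mode; set a := ccoef f k; set b := scoef f k; set c := ccoef g l; set e := scoef g l.
transitivity (\int[unif R]_x (2^-1 * (
    a * c * (cos (dotk l (F x) - dotk k x) + cos (dotk l (F x) - dotk (oppk k) x)) +
    b * e * (cos (dotk l (F x) - dotk k x) - cos (dotk l (F x) - dotk (oppk k) x)) +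
    a * e * (sin (dotk l (F x) - dotk k x) + sin (dotk l (F x) - dotk (oppk k) x)) +
    b * c * (sin (dotk l (F x) - dotk (oppk k) x) - sin (dotk l (F x) - dotk k x))))).
  apply: eq_Rintegral => x _; rewrite dotk_opp opprK.
  by move: (dotk k x) (dotk l (F x)) => u v; rewrite cosB cosD sinB sinD; field.
have i1 := bmeasD (bc k) (bc (oppk k)); have i2 := bmeasB (bc k) (bc (oppk k)).
have i3 := bmeasD (bs k) (bs (oppk k)); have i4 := bmeasB (bs (oppk k)) (bs k).
have cM (r : R) h : bmeas h -> bmeas (fun x : plane R => r * h x).
  by move=> bh; apply: bmeasM => //; exact: bmeas_cst.
have j1 := cM (a * c) _ i1; have j2 := cM (b * e) _ i2.
have j3 := cM (a * e) _ i3; have j4 := cM (b * c) _ i4.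
have j12 := bmeasD j1 j2; have j123 := bmeasD j12 j3; have j1234 := bmeasD j123 j4.
rewrite (RintZ (unif R) 2^-1 j1234) (RintD (unif R) j123 j4) (RintD (unif R) j12 j3).
rewrite (RintD (unif R) j1 j2) (RintZ (unif R) _ i1) (RintZ (unif R) _ i2).
rewrite (RintZ (unif R) _ i3) (RintZ (unif R) _ i4).
by rewrite (RintD (unif R) (bc _) (bc _)) (RintD (unif R) (bs _) (bs _)) (RintB (unif R) (bc _) (bc _))
  (RintB (unif R) (bs _) (bs _)).
Qed.

Definition hnorm2 M f : R := \sum_(k <- box M) ksq R k * pcoef f k.

(** The zero modes drop out, since [ksq] vanishes there and [0^-1 = 0]. *)
Definition correlation2 M F : R :=
  \sum_(l <- box M) (ksq R l)^-1 * \sum_(k <- box M) (ksq R k)^-1 * acoef2 F l k.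

Lemma pcoef_ge0 f k : 0 <= pcoef f k.
Proof. by rewrite addr_ge0 ?sqr_ge0. Qed.

Lemma pcoef_opp f k : sq_integrable (unif R) f -> pcoef f (oppk k) = pcoef f k.
Proof. by move=> If; rewrite /pcoef ccoef_opp scoef_opp// sqrrN. Qed.

Lemma pcoef0 f : ccoef f (0, 0) = 0 -> pcoef f (0, 0) = 0.
Proof.
move=> f0; rewrite /pcoef f0 /scoef.
under eq_Rintegral do rewrite /dotk !mul0r addr0 sin0 mulr0.
by rewrite Rint_cst expr0n addr0.
Qed.

Lemma hnorm2_ge0 M f : 0 <= hnorm2 M f.
Proof. by apply: sumr_ge0 => k _; rewrite mulr_ge0 ?ksq_ge0 ?pcoef_ge0. Qed.

Lemma pcoef_le_ksq f k : ccoef f (0, 0) = 0 -> pcoef f k <= ksq R k * pcoef f k.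
Proof.
move=> f0; have [->|k0] := eqVneq k (0, 0); first by rewrite pcoef0// mulr0.
by rewrite -[leLHS]mul1r ler_wpM2r ?pcoef_ge0// ksq_ge1.
Qed.

Lemma sqnorm_proj_le M f : sq_integrable (unif R) f -> ccoef f (0, 0) = 0 ->
  sqnorm (unif R) (proj M f) <= hnorm2 M f.
Proof. by move=> If f0; rewrite sqnorm_proj//; apply: ler_sum => k _; exact: pcoef_le_ksq. Qed.

Lemma Rint_proj_proj M f g F : measurable_fun setT F ->
  \int[unif R]_x (proj M f x * proj M g (F x)) =
  \sum_(l <- box M) \sum_(k <- box M) \int[unif R]_x (mode f k x * mode g l (F x)).
Proof.
move=> mF; have bb k l : bmeas (fun x => mode f k x * mode g l (F x)).
  by apply: bmeasM; [exact: bmeas_mode|exact: (bmeas_comp mF (bmeas_mode g l))].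
under [RHS]eq_bigr do rewrite -Rint_sum//.
rewrite -Rint_sum; last by move=> l; exact: bmeas_sum.
apply: eq_Rintegral => x _; rewrite [proj M g _]/proj mulr_sumr; apply: eq_bigr => l _.
by rewrite /proj mulr_suml.
Qed.

(* Pairing the mode k with -k turns the products of cosines and sines into the
   exponential coefficients [acoef2]. *)
Lemma norm_Rint_proj_le M f g F : measurable_fun setT F ->
  sq_integrable (unif R) f ->
  `|\int[unif R]_x (proj M f x * proj M g (F x))| <=
  \sum_(l <- box M) \sum_(k <- box M)
    Num.sqrt (acoef2 F l k) * (Num.sqrt (pcoef f k) * Num.sqrt (pcoef g l)).
Proof.
move=> mF If; rewrite Rint_proj_proj//.
apply: le_trans (ler_norm_sum _ _ _) _; apply: ler_sum => l _.
apply: le_trans (ler_norm_sum _ _ _) _.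
apply: le_trans (ler_sum _ (fun k _ => norm_Rint_mode_le f g k l mF)) _.
rewrite le_eqVlt; apply/orP; left; apply/eqP.
pose H k := Num.sqrt (acoef2 F l k) * (Num.sqrt (pcoef f k) * Num.sqrt (pcoef g l)).
rewrite (eq_bigr (fun k => 2^-1 * H k + 2^-1 * H (oppk k))); last first.
  by move=> k _; rewrite /H pcoef_opp//; ring.
by rewrite big_split/= -!mulr_sumr (sum_box_opp M H); field.
Qed.

Lemma sqr_Rint_proj_le M f g F : measurable_fun setT F ->
  sq_integrable (unif R) f -> ccoef f (0, 0) = 0 -> ccoef g (0, 0) = 0 ->
  (\int[unif R]_x (proj M f x * proj M g (F x))) ^+ 2 <=
  correlation2 M F * (hnorm2 M f * hnorm2 M g).
Proof.
move=> mF If f0 g0.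
pose s := [seq (l, k) | l <- box M, k <- box M].
pose X (lk : (int * int) * (int * int)) :=
  Num.sqrt ((ksq R lk.1)^-1 * ((ksq R lk.2)^-1 * acoef2 F lk.1 lk.2)).
pose Y (lk : (int * int) * (int * int)) :=
  Num.sqrt (ksq R lk.2 * pcoef f lk.2) * Num.sqrt (ksq R lk.1 * pcoef g lk.1).
have E : \sum_(l <- box M) \sum_(k <- box M)
    Num.sqrt (acoef2 F l k) * (Num.sqrt (pcoef f k) * Num.sqrt (pcoef g l)) =
    \sum_(lk <- s) X lk * Y lk.
  rewrite [RHS]big_allpairs; apply: eq_bigr => l _; apply: eq_bigr => k _; rewrite /X /Y/=.
  have [->|k0] := eqVneq k (0, 0); first by rewrite pcoef0// mulr0 sqrtr0 !(mul0r, mulr0).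
  have [->|l0] := eqVneq l (0, 0); first by rewrite pcoef0// mulr0 sqrtr0 !(mul0r, mulr0).
  have kk : 0 < ksq R k by apply: lt_le_trans (ksq_ge1 R k0).
  have ll : 0 < ksq R l by apply: lt_le_trans (ksq_ge1 R l0).
  rewrite -!sqrtrM ?mulr_ge0 ?invr_ge0 ?acoef2_ge0 ?pcoef_ge0 ?(ltW kk) ?(ltW ll)//.
  by congr Num.sqrt; field; rewrite !gt_eqF.
have h1 : \sum_(lk <- s) X lk ^+ 2 = correlation2 M F.
  rewrite big_allpairs /correlation2; apply: eq_bigr => l _; rewrite mulr_sumr; apply: eq_bigr => k _.
  by rewrite sqr_sqrtr// !mulr_ge0 ?invr_ge0 ?ksq_ge0 ?acoef2_ge0.
have h2 : \sum_(lk <- s) Y lk ^+ 2 = hnorm2 M f * hnorm2 M g.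
  rewrite big_allpairs /hnorm2 mulrC mulr_suml; apply: eq_bigr => l _; rewrite mulr_sumr; apply: eq_bigr => k _.
  by rewrite /Y/= exprMn !sqr_sqrtr ?mulr_ge0 ?ksq_ge0 ?pcoef_ge0// mulrC.
rewrite -h1 -h2; apply: le_trans (sum_cauchy_schwarz _ _ _).
rewrite -E -real_normK ?num_real// lerXn2r ?nnegrE//; last exact: norm_Rint_proj_le.
by apply: sumr_ge0 => l _; apply: sumr_ge0 => k _; rewrite !mulr_ge0 ?sqrtr_ge0.
Qed.

(** The a priori bound behind the 1 in [Num.min 1 S]: composition with [F] preserves the L^2 norm,
    and for mean-zero functions that norm is below the H^1 norm. *)
Lemma sqr_Rint_proj_le1 M f g F : preserving (unif R) F ->
  sq_integrable (unif R) f -> sq_integrable (unif R) g ->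
  ccoef f (0, 0) = 0 -> ccoef g (0, 0) = 0 ->
  (\int[unif R]_x (proj M f x * proj M g (F x))) ^+ 2 <= hnorm2 M f * hnorm2 M g.
Proof.
move=> pF If Ig f0 g0.
have Ip := sq_integrable_bmeas (unif R) (bmeas_trig (trig_proj M f)).
have Iq := sq_integrable_bmeas (unif R) (bmeas_trig (trig_proj M g)).
apply: le_trans (cauchy_schwarz Ip (sq_integrable_preserving pF Iq)) _.
by rewrite sqnorm_preserving// ler_pM ?sqnorm_ge0// sqnorm_proj_le.
Qed.

(** Truncating both functions leaves three products with a small factor; composition with [F] keeps
    the truncation error of [g] small because it is an L^2 isometry. *)
Lemma norm_Rint_le_proj f g F (B : R) : preserving (unif R) F ->
  sq_integrable (unif R) f -> sq_integrable (unif R) g ->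
  (forall M, `|\int[unif R]_x (proj M f x * proj M g (F x))| <= B) ->
  `|\int[unif R]_x (f x * g (F x))| <= B.
Proof.
move=> pF If Ig HB; apply/ler_addgt0Pr => e e0.
pose c := Num.sqrt (sqnorm (unif R) f) + 1 + Num.sqrt (sqnorm (unif R) g).
have c0 : 0 < c by rewrite ltr_wpDr ?sqrtr_ge0// ltr_wpDl ?sqrtr_ge0.
(* The cap at 1 lets the product of the two truncation errors be bounded linearly in [u]. *)
pose u := Num.min (e / c) 1; have u0 : 0 < u by rewrite lt_min ltr01 divr_gt0.
have u2 : 0 < u ^+ 2 by rewrite exprn_gt0.
have uc : u * c <= e by rewrite -ler_pdivlMr// ge_min lexx.
have u1 : u <= 1 by rewrite ge_min lexx orbT.
have arith (a b r t : R) : 0 <= a -> 0 <= b -> 0 <= t -> 0 <= r -> a <= u -> t <= u ->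
    a * b + a * t + r * t <= u * (r + 1 + b).
  move=> a0 b0 t0 r0 au tu; rewrite !mulrDr addrC [u * r]mulrC -[leRHS]addrA.
  apply: lerD; first exact: ler_wpM2l.
  by rewrite addrC; apply: lerD; apply: ler_pM => //; exact: le_trans tu u1.
have [M1 H1] := proj_cvg If u2; have [M2 H2] := proj_cvg Ig u2.
pose M := maxn M1 M2; have {H1} := H1 M (leq_maxl _ _); have {H2} := H2 M (leq_maxr _ _).
have Ip := sq_integrable_bmeas (unif R) (bmeas_trig (trig_proj M f)).
have Iq := sq_integrable_bmeas (unif R) (bmeas_trig (trig_proj M g)).
have Idf := sq_integrableB If Ip; have Idg := sq_integrableB Ig Iq.
have sqle (h : plane R -> R) : sqnorm (unif R) h <= u ^+ 2 -> Num.sqrt (sqnorm (unif R) h) <= u.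
  by move=> hh; rewrite -(ger0_norm (ltW u0)) -sqrtr_sqr ler_sqrt ?sqr_ge0.
move=> /sqle dg /sqle df.
have IgF := sq_integrable_preserving pF Ig; have IqF := sq_integrable_preserving pF Iq.
have IdgF := sq_integrable_preserving pF Idg.
have E : \int[unif R]_x (f x * g (F x)) = \int[unif R]_x ((f x - proj M f x) * g (F x)) -
   \int[unif R]_x ((f x - proj M f x) * (g (F x) - proj M g (F x))) +
   \int[unif R]_x (f x * (g (F x) - proj M g (F x))) +
   \int[unif R]_x (proj M f x * proj M g (F x)).
  have i1 := sq_integrableM Idf IgF; have i2 := sq_integrableM Idf IdgF.
  have i3 := sq_integrableM If IdgF; have i4 := sq_integrableM Ip IqF.
  have j12 := integrableDR i1 (integrableZR (-1) i2).
  have j123 := integrableDR j12 i3.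
  transitivity (\int[unif R]_x ((f x - proj M f x) * g (F x) +
     -1 * ((f x - proj M f x) * (g (F x) - proj M g (F x))) +
     f x * (g (F x) - proj M g (F x)) + proj M f x * proj M g (F x))).
    by apply: eq_Rintegral => x _; ring.
  rewrite (RintegralD measurableT j123 i4) (RintegralD measurableT j12 i3).
  rewrite (RintegralD measurableT i1 (integrableZR (-1) i2)) RintegralZl//.
  by rewrite mulN1r.
rewrite E; apply: le_trans (ler_normD _ _) _; rewrite [leRHS]addrC.
apply: lerD; last exact: HB.
apply: le_trans (ler_normD _ _) _.
have h1 := norm_Rint_mul_le Idf IgF; have h2 := norm_Rint_mul_le Idf IdgF.
have h3 := norm_Rint_mul_le If IdgF.
have pgE : sqnorm (unif R) (fun x => g (F x) - proj M g (F x)) = sqnorm (unif R) (fun x => g x - proj M g x).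
  exact: (sqnorm_preserving pF Idg).
rewrite sqnorm_preserving// in h1; rewrite pgE in h2 h3.
have ng := sqrtr_ge0 (sqnorm (unif R) g); have nf := sqrtr_ge0 (sqnorm (unif R) f).
have ndg := sqrtr_ge0 (sqnorm (unif R) (fun x => g x - proj M g x)).
have ndf := sqrtr_ge0 (sqnorm (unif R) (fun x => f x - proj M f x)).
apply: le_trans (lerD (ler_normB _ _) h3) _.
apply: le_trans (lerD (lerD h1 h2) (lexx _)) _.
apply: le_trans uc; rewrite /c.
exact: (arith _ _ _ _ ndf ng ndg nf df dg).
Qed.

Lemma correlation_bound f g F (S H1 H2 : R) : preserving (unif R) F ->
  sq_integrable (unif R) f -> sq_integrable (unif R) g ->
  ccoef f (0, 0) = 0 -> ccoef g (0, 0) = 0 -> 0 <= S ->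
  (forall M, correlation2 M F <= S) ->
  (forall M, hnorm2 M f <= H1 ^+ 2) -> (forall M, hnorm2 M g <= H2 ^+ 2) -> 0 <= H1 -> 0 <= H2 ->
  `|\int[unif R]_x (f x * g (F x))| <= Num.sqrt (Num.min 1 S) * H1 * H2.
Proof.
move=> pF If Ig f0 g0 S0 HS Hf Hg H10 H20; apply: norm_Rint_le_proj => // M.
have HH : hnorm2 M f * hnorm2 M g <= (H1 * H2) ^+ 2 by rewrite exprMn ler_pM ?hnorm2_ge0.
have m0 : 0 <= Num.min 1 S by rewrite le_min ler01.
rewrite -mulrA -[H1 * H2]ger0_norm ?mulr_ge0// -!sqrtr_sqr -sqrtrM// ler_sqrt ?mulr_ge0 ?sqr_ge0//.
rewrite minr_pMl ?sqr_ge0// le_min mul1r; apply/andP; split.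
  exact: le_trans (sqr_Rint_proj_le1 M pF If Ig f0 g0) HH.
case: pF => mF _; apply: le_trans (sqr_Rint_proj_le M mF If f0 g0) _.
apply: ler_pM => //; last by rewrite mulr_ge0 ?hnorm2_ge0.
apply: sumr_ge0 => l _; rewrite mulr_ge0 ?invr_ge0 ?ksq_ge0//.
by apply: sumr_ge0 => k _; rewrite mulr_ge0 ?invr_ge0 ?ksq_ge0 ?acoef2_ge0.
Qed.

End bilinear.

(** * From the uniform probability to Lebesgue measure on the torus *)

Section proportional_measures.
Context d (T : measurableType d) (R : realType) (mu nu : {measure set T -> \bar R}).
Variables (D : set T) (c : R).
Hypotheses (mD : measurable D) (c0 : 0 < c)
  (nuE : forall A, measurable A -> A `<=` D -> nu A = (c%:E * mu A)%E).

Lemma ge0_integral_proportional (f : T -> \bar R) : measurable_fun D f ->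
  (forall x, D x -> 0 <= f x)%E ->
  (\int[nu]_(x in D) f x = c%:E * \int[mu]_(x in D) f x)%E.
Proof.
move=> mf f0; rewrite (eq_measure_integral (mscale (NngNum (ltW c0)) mu)); last first.
  by move=> A mA AD; rewrite nuE.
by rewrite ge0_integral_mscale.
Qed.

Lemma integrable_proportional (f : T -> \bar R) : nu.-integrable D f -> mu.-integrable D f.
Proof.
move=> /integrableP[mf If]; apply/integrableP; split => //.
move: If; rewrite ge0_integral_proportional//; last exact: measurableT_comp.
by case: (\int[mu]_(_ in _) _)%E => [r|//|//]; rewrite ?ltry// gt0_muley ?lte_fin.
Qed.

Lemma Rintegral_proportional (f : T -> R) : mu.-integrable D (EFin \o f) ->
  \int[nu]_(x in D) f x = c * \int[mu]_(x in D) f x.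
Proof.
move=> If; have mf : measurable_fun D (EFin \o f) by case/integrableP: If.
rewrite /Rintegral integralE [in RHS]integralE.
have mp := measurable_funepos mf; have mn := measurable_funeneg mf.
rewrite !ge0_integral_proportional//.
have fp : (\int[mu]_(x in D) ((EFin \o f)^\+ x) \is a fin_num)%E.
  by apply: integrable_fin_num => //; exact: integrable_funepos.
have fn : (\int[mu]_(x in D) ((EFin \o f)^\- x) \is a fin_num)%E.
  by apply: integrable_fin_num => //; exact: integrable_funeneg.
rewrite -muleBr//; last by rewrite fin_num_adde_defr.
by rewrite fineM// fin_numB fp fn.
Qed.

End proportional_measures.

Section torus_transfer.
Variable R : realType.
Implicit Types (f g : plane R -> R) (k : int * int).

Lemma leb2_unif (A : set (plane R)) : measurable A -> A `<=` torus ->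
  leb2 A = (((2 * pi) ^+ 2)%:E * unif R A)%E.
Proof.
move=> mA AT; rewrite unif_leb2// /uniform_torus (setIidl AT) muleA -EFinM.
by rewrite mulfV ?mul1e// expf_neq0// gt_eqF// twopi_gt0.
Qed.

Lemma sqr_twopi_gt0 : 0 < (2 * pi : R) ^+ 2.
Proof. by rewrite exprn_gt0// twopi_gt0. Qed.

Lemma restrictM f g : (f \_ torus) \* g = (fun x => f x * g x) \_ torus.
Proof. by apply/funext => x /=; rewrite /patch; case: ifP; rewrite ?mul0r. Qed.

Lemma Rint_torus f : (unif R).-integrable setT (EFin \o (f \_ torus)) ->
  \int[leb2]_(x in torus) f x = (2 * pi) ^+ 2 * \int[unif R]_x (f \_ torus) x.
Proof.
move=> If; rewrite (Rintegral_proportional (@measurable_torus R) sqr_twopi_gt0 leb2_unif).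
  by rewrite [in LHS]Rintegral_mkcond.
apply/integrable_mkcond; first exact: measurable_torus.
by move: If; congr (_.-integrable _ _); apply/funext => x /=; rewrite /patch; case: ifP.
Qed.

Lemma sq_integrable_torus f : measurable_fun torus f ->
  leb2.-integrable torus (fun x => (f x ^+ 2)%:E) -> sq_integrable (unif R) (f \_ torus).
Proof.
move=> mf /(integrable_proportional (@measurable_torus R) sqr_twopi_gt0 leb2_unif) If.
split; first by apply/(measurable_restrictT _ (@measurable_torus R)).
have /integrable_mkcond := If; move=> /(_ (@measurable_torus R)).
congr (_.-integrable _ _); apply/funext => x /=; rewrite /patch; case: ifP => //.
by rewrite expr0n.
Qed.

Lemma ccoef_torus f k : sq_integrable (unif R) (f \_ torus) ->
  \int[leb2]_(x in torus) (f x * cos (dotk k x)) = (2 * pi) ^+ 2 * ccoef (f \_ torus) k.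
Proof.
move=> If; rewrite Rint_torus -restrictM//.
exact: (sq_integrable_mul_bmeas If (bmeas_cosk R k)).
Qed.

Lemma scoef_torus f k : sq_integrable (unif R) (f \_ torus) ->
  \int[leb2]_(x in torus) (f x * sin (dotk k x)) = (2 * pi) ^+ 2 * scoef (f \_ torus) k.
Proof.
move=> If; rewrite Rint_torus -restrictM//.
exact: (sq_integrable_mul_bmeas If (bmeas_sink R k)).
Qed.

Lemma normc_fourier_coef f k : sq_integrable (unif R) (f \_ torus) ->
  ComplexField.Normc.normc (fourier_coef f k) ^+ 2 = (2 * pi) ^+ 2 * pcoef (f \_ torus) k.
Proof.
move=> If; rewrite /fourier_coef /ComplexField.Normc.normc sqr_sqrtr; last by rewrite addr_ge0 ?sqr_ge0.
rewrite ccoef_torus// scoef_torus// /pcoef.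
have := twopi_gt0 R; move: (2 * pi) => t t0.
by field; rewrite gt_eqF.
Qed.

Lemma hnorm2_le_Hdot1 M f : sq_integrable (unif R) (f \_ torus) -> (Hdot1_sq f < +oo)%E ->
  ccoef (f \_ torus) (0, 0) = 0 ->
  hnorm2 M (f \_ torus) <= ((2 * pi)^-1 * Hdot1_norm f) ^+ 2.
Proof.
move=> If Hf f0.
have H0 : (0 <= Hdot1_sq f)%E.
  by apply: esum_ge0 => k _; rewrite lee_fin mulr_ge0 ?sqr_ge0// (ksq_ge0 R k).
rewrite exprMn /Hdot1_norm sqr_sqrtr ?fine_ge0// exprVn mulrC ler_pdivlMr ?sqr_twopi_gt0//.
rewrite -lee_fin fineK ?ge0_fin_numE//.
have -> : hnorm2 M (f \_ torus) * (2 * pi) ^+ 2 = \sum_(k <- [seq k <- box M | k != (0, 0)])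
    ((k.1%:~R ^+ 2 + k.2%:~R ^+ 2) * ComplexField.Normc.normc (fourier_coef f k) ^+ 2).
  rewrite big_filter /hnorm2 mulr_suml [RHS]big_mkcond; apply: eq_bigr => k _.
  have [->|_] := eqVneq k (0, 0); first by rewrite pcoef0// mulr0 mul0r.
  by rewrite normc_fourier_coef// /ksq -mulrA [X in _ * X]mulrC.
rewrite -sumEFin.
apply: esum_ge.
exists [set` [seq k <- box M | k != (0, 0)]].
  split; first exact: finite_seq.
  by move=> k /=; rewrite mem_filter => /andP[].
rewrite fsbig_seq//.
by rewrite filter_uniq// uniq_box.
Qed.

End torus_transfer.

(** * The random constant *)

Section maximal.
Context d (T : measurableType d) (R : realType) (P : probability T R).

(** By monotone convergence the limit has finite mean, hence is finite almost everywhere. [fine]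
    makes it real-valued, with default 0 where the limit is infinite, and there the domination may
    fail. *)
Lemma monotone_envelope (Y : nat -> T -> R) (B : R) :
  (forall n, bmeas (Y n)) -> (forall n w, 0 <= Y n w) ->
  (forall w, {homo (fun n => Y n w) : n m / (n <= m)%N >-> n <= m}) ->
  (forall n, \int[P]_w Y n w <= B) ->
  exists Z : T -> R, [/\ measurable_fun setT Z, (forall w, 0 <= Z w),
    {ae P, forall w, forall n, Y n w <= Z w} & (\int[P]_w (Z w)%:E <= B%:E)%E].
Proof.
move=> bY Y0 ndY YB.
pose g n w := (Y n w)%:E; pose X w := limn (g ^~ w).
have mg n : measurable_fun setT (g n) by apply/measurable_EFinP; have [] := bY n.
have ndg w : {homo (g ^~ w) : n m / (n <= m)%N >-> (n <= m)%E}.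
  by move=> n m nm; rewrite lee_fin; exact: ndY.
have cX w : g ^~ w @ \oo --> X w by exact: ereal_nondecreasing_is_cvgn.
have gX n w : (g n w <= X w)%E.
  rewrite /X (cvg_lim _ (ereal_nondecreasing_cvgn (ndg w)))//.
  by apply: ereal_sup_ubound; exists n.
have X0 w : (0 <= X w)%E by apply: le_trans (gX 0%N w); rewrite lee_fin.
have mX : measurable_fun setT X by apply: (emeasurable_fun_cvg g X mg) => w _; exact: cX.
have IX : (\int[P]_w X w <= B%:E)%E.
  rewrite monotone_convergence//; last by move=> n w _; rewrite lee_fin.
  apply: lime_le; last by apply: nearW => n; rewrite -EFin_Rint// lee_fin.
  apply: ereal_nondecreasing_is_cvgn => n m nm; apply: ge0_le_integral => //.
  - by move=> w _; rewrite lee_fin.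
  - by move=> w _; exact: ndg.
have aeX : {ae P, forall w, X w \is a fin_num}.
  have : P.-integrable setT X.
    apply/integrableP; split => //.
    by rewrite (eq_integral X)//; [exact: le_lt_trans IX (ltry _)|move=> w _; rewrite gee0_abs].
  by move=> /(integrable_ae measurableT); apply: filterS => w; exact.
have fX w : ((fine (X w))%:E <= X w)%E by case: (X w) (X0 w) => [r|_|//] //=; rewrite leey.
exists (fine \o X); split.
- by apply: measurableT_comp => //; exact: fine_measurable.
- by move=> w /=; exact: fine_ge0.
- apply: filterS aeX => w fw n /=; rewrite -lee_fin fineK//; exact: gX.
- apply: le_trans IX; apply: ge0_le_integral => //.
  + by move=> w _; rewrite lee_fin fine_ge0.
  + by apply/measurable_EFinP; apply: measurableT_comp => //; exact: fine_measurable.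
  + by move=> w _; exact: fX.
Qed.

(** The shift by 1 makes the base at least 1, so a power with exponent [t * q <= 1] is below the
    base itself and the first moment suffices. *)
Lemma powR_moment (Z : T -> R) (B t q : R) : measurable_fun setT Z -> (forall w, 0 <= Z w) ->
  (\int[P]_w (Z w)%:E <= B%:E)%E -> 0 <= t -> t * q <= 1 ->
  ('E_P[fun w => (((1 + Z w) `^ t) `^ q)%R] <= (1 + B)%:E)%E.
Proof.
move=> mZ Z0 IZ t0 tq; rewrite unlock.
have m1Z : measurable_fun setT (fun w => 1 + Z w) by exact: measurable_funD.
apply: (@le_trans _ _ (\int[P]_w (1 + (Z w)%:E))%E).
  apply: ge0_le_integral => //.
  - by move=> w _; rewrite lee_fin powR_ge0.
  - apply/measurable_EFinP.
    apply: (measurableT_comp (measurable_powR q)).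
    exact: (measurableT_comp (measurable_powR t)).
  - by apply: emeasurable_funD => //; apply/measurable_EFinP.
  - move=> w _; rewrite -powRrM -EFinD lee_fin.
    by rewrite -[leRHS]powRr1 ?addr_ge0// ler_powR// lerDl.
rewrite ge0_integralD//; last by apply/measurable_EFinP.
  by rewrite integral_cst// [X in (_ * X)%E]probability_setT mule1 EFinD leeD2l.
by move=> w _; rewrite lee_fin.
Qed.

End maximal.

(** On [0, 1] the square root is the smaller of the two powers. The cap at 1 thus allows the
    exponent to be lowered from 1/2 to [t], trading decay in [u] for integrability in [Z]. *)
Lemma sqrt_min_le_powR (R : realType) (Z u t : R) : 0 <= Z -> 0 <= u -> 0 <= t -> t <= 2^-1 ->
  Num.sqrt (Num.min 1 (u * Z)) <= (1 + Z) `^ t * u `^ t.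
Proof.
move=> Z0 u0 t0 t1; have m0 : 0 <= Num.min 1 (u * Z) by rewrite le_min ler01 mulr_ge0.
have Z1 : 0 <= 1 + Z by rewrite addr_ge0.
rewrite -powR12_sqrt// -powRM//.
apply: (@le_trans _ _ (Num.min 1 (u * Z) `^ t)).
  have [->|mn0] := eqVneq (Num.min 1 (u * Z)) 0.
    by rewrite powR0 ?powR_ge0// invr_neq0.
  by apply: ger_powR => //; rewrite lt_neqAle eq_sym mn0 m0 ge_min lexx.
apply: ge0_ler_powR => //; rewrite ?nnegrE ?mulr_ge0//.
by rewrite mulrC ge_min; apply/orP; right; rewrite ler_wpM2r// lerDr.
Qed.

(** * Correlations on the torus for a fixed noise *)

Section quenched.
Variables (R : realType).
Implicit Types (phi psi : plane R -> R).

Lemma torus_chirikov_iter (K : R) (w : nat -> plane R) n x : torus x -> torus (chirikov_iter K w n x).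
Proof.
case: n => [//|n] _ /=; rewrite /chirikov /torus/= !in_itv/=.
by split; exact: mod2pi_itv.
Qed.

Lemma torus_correlation (K : R) (w : nat -> plane R) n (S : R) phi psi :
  0 <= S -> (forall M, correlation2 M (chirikov_iter K w n) <= S) ->
  H1_mean_zero phi -> H1_mean_zero psi ->
  `| \int[leb2]_(x in torus) (phi x * psi (chirikov_iter K w n x)) | <=
  Num.sqrt (Num.min 1 S) * Hdot1_norm phi * Hdot1_norm psi.
Proof.
move=> S0 HS [mphi iphi fphi zphi] [mpsi ipsi fpsi zpsi].
have Iphi := sq_integrable_torus mphi iphi; have Ipsi := sq_integrable_torus mpsi ipsi.
have c0 f : sq_integrable (unif R) (f \_ torus) -> \int[leb2]_(x in torus) f x = 0 ->
    ccoef (f \_ torus) (0, 0) = 0.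
  move=> If zf; have := ccoef_torus (0, 0) If.
  under eq_Rintegral do rewrite /dotk !mul0r addr0 cos0 mulr1.
  by rewrite zf => /esym/eqP; rewrite mulf_eq0 gt_eqF ?sqr_twopi_gt0//= => /eqP.
have Cphi := c0 _ Iphi zphi; have Cpsi := c0 _ Ipsi zpsi.
have pF := preserving_chirikov_iter K w n.
have E : (fun x => phi x * psi (chirikov_iter K w n x)) \_ torus =
   (phi \_ torus) \* (fun x => (psi \_ torus) (chirikov_iter K w n x)).
  apply/funext => x; rewrite /= /patch; case: ifPn => xT; last by rewrite mul0r.
  by rewrite mem_set//; apply: torus_chirikov_iter; rewrite -inE.
rewrite Rint_torus E; last exact: sq_integrableM Iphi (sq_integrable_preserving pF Ipsi).
have tp := twopi_gt0 R.
have H := correlation_bound pF Iphi Ipsi Cphi Cpsi S0 HS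
  (fun M => hnorm2_le_Hdot1 M Iphi fphi Cphi) (fun M => hnorm2_le_Hdot1 M Ipsi fpsi Cpsi).
rewrite normrM (ger0_norm (x := (2 * pi) ^+ 2)); last by rewrite ltW ?sqr_twopi_gt0.
apply: le_trans (ler_wpM2l (ltW (sqr_twopi_gt0 R)) (H _ _)) _.
- by rewrite mulr_ge0 ?sqrtr_ge0 ?invr_ge0 ?ltW.
- by rewrite mulr_ge0 ?sqrtr_ge0 ?invr_ge0 ?ltW.
(* The factor [(2 * pi) ^+ 2] of Lebesgue measure cancels the two factors [(2 * pi)^-1] that come
   from the normalisation of the Fourier coefficients. *)
rewrite le_eqVlt; apply/orP; left; apply/eqP.
by move: (2 * pi) tp => t t0; field; rewrite gt_eqF.
Qed.

End quenched.

(** * The time-weighted correlation and its mean *)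

Section annealed.
Variables (R : realType) (P : probability (noise R) R) (hP : is_uniform_product P) (K : R).

Lemma bmeas_correlation2 M n : bmeas (fun w : noise R => correlation2 M (chirikov_iter K w n)).
Proof.
apply: bmeas_sum => l; apply: bmeasM; first exact: bmeas_cst.
apply: bmeas_sum => k; apply: bmeasM; first exact: bmeas_cst.
exact: bmeas_acoef2_iter.
Qed.

Lemma correlation2_ge0 M (F : plane R -> plane R) : 0 <= correlation2 M F.
Proof.
apply: sumr_ge0 => l _; rewrite mulr_ge0 ?invr_ge0 ?ksq_ge0//.
by apply: sumr_ge0 => k _; rewrite mulr_ge0 ?invr_ge0 ?ksq_ge0 ?acoef2_ge0.
Qed.

Lemma box_mono (M N : nat) k : (M <= N)%N -> k \in box M -> k \in box N.
Proof.
by move=> MN; rewrite !mem_box => /andP[a b]; rewrite (leq_trans a MN) (leq_trans b MN).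
Qed.

Lemma correlation2_mono (M N : nat) (F : plane R -> plane R) : (M <= N)%N ->
  correlation2 M F <= correlation2 N F.
Proof.
move=> MN; rewrite /correlation2.
apply: (@le_trans _ _ (\sum_(l <- box M) (ksq R l)^-1 *
    \sum_(k <- box N) (ksq R k)^-1 * acoef2 F l k)).
  apply: ler_sum => l _; rewrite ler_wpM2l ?invr_ge0 ?ksq_ge0//.
  apply: ler_sum_uniq_sub; [exact: uniq_box|exact: uniq_box| |].
    by move=> k; exact: box_mono.
  by move=> k; rewrite mulr_ge0 ?invr_ge0 ?ksq_ge0 ?acoef2_ge0.
apply: ler_sum_uniq_sub; [exact: uniq_box|exact: uniq_box| |].
  by move=> k; exact: box_mono.
move=> l; rewrite mulr_ge0 ?invr_ge0 ?ksq_ge0//.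
by apply: sumr_ge0 => k _; rewrite mulr_ge0 ?invr_ge0 ?ksq_ge0 ?acoef2_ge0.
Qed.

Lemma mean_correlation2 (kap : nat) : 532 <= 2 ^+ kap :> R -> 2 * base%:R ^+ kap <= K ->
  forall M n, \int[P]_w correlation2 M (chirikov_iter K w n) <= 24 * (4 + 8 * base%:R) * 2^-1 ^+ n.
Proof.
move=> hk hK M n; apply: (le_trans _ (mean_acoef2_sum hP hk hK n M)).
have bA l k : bmeas (fun w : noise R => (ksq R k)^-1 * acoef2 (chirikov_iter K w n) l k).
  by apply: bmeasM; [exact: bmeas_cst|exact: bmeas_acoef2_iter].
have bS l : bmeas (fun w : noise R => \sum_(k <- box M) (ksq R k)^-1 * acoef2 (chirikov_iter K w n) l k).
  exact: bmeas_sum.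
rewrite Rint_sum; last by move=> l; apply: bmeasM; [exact: bmeas_cst|].
rewrite big_allpairs; apply: ler_sum => a _; apply: ler_sum => b _.
rewrite (RintZ P _ (bS _)) (Rint_sum P _ _ (bA _)) big_allpairs.
rewrite ler_wpM2l ?invr_ge0 ?ksq_ge0//.
apply: ler_sum => c _; apply: ler_sum => e _.
by rewrite RintZ//; exact: bmeas_acoef2_iter.
Qed.

(** One parameter truncates both time and frequency, so that a single monotone limit is taken. The
    weight [3 / 2] lies strictly between 1 and 2: against the halving of the means it leaves the
    summable [(3 / 4) ^+ n], and it still yields decay [(2 / 3) ^+ n]. *)
Definition weighted_correlation (M : nat) (w : noise R) : R :=
  \sum_(n < M) (3 / 2) ^+ n * correlation2 M (chirikov_iter K w n).

Lemma bmeas_weighted_correlation M : bmeas (weighted_correlation M).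
Proof.
apply: bmeas_sum => n; apply: bmeasM; first exact: bmeas_cst.
exact: bmeas_correlation2.
Qed.

Lemma weighted_correlation_ge0 M w : 0 <= weighted_correlation M w.
Proof.
by apply: sumr_ge0 => n _; rewrite mulr_ge0 ?exprn_ge0 ?divr_ge0 ?correlation2_ge0.
Qed.

Lemma weighted_correlation_mono w :
  {homo (fun M => weighted_correlation M w) : n m / (n <= m)%N >-> n <= m}.
Proof.
move=> M N MN; rewrite /weighted_correlation.
rewrite (big_ord_widen N (fun n => (3 / 2) ^+ n * correlation2 M (chirikov_iter K w n)) MN).
rewrite big_mkcond/=; apply: ler_sum => n _.
case: ifP => _; first by rewrite ler_wpM2l ?exprn_ge0 ?divr_ge0// correlation2_mono.
by rewrite mulr_ge0 ?exprn_ge0 ?divr_ge0// correlation2_ge0.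
Qed.

Lemma mean_weighted_correlation (kap : nat) : 532 <= 2 ^+ kap :> R -> 2 * base%:R ^+ kap <= K ->
  forall M, \int[P]_w weighted_correlation M w <= 4 * (24 * (4 + 8 * base%:R)).
Proof.
move=> hk hK M; set A := 24 * _; have A0 : 0 <= A by rewrite !(mulr_ge0, addr_ge0).
have bc n := bmeas_correlation2 M n.
rewrite /weighted_correlation Rint_sum; last by move=> n; apply: bmeasM; [exact: bmeas_cst|].
apply: (@le_trans _ _ (\sum_(n < M) A * (3 / 4) ^+ n)).
  apply: ler_sum => n _; rewrite RintZ//.
  apply: le_trans (ler_wpM2l _ (mean_correlation2 hk hK M n)) _; first by rewrite exprn_ge0 ?divr_ge0.
  rewrite mulrCA -exprMn (_ : 3 / 2 * 2^-1 = 3 / 4 :> R)//; by field.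
rewrite -mulr_sumr mulrC ler_wpM2r//.
have geo : \sum_(n < M) (3 / 4 : R) ^+ n = 4 * (1 - (3 / 4) ^+ M).
  elim: M {bc} => [|M IH]; first by rewrite big_ord0 expr0 subrr mulr0.
  by rewrite big_ord_recr/= IH exprS; field.
by rewrite geo ler_piMr// gerBl exprn_ge0// divr_ge0.
Qed.

Lemma correlation2_le_weighted M n w (Z : R) : (forall N, weighted_correlation N w <= Z) ->
  correlation2 M (chirikov_iter K w n) <= (2 / 3) ^+ n * Z.
Proof.
(* The truncation must contain both the box [M] and the time [n]. *)
move=> HZ; have := HZ (maxn M n.+1); set N := maxn M n.+1 => H.
have nN : (n < N)%N by rewrite leq_maxr.
have -> : (2 / 3) ^+ n = ((3 / 2) ^+ n)^-1 :> R by rewrite -exprVn invf_div.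
rewrite ler_pdivlMl ?exprn_gt0 ?divr_gt0//.
apply: le_trans H; rewrite /weighted_correlation (bigD1 (Ordinal nN))//= -[leLHS]addr0.
apply: lerD.
  by rewrite ler_wpM2l ?exprn_ge0 ?divr_ge0// correlation2_mono// leq_maxl.
by apply: sumr_ge0 => i _; rewrite mulr_ge0 ?exprn_ge0 ?divr_ge0 ?correlation2_ge0.
Qed.

End annealed.

Theorem theorem1p1 (R : realType) (P : probability (noise R) R)
    (hP : is_uniform_product P) (p : R) (hp0 : 0 < p) (hp1 : p < 2^-1) :
  exists K0 C1 C2 : R, [/\ 0 < K0, 0 < C1, 0 < C2 &
    forall q K : R, 0 < q -> K0 <= K ->
    exists D : {RV P >-> R}, [/\ forall w, 0 <= D w,
      {ae P, forall w : noise R, forall (n : nat) (phi psi : plane R -> R),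
        H1_mean_zero phi -> H1_mean_zero psi ->
        `| \int[leb2]_(x in torus) (phi x * psi (chirikov_iter K w n x)) |
        <= D w * expR (- (C1 / (1 + q) * expR (- K ^+ 265) * n%:R))
           * Hdot1_norm phi * Hdot1_norm psi} &
      ('E_P[fun w => (D w `^ q)%R] <= (C2 * K `^ p)%:E)%E]].
Proof.
have hk : 532 <= 2 ^+ 10 :> R by rewrite -natrX ler_nat.
set B : R := 4 * (24 * (4 + 8 * base%:R)).
have B0 : 0 <= B by rewrite !(mulr_ge0, addr_ge0).
have base1 : 1 <= base%:R ^+ 10 :> R by rewrite exprn_ege1// ler1n (ltn_trans _ base_gt1).
have ln32 : 0 < ln (3 / 2 : R) by rewrite ln_gt0// ltr_pdivlMr// mul1r ltr_nat.
(* [K0] is the threshold of the one-step contraction with [kap = 10], as [2 ^ 10 >= 532]. [C1] is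
   set so that [C1 / (1 + q) = t * ln (3 / 2)] for the exponent [t] below, and [C2] bounds the mean
   of [1 + Z]. *)
exists (2 * base%:R ^+ 10), (ln (3 / 2) / 2), (1 + B); split.
- by rewrite mulr_gt0// (lt_le_trans ltr01).
- by rewrite divr_gt0.
- by rewrite ltr_wpDr.
move=> q K q0 hK.
have K1 : 1 <= K by apply: le_trans hK; rewrite -[leLHS]mulr1 ler_pM// ler1n.
have [Z [mZ Z0 aeZ IZ]] := monotone_envelope (bmeas_weighted_correlation P K)
  (weighted_correlation_ge0 K) (weighted_correlation_mono K) (mean_weighted_correlation hP hk hK).
pose t : R := (2 * (1 + q))^-1.
have q1 : 0 < 1 + q by rewrite ltr_wpDr ?ltW.
have t0 : 0 <= t by rewrite invr_ge0 mulr_ge0// ltW.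
have t1 : t <= 2^-1.
  by rewrite lef_pV2 ?posrE ?mulr_gt0// ler_peMr// lerDl ltW.
have mD : measurable_fun setT (fun w => (1 + Z w) `^ t).
  by apply: (measurableT_comp (measurable_powR t)); exact: measurable_funD.
exists (mfun_Sub (mem_set mD)); split.
- by move=> w; exact: powR_ge0.
(* The only exceptional event is the failure of [Z] to dominate the truncations, so it depends on
   neither [n] nor the test functions. *)
- apply: filterS aeZ => w HZ n phi psi hphi hpsi.
  have H := torus_correlation _ (fun M => correlation2_le_weighted M n HZ) hphi hpsi.
  apply: le_trans (H _) _; first by rewrite mulr_ge0 ?exprn_ge0 ?divr_ge0.
  do 2 (apply: ler_wpM2r; first exact: sqrtr_ge0).
  have u0 : 0 <= (2 / 3 : R) ^+ n by rewrite exprn_ge0 ?divr_ge0.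
  apply: le_trans (sqrt_min_le_powR (Z0 w) u0 t0 t1) _.
  apply: ler_wpM2l; first exact: powR_ge0.
  have -> : (2 / 3) ^+ n = expR (- (ln (3 / 2) * n%:R)) :> R.
    rewrite expRN [ln _ * _]mulrC expRM_natl lnK ?posrE ?divr_gt0//.
    by rewrite -exprVn invf_div.
  rewrite -expRM ler_expR mulNr lerN2.
  (* The rate reached is [t * ln (3 / 2)], uniformly in [K]; the extra factor of the stated rate is
     at most 1. *)
  have e1 : expR (- K ^+ 265) <= 1 by rewrite -expR0 ler_expR oppr_le0 exprn_ge0 ?(le_trans ler01).
  have -> : ln (3 / 2) / 2 / (1 + q) * expR (- K ^+ 265) * n%:R =
     ln (3 / 2) * n%:R * t * expR (- K ^+ 265).
    by rewrite /t; field; rewrite gt_eqF.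
  by apply: ler_piMr => //; rewrite !mulr_ge0// ltW.
have tq : t * q <= 1.
  rewrite /t mulrC ler_pdivrMr ?mulr_gt0// mul1r; lra.
apply: le_trans (powR_moment (q := q) mZ Z0 IZ t0 tq) _.
(* The moment bound does not depend on [K], and [K ^ p >= 1] because [K >= 1] and [p > 0]. *)
rewrite lee_fin ler_peMr ?addr_ge0//.
by rewrite -(powRr0 K) ler_powR// ltW.
Qed.
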